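(* Let $\mathcal{H}$ denote either $\operatorname{Homeo}_0(\mathbf{T}^2)$ or its subspace $\operatorname{Homeo}_{0,\lambda}(\mathbf{T}^2)$ of Lebesgue-area-preserving homeomorphisms, endowed with the uniform $C^0$ topology (the statement holds in both cases). The set of all $f\in\mathcal{H}$ whose rotation set is stable (in $\mathcal{H}$) is open and dense in $\mathcal{H}$. Moreover, the rotation set of every such $f$ is a convex polygon with rational vertices (vertices in $\mathbf{Q}^2$), and when $\mathcal{H}=\operatorname{Homeo}_{0,\lambda}(\mathbf{T}^2)$ this polygon has nonempty interior.
   Context: $\mathbf{T}^2=\mathbf{R}^2/\mathbf{Z}^2$ with projection $\pi:\mathbf{R}^2\to\mathbf{T}^2$; $\operatorname{Homeo}_0(\mathbf{T}^2)$ is the space of homeomorphisms of $\mathbf{T}^2$ isotopic to the identity, with the uniform $C^0$ distance $d_{C^0}(f,g)=\sup_x d(f(x),g(x))$. For a lift $\tilde f:\mathbf{R}^2\to\mathbf{R}^2$ of $f$, the rotation set $\rho(\tilde f)$ is the set of all limits $\lim_{k\to\infty}(\tilde f^{n_k}(z_k)-z_k)/n_k$ over sequences $z_k\in\mathbf{R}^2$ and $n_k\to\infty$; it is compact and convex. Different lifts give rotation sets differing by an integer translation, and $\rho(f)$ denotes $\rho(\tilde f)$ regarded modulo integer translations. For $\delta>0$, $\rho(f)$ is $\delta$-stable (in $\mathcal{H}$) if every $g\in\mathcal{H}$ with $d_{C^0}(f,g)<\delta$ satisfies $\rho(g)=\rho(f)$ (as sets modulo integer translations); it is stable if it is $\delta$-stable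 for some $\delta>0$. *)

(* Defs.v *)
From HB Require Import structures.
From mathcomp Require Import all_boot all_order all_algebra.
From mathcomp Require Import all_classical all_reals all_analysis.
Set Implicit Arguments. Unset Strict Implicit. Unset Printing Implicit Defensive.
Import Order.TTheory GRing.Theory Num.Theory.
Import numFieldNormedType.Exports.
Local Open Scope classical_set_scope.
Local Open Scope ring_scope.

Section Torus.
Variable R : realType.

Definition pt := (R * R)%type.

Definition padd (x y : pt) : pt := (x.1 + y.1, x.2 + y.2).
Definition psub (x y : pt) : pt := (x.1 - y.1, x.2 - y.2).
Definition pscale (c : R) (x : pt) : pt := (c * x.1, c * x.2).
Definition enorm (x : pt) : R := Num.sqrt (x.1 ^+ 2 + x.2 ^+ 2).

Definition zvec (a b : int) : pt := (a%:~R, b%:~R).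

(* flat distance on T^2 = R^2/Z^2 between the projections of x and y *)
Definition tdist (x y : pt) : R :=
  inf [set enorm (psub (psub x y) (zvec a b)) | a in [set: int] & b in [set: int]].

Definition Zequivariant (F : pt -> pt) : Prop :=
  forall (a b : int) (z : pt), F (padd z (zvec a b)) = padd (F z) (zvec a b).

Definition homeomorphism (F : pt -> pt) : Prop :=
  continuous F /\ exists G : pt -> pt, continuous G /\ cancel F G /\ cancel G F.

(* F is a lift of an element of Homeo_0(T^2): a Z^2-equivariant homeomorphism
   of R^2 joined to the identity by an isotopy through Z^2-equivariant
   homeomorphisms (the lift of an isotopy from id_{T^2} to f). *)
Definition lift_homeo0 (F : pt -> pt) : Prop :=
  homeomorphism F /\ Zequivariant F /\
  exists H : R * pt -> pt,
    {within [set p : R * pt | 0 <= p.1 <= 1], continuous H} /\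
    (forall z, H (0, z) = z) /\ (forall z, H (1, z) = F z) /\
    (forall t, 0 <= t <= 1 ->
       homeomorphism (fun z => H (t, z)) /\ Zequivariant (fun z => H (t, z))).

Definition leb2 := ((@lebesgue_measure R) \x (@lebesgue_measure R))%E.

(* the lift preserves Lebesgue measure on R^2, equivalently the induced
   homeomorphism of T^2 preserves Lebesgue (Haar) measure on T^2 *)
Definition area_preserving (F : pt -> pt) : Prop :=
  forall A : set pt, measurable A -> leb2 (F @^-1` A) = leb2 A.

(* the space H: [area = false] is Homeo_0(T^2), [area = true] is
   Homeo_{0,lambda}(T^2); elements are represented by their lifts *)
Definition inH (area : bool) (F : pt -> pt) : Prop :=
  lift_homeo0 F /\ (area -> area_preserving F).

Definition dC0 (F G : pt -> pt) : R :=
  sup [set tdist (F z) (G z) | z in [set: pt]].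

Definition rotation_set (F : pt -> pt) : set pt :=
  [set w | exists (z : nat -> pt) (n : nat -> nat),
     (forall M : nat, exists K : nat, forall k, (K <= k)%N -> (M <= n k)%N) /\
     (fun k => pscale (n k)%:R^-1 (psub (iter (n k) F (z k)) (z k))) @ \oo --> w].

Definition translate (A : set pt) (v : pt) : set pt := [set padd x v | x in A].

Definition same_rot_mod_Z2 (F G : pt -> pt) : Prop :=
  exists a b : int, rotation_set G = translate (rotation_set F) (zvec a b).

Definition delta_stable (area : bool) (delta : R) (F : pt -> pt) : Prop :=
  forall G, inH area G -> dC0 F G < delta -> same_rot_mod_Z2 F G.

Definition stable (area : bool) (F : pt -> pt) : Prop :=
  exists delta : R, 0 < delta /\ delta_stable area delta F.

Definition rational_polygon (A : set pt) : Prop :=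
  exists (n : nat) (p : 'I_n -> (rat * rat)%type), (0 < n)%N /\
    A = [set x | exists l : 'I_n -> R, (forall i, 0 <= l i) /\
           \sum_(i < n) l i = 1 /\
           x = (\sum_(i < n) l i * ratr (p i).1, \sum_(i < n) l i * ratr (p i).2)].

Definition nonempty_interior (A : set pt) : Prop :=
  exists (w : pt) (e : R), 0 < e /\ (forall x, enorm (psub x w) < e -> A x).

End Torus.

(* Main.v *)
(* Cut the plane into the cells [C_k] of a fine Z^2-invariant grid and attach to
   a lift [F] the graph of the pairs [(k, l)] such that [F C_k] meets [C_l].
   - Every orbit follows a walk of the graph, and a walk is made of closed walks
     of bounded length, so the rotation set lies in the convex hull of the finitely
     many mean displacements of short closed walks, a rational polygon.
   - Perturb [F] so that the number of pairs of cells with [F (int C_k)] meeting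
     [int C_l] is locally maximal; a small translation then turns any contact
     between closed cells into an intersection of interiors, hence the graph cannot
     grow under small perturbations.
   - Commutators of thin shears are area preserving and supported in thin boxes.
     Composing with such maps, which preserve every cell and hence the graph, makes
     every short closed walk the itinerary of a periodic orbit.
   - Near a periodic point, a small horizontal shear followed by a steep vertical
     one gives the displacement of the return map the boundary behaviour of the
     Poincare-Miranda theorem, so the periodic orbit survives C^0 perturbations.
   - Vectors realised by orbit segments of every large length form a closed set
     which is convex because a lift embeds the fundamental domain disjointly from
     its integer translates (Misiurewicz-Ziemian).
   So near the perturbed map the rotation set is exactly the polygon.  In the
   area-preserving case Poincare recurrence puts every edge of the graph on a closed
   walk, and adjacent cells have a common successor; if the closed walks had
   collinear means, walking across the torus would force the line to be trivial. *)

(* Both values of [area] share one argument because every perturbation is a post-composition with a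
   finite product of periodic Lipschitz shears ([shmap]), which preserve area, are isotopic to the
   identity and have inverses of the same kind. The inverse matters: the map [h] that closes the
   walks has size up to [1 / N], which need not be below the tolerance of the maximal graph, so maps
   near [h \o F1] are controlled by undoing [h], at the cost of a Lipschitz constant. The obstacle
   to robustness is that a C^0 perturbation can remove a fixed point of index zero. Degree theory is
   replaced by counting quarter turns of quadrant labels on a fine grid; the same count yields the
   half-chord statement behind convexity. An arbitrary stable map gets its polygon from an
   approximating map inside its own stability radius. *)
Require Import Defs.
From HB Require Import structures.
From mathcomp Require Import all_boot all_order all_algebra.
From mathcomp Require Import all_classical all_reals all_analysis.
From mathcomp Require Import measurable_realfun.
From mathcomp Require Import zify ring lra.
Set Implicit Arguments. Unset Strict Implicit. Unset Printing Implicit Defensive.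
Import Order.TTheory GRing.Theory Num.Theory.
Import numFieldNormedType.Exports.
Local Open Scope classical_set_scope.
Local Open Scope ring_scope.

(** * Continuity in the sup norm *)

Section Near.
Variable R : realType.
Implicit Types (p q z w : pt R) (F G : pt R -> pt R) (e d : R).

(** Closed balls of the sup norm: membership is four linear inequalities, so later estimates reduce
    to linear arithmetic. The Euclidean norm returns only for the torus distance and the
    interior. *)
Definition near2 e p q : Prop := `|p.1 - q.1| <= e /\ `|p.2 - q.2| <= e.

Lemma near2P e p q : near2 e p q <->
  [/\ p.1 - q.1 <= e, q.1 - p.1 <= e, p.2 - q.2 <= e & q.2 - p.2 <= e].
Proof.
rewrite /near2 !ler_norml; split.
  by move=> [/andP[a b] /andP[c d]]; split => //; lra.
by move=> [a b c d]; split; apply/andP; split; lra.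
Qed.

Lemma near2_refl e p : 0 <= e -> near2 e p p.
Proof. by move=> e0; apply/near2P; split; lra. Qed.

Lemma near2_sym e p q : near2 e p q -> near2 e q p.
Proof. by move=> /near2P[a b c d]; apply/near2P; split; lra. Qed.

Lemma near2_trans p q z d e : near2 d p q -> near2 e q z -> near2 (d + e) p z.
Proof.
by move=> /near2P[a b c f] /near2P[a' b' c' f']; apply/near2P; split; lra.
Qed.

Lemma near2_le d e p q : d <= e -> near2 d p q -> near2 e p q.
Proof. by move=> de /near2P[a b c f]; apply/near2P; split; lra. Qed.

Definition cont2 F : Prop := forall z e, 0 < e ->
  exists2 d : R, 0 < d & forall w, near2 d z w -> near2 e (F z) (F w).

Lemma nbhs_near2P z (A : set (pt R)) :
  nbhs z A <-> exists2 d : R, 0 < d & forall w, near2 d z w -> A w.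
Proof.
split => [/nbhs_ballP[d /= d0 h]|[d d0 h]].
  exists (d / 2); first by rewrite divr_gt0.
  move=> w [a b]; apply: h; split; rewrite /ball /=.
    by apply: le_lt_trans a _; lra.
  by apply: le_lt_trans b _; lra.
apply/nbhs_ballP; exists d => // w [a b]; apply: h; split; exact: ltW.
Qed.

Lemma cont2P F : continuous F <-> cont2 F.
Proof.
split => [cF z e e0|cF z A /nbhs_near2P[e e0 h]].
  have /(cF z) : nbhs (F z) [set w | near2 e (F z) w] by apply/nbhs_near2P; exists e.
  by move=> /nbhs_near2P.
by have [d d0 hd] := cF z e e0; apply/nbhs_near2P; exists d => // w /hd /h.
Qed.

Definition unitsq z : Prop := [/\ 0 <= z.1, z.1 <= 1, 0 <= z.2 & z.2 <= 1].

(** A Lebesgue number argument. Only the first point is confined to the square, so pairs straddling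
    its boundary are covered. *)
Lemma uniformize (P : pt R -> pt R -> Prop) :
  (forall z, unitsq z -> exists2 d : R, 0 < d &
     forall w w', near2 d z w -> near2 d z w' -> P w w') ->
  exists2 d : R, 0 < d & forall w w', unitsq w -> near2 d w w' -> P w w'.
Proof.
move=> h.
have K : compact (`[0 : R, 1] `*` `[0 : R, 1])%classic.
  by apply: compact_setX; exact: segment_compact.
move/compact_near_coveringP : K => /(_ nat \oo%classic
  (fun n w => forall w', near2 (n.+1%:R^-1) w w' -> P w w') _).
case.
  move=> z /= [z1 z2].
  have [|d d0 hd] := h z.
    by move: z1 z2; rewrite !in_itv /= => /andP[? ?] /andP[? ?].
  have dh : 0 < d / 2 by rewrite divr_gt0.
  have [n _ hn] := near_infty_natSinv_lt (PosNum dh).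
  exists ([set w | near2 (d / 2) z w], [set m | (n <= m)%N]).
    split; first by apply/nbhs_near2P; exists (d / 2) => //; rewrite divr_gt0.
    by exists n.
  move=> [w m] /= [zw nm] w' ww'; apply: hd.
    by apply: near2_le zw; lra.
  have := hn m nm; rewrite /= => lt.
  have -> : d = d / 2 + d / 2 by lra.
  by apply: near2_trans zw _; apply: near2_le ww'; exact: ltW.
move=> n _ hn; exists n.+1%:R^-1; first by rewrite invr_gt0 ltr0n.
move=> w w' [a b c d] ww'; apply: (hn n (leqnn n) w) => //=.
by split; rewrite /= in_itv /=; apply/andP.
Qed.

End Near.

(** * Planar winding numbers on grids *)

Variant quad := Q0 | Q1 | Q2 | Q3.

Definition qopp a := match a with Q0 => Q2 | Q1 => Q3 | Q2 => Q0 | Q3 => Q1 end.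

Definition qval a : int := match a with Q0 => 0 | Q1 => 1 | Q2 => 2 | Q3 => 3 end.

(* The signed number of quarter turns from [a] to [b]; junk on opposite quadrants. *)
Definition qstep a b : int := match a, b with
  | Q0, Q1 | Q1, Q2 | Q2, Q3 | Q3, Q0 => 1
  | Q1, Q0 | Q2, Q1 | Q3, Q2 | Q0, Q3 => -1
  | _, _ => 0 end.

(** Discrete closedness: when no two corners of a cell carry opposite labels, both ways around it
    make the same number of quarter turns. This stands for the vanishing of the winding number of a
    loop that bounds a disc missing the origin. *)
Lemma qstep_cell a b c d : b <> qopp a -> c <> qopp b -> d <> qopp a ->
  c <> qopp d -> c <> qopp a -> d <> qopp b ->
  qstep a b + qstep b c = qstep a d + qstep d c.
Proof. by case: a; case: b; case: c; case: d. Qed.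

Lemma qstep_anti a b : qstep a b + qstep b a = 0.
Proof. by case: a; case: b. Qed.

Lemma qstep_opp a b : qstep (qopp a) (qopp b) = qstep a b.
Proof. by case: a; case: b. Qed.

Lemma qstep_val a b : b <> qopp a -> exists k : int, qstep a b = qval b - qval a + 4 * k.
Proof.
by case: a; case: b => //= _;
  first [exists 0; done | exists 1; done | exists (-1); done].
Qed.

Definition qind a b : int := match a, b with
  | Q0, Q0 | Q1, Q1 | Q2, Q2 | Q3, Q3 => 1 | _, _ => 0 end.

Lemma qstep_ind a b c c' : qstep a b = 1 -> c = a \/ c = b -> c' = a \/ c' = b ->
  qstep c c' = qind b c' - qind b c.
Proof. by case: a; case: b => //= _ [] -> [] ->. Qed.

(** [phi] is a potential for [qstep] on the labels allowed by [A], so the turn along a side depends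
    only on its ends. For two neighbouring quadrants [qstep_ind] provides one. *)
Lemma lift_tele n (q : nat -> quad) (L : nat -> int) (A : quad -> Prop) (phi : quad -> int) :
  (forall i, (i < n)%N -> L i.+1 - L i = qstep (q i) (q i.+1)) ->
  (forall i, (i <= n)%N -> A (q i)) ->
  (forall a b, A a -> A b -> qstep a b = phi b - phi a) ->
  L n - L 0%N = phi (q n) - phi (q 0%N).
Proof.
elim: n => [|n IH] hL hA hphi; first by rewrite !subrr.
have := hL n (ltnSn n); rewrite hphi; [|exact: hA|exact: hA].
have := IH (fun i h => hL i (ltnW h)) (fun i h => hA i (leqW h)) hphi.
lia.
Qed.

Lemma lift_mod4 n (q : nat -> quad) (L : nat -> int) :
  (forall i, (i < n)%N -> L i.+1 - L i = qstep (q i) (q i.+1)) ->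
  (forall i, (i < n)%N -> q i.+1 <> qopp (q i)) ->
  exists k : int, L n - L 0%N = qval (q n) - qval (q 0%N) + 4 * k.
Proof.
elim: n => [|n IH] hL hA; first by exists 0; rewrite !subrr.
have := hL n (ltnSn n); have [k ->] := qstep_val (hA n (ltnSn n)).
have [k' h'] := IH (fun i h => hL i (ltnW h)) (fun i h => hA i (ltnW h)).
by move=> h; exists (k + k'); lia.
Qed.

(** A discrete Poincare lemma: [L] is a lift of the angle, counted in quarter turns. *)
Lemma grid_lift n (l : nat -> nat -> quad) :
  (forall i j (a b c d : bool), (i < n)%N -> (j < n)%N ->
     l (i + a)%N (j + b)%N <> qopp (l (i + c)%N (j + d)%N)) ->
  exists L : nat -> nat -> int,
    (forall i j, (i < n)%N -> (j <= n)%N -> L i.+1 j - L i j = qstep (l i j) (l i.+1 j)) /\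
    (forall i j, (i <= n)%N -> (j < n)%N -> L i j.+1 - L i j = qstep (l i j) (l i j.+1)).
Proof.
move=> h.
(* Integration up column 0, then along row [j]. Horizontal increments hold by construction; vertical
   ones follow from [qstep_cell] by induction on [i]. *)
pose L i j : int := \sum_(a < j) qstep (l 0%N a) (l 0%N a.+1)
                  + \sum_(a < i) qstep (l a j) (l a.+1 j).
have Lx i j : L i.+1 j - L i j = qstep (l i j) (l i.+1 j).
  by rewrite /L big_ord_recr /= addrA [LHS]addrC addKr.
exists L; split => // i j; elim: i => [|i IH] hi hj.
  by rewrite /L !big_ord0 !addr0 big_ord_recr /= [LHS]addrC addKr.
have := IH (ltnW hi) hj; have := Lx i j; have := Lx i j.+1.
have hh a b c d := h i j a b c d hi hj.
have := @qstep_cell (l i j) (l i.+1 j) (l i.+1 j.+1) (l i j.+1).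
move: (hh true false false false) (hh true true true false) (hh false true false false)
  (hh true true false true) (hh true true false false) (hh false true true false).
by rewrite !addn0 !addn1 => a b c d e f /(_ a b c d e f); lia.
Qed.

Section Quadrants.
Variable R : realType.
Implicit Types (p q z w : pt R) (f : pt R -> pt R).

(** The quadrants are half-open in rotational order, so they partition the punctured plane and the
    antipodal map acts exactly as [qopp]. The origin gets [Q3] by default. *)
Definition lab p : quad :=
  if (0 < p.1) && (0 <= p.2) then Q0 else
  if (p.1 <= 0) && (0 < p.2) then Q1 else
  if (p.1 < 0) && (p.2 <= 0) then Q2 else Q3.

Lemma lab_spec p : p <> (0, 0) -> match lab p with
  | Q0 => 0 < p.1 /\ 0 <= p.2 | Q1 => p.1 <= 0 /\ 0 < p.2
  | Q2 => p.1 < 0 /\ p.2 <= 0 | Q3 => 0 <= p.1 /\ p.2 < 0 end.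
Proof.
case: p => x y n; rewrite /lab /=.
have nn : x = 0 -> y = 0 -> False by move=> *; apply: n; congr pair.
clear n.
case: (ltrgtP x 0) => hx; case: (ltrgtP y 0) => hy //=; try by split; lra.
Qed.

Lemma lab_opp p : p <> (0, 0) -> lab (- p.1, - p.2) = qopp (lab p).
Proof.
case: p => x y n; rewrite /lab /=.
have nn : x = 0 -> y = 0 -> False by move=> *; apply: n; congr pair.
clear n.
rewrite !oppr_gt0 !oppr_ge0 !oppr_le0 !oppr_lt0.
case: (ltrgtP x 0) => hx; case: (ltrgtP y 0) => hy //=.
by case: nn.
Qed.

Lemma lab_near p : p <> (0, 0) -> exists2 d : R, 0 < d &
  forall q q', near2 d p q -> near2 d p q' -> lab q <> qopp (lab q').
Proof.
move=> np.
have [m m0 hm] : exists2 m : R, 0 < m & m <= `|p.1| \/ m <= `|p.2|.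
  have [p1|p1] := eqVneq p.1 0.
    exists `|p.2|; last by right.
    rewrite normr_gt0; apply/eqP => p2; apply: np.
    by case: p p1 p2 => /= ? ? -> ->.
  by exists `|p.1|; [rewrite normr_gt0 | left].
(* Within [m / 8] the coordinate of size at least [m] keeps a strict sign, whereas opposite
   quadrants have opposite weak signs in each coordinate. *)
exists (m / 8); first by lra.
move=> q q' nq nq'.
have nz r : near2 (m / 8) p r -> r <> (0, 0).
  move=> + r0; rewrite r0 => -[/= a b]; rewrite !subr0 in a b.
  by case: hm; lra.
have := lab_spec (nz _ nq); have := lab_spec (nz _ nq'); clear nz np.
move/near2P : nq => [a b c d]; move/near2P : nq' => [a' b' c' d'].
case: (lab q') => -[h1 h2]; case: (lab q) => -[h3 h4] //= _; case: hm;
  rewrite ler_normr => /orP[]; lra.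
Qed.

Lemma unitsq_grid n i j : (0 < n)%N -> (i <= n)%N -> (j <= n)%N ->
  unitsq (i%:R / n%:R : R, j%:R / n%:R).
Proof.
move=> n0 hi hj; have n0' : 0 < n%:R :> R by rewrite ltr0n.
split => /=; rewrite ?divr_ge0// ler_pdivrMr// mul1r ler_nat//.
Qed.

Lemma cont_grid_lift f : cont2 f -> (forall z, unitsq z -> f z <> (0, 0)) ->
  exists n (L : nat -> nat -> int),
    let l i j := lab (f (i%:R / n%:R, j%:R / n%:R)) in
    [/\ (0 < n)%N,
     forall i j, (i < n)%N -> (j <= n)%N -> L i.+1 j - L i j = qstep (l i j) (l i.+1 j),
     forall i j, (i <= n)%N -> (j < n)%N -> L i j.+1 - L i j = qstep (l i j) (l i j.+1) &
     forall i j, (i <= n)%N -> (j < n)%N -> l i j.+1 <> qopp (l i j)].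
Proof.
move=> cf nf.
have [d d0 hd] : exists2 d : R, 0 < d & forall w w', unitsq w -> near2 d w w' ->
    lab (f w) <> qopp (lab (f w')).
  apply: uniformize => z uz.
  have [e e0 he] := lab_near (nf z uz).
  by have [d d0 hd] := cf z e e0; exists d => // w w' /hd h /hd h'; exact: he.
have [m _ hm] := near_infty_natSinv_lt (PosNum d0).
pose n := m.+1; exists n.
have hn := hm m (leqnn m); rewrite /= in hn.
pose l i j := lab (f (i%:R / n%:R, j%:R / n%:R)).
have n0 : 0 < n%:R :> R by rewrite ltr0n.
have hstep (i : nat) (a c : bool) : `|(i + a)%N%:R / n%:R - (i + c)%N%:R / n%:R : R| <= d.
  rewrite -mulrBl normrM (gtr0_norm (_ : 0 < n%:R^-1)) ?invr_gt0//.
  apply: le_trans (ltW hn); rewrite ler_piMl// ?invr_ge0 ?ler0n// !natrD.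
  by case: a; case: c; rewrite /= ?mulr1n ?mulr0n ler_norml; apply/andP; split; lra.
have hl i j (a b c e : bool) : (i < n)%N -> (j < n)%N ->
    l (i + a)%N (j + b)%N <> qopp (l (i + c)%N (j + e)%N).
  move=> hi hj; apply: hd; last by split; exact: hstep.
  by apply: unitsq_grid => //; [case: a | case: b]; rewrite ?addn0 ?addn1 // ltnW.
have [L [L1 L2]] := grid_lift hl.
exists L; split => // i j hi hj.
move: hi; rewrite leq_eqVlt => /orP[/eqP ->|hi].
  by have := hl m j true true true false (ltnSn m) hj; rewrite !addn1 addn0.
by have := hl i j false true false false hi hj; rewrite !addn1 !addn0.
Qed.

Lemma maxr_lip (a b a' b' d : R) : `|a - a'| <= d -> `|b - b'| <= d ->
  `|Num.max a b - Num.max a' b'| <= d.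
Proof.
rewrite !ler_norml => /andP[? ?] /andP[? ?].
by case: (leP a b) => ?; case: (leP a' b') => ?; apply/andP; split; lra.
Qed.

Lemma minr_lip (a b a' b' d : R) : `|a - a'| <= d -> `|b - b'| <= d ->
  `|Num.min a b - Num.min a' b'| <= d.
Proof.
rewrite !ler_norml => /andP[? ?] /andP[? ?].
by case: (leP a b) => ?; case: (leP a' b') => ?; apply/andP; split; lra.
Qed.

Definition cont_path (c : R -> pt R) : Prop := forall t e : R, 0 < e ->
  exists2 d : R, 0 < d & forall s, `|t - s| <= d -> near2 e (c t) (c s).

(* The chord map [c t - c s - v] on the triangle [s <= t] is constant on the
   diagonal and antipodal on the two other sides, so its boundary loop has odd
   winding number around the origin. *)
Lemma half_chord (c : R -> pt R) (v : pt R) : cont_path c ->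
  c 1 = ((c 0).1 + 2 * v.1, (c 0).2 + 2 * v.2) ->
  exists s t : R, [/\ 0 <= s, s <= t, t <= 1 &
    c t = ((c s).1 + v.1, (c s).2 + v.2)].
Proof.
move=> cc c1; apply: contrapT => nch.
have nch' s t : 0 <= s -> s <= t -> t <= 1 -> c t <> ((c s).1 + v.1, (c s).2 + v.2).
  by move=> h1 h2 h3 h4; apply: nch; exists s, t.
(* [max] and [min] extend the chord map symmetrically from the triangle to the square, where the
   grid lemma applies. *)
pose f z : pt R := ((c (Num.max z.1 z.2)).1 - (c (Num.min z.1 z.2)).1 - v.1,
             (c (Num.max z.1 z.2)).2 - (c (Num.min z.1 z.2)).2 - v.2).
have cf : cont2 f.
  move=> z e e0.
  have e2 : 0 < e / 2 by rewrite divr_gt0.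
  have [d1 d10 h1] := cc (Num.max z.1 z.2) _ e2.
  have [d2 d20 h2] := cc (Num.min z.1 z.2) _ e2.
  exists (Num.min d1 d2); first by rewrite lt_min d10.
  move=> w [zw1 zw2].
  have l1 : Num.min d1 d2 <= d1 by rewrite ge_min lexx.
  have l2 : Num.min d1 d2 <= d2 by rewrite ge_min lexx orbT.
  have {}h1 := h1 _ (le_trans (maxr_lip zw1 zw2) l1).
  have {}h2 := h2 _ (le_trans (minr_lip zw1 zw2) l2).
  move/near2P : h1 => [? ? ? ?]; move/near2P : h2 => [? ? ? ?].
  by apply/near2P; split; rewrite /f /=; lra.
have nf z : unitsq z -> f z <> (0, 0).
  move=> [z1 z2 z3 z4] [e1 e2].
  apply: (@nch' (Num.min z.1 z.2) (Num.max z.1 z.2)).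
  - by rewrite le_min z1.
  - by rewrite ge_min le_max lexx.
  - by rewrite ge_max z2.
  - by rewrite [LHS]surjective_pairing; congr pair; lra.
have [n [L]] := cont_grid_lift cf nf.
set l := fun i j : nat => _ => /= -[n0 Lx Ly nopp].
have n0' : n%:R != 0 :> R by rewrite pnatr_eq0 -lt0n.
have diag i : l i i = lab (- v.1, - v.2).
  by rewrite /l /f /= maxxx minxx !subrr !sub0r.
have Ldiag i : (i <= n)%N -> L i i = L 0%N 0%N.
  elim: i => // i IH hi; rewrite -(IH (ltnW hi)).
  have := Lx i i hi (ltnW hi); have := Ly i.+1 i hi hi.
  by have := qstep_anti (l i i) (l i.+1 i); rewrite !diag; lia.
have sym i : (i <= n)%N -> l i n = qopp (l 0%N i).
  move=> hi; have /(_ n0 (leq0n _) hi) := @unitsq_grid n 0 i.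
  have /(_ n0 hi (leqnn _)) := @unitsq_grid n i n.
  rewrite /l mul0r divff// => -[/= a b _ _] /nf nf0.
  rewrite -(lab_opp nf0) /f /= (max_idPr b) (min_idPl b) (max_idPr a) (min_idPl a) c1 /=.
  by congr lab; congr pair; lra.
have half i : (i <= n)%N -> L i n - L 0%N n = L 0%N i - L 0%N 0%N.
  elim: i => [|i IH] hi; first by rewrite !subrr.
  have := IH (ltnW hi); have := Lx i n hi (leqnn n); have := Ly 0%N i (leq0n n) hi.
  by rewrite (sym i.+1 hi) (sym i (ltnW hi)) qstep_opp; lia.
(* The lift is constant along the diagonal and the two other sides contribute equally, so each
   contributes 0. But [l 0 n] is opposite to [l 0 0], which forces 2 modulo 4. *)
have [k] := @lift_mod4 n (l 0%N) (L 0%N) (fun i hi => Ly 0%N i (leq0n n) hi)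
  (fun i hi => nopp 0%N i (leq0n n) hi).
have := half n (leqnn n); rewrite (Ldiag n (leqnn n)).
have := sym n (leqnn n); rewrite diag -(diag 0%N) => hs.
have {hs} : qval (l 0%N n) = qval (l 0%N 0%N) + 2 \/ qval (l 0%N n) = qval (l 0%N 0%N) - 2.
  by rewrite hs; case: (l 0%N n) => /=; [right|right|left|left].
lia.
Qed.

(** Each side confines the image to two neighbouring quadrants, which forces the labels at the
    corners. Counterclockwise, every side then adds one quarter turn, four in all, whereas a lift on
    the whole grid would return to its initial value. *)
Lemma miranda f : cont2 f ->
  (forall x : R, 0 <= x <= 1 -> 0 < (f (x, 0)).1) ->
  (forall x : R, 0 <= x <= 1 -> (f (x, 1)).1 < 0) ->
  (forall y : R, 0 <= y <= 1 -> (f (0, y)).2 < 0) ->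
  (forall y : R, 0 <= y <= 1 -> 0 < (f (1, y)).2) ->
  exists2 z, unitsq z & f z = (0, 0).
Proof.
move=> cf hb ht hl hr; apply: contrapT => nz.
have nf z : unitsq z -> f z <> (0, 0) by move=> uz fz; apply: nz; exists z.
have [n [L]] := cont_grid_lift cf nf.
set l := fun i j : nat => _ => /= -[n0 Lx Ly _].
have n0' : n%:R != 0 :> R by rewrite pnatr_eq0 -lt0n.
have gr i : (i <= n)%N -> 0 <= (i%:R / n%:R : R) <= 1.
  by move=> hi; have [] := @unitsq_grid n i i n0 hi hi => /= -> ->.
have nl i j : (i <= n)%N -> (j <= n)%N ->
    f (i%:R / n%:R, j%:R / n%:R) <> (0, 0).
  by move=> hi hj; apply: nf; exact: unitsq_grid.
pose isin (a b c : quad) := c = a \/ c = b.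
have B i : (i <= n)%N -> isin Q3 Q0 (l i 0%N).
  move=> hi; have := hb _ (gr i hi); have := lab_spec (nl i 0%N hi (leq0n n)).
  by rewrite /l mul0r /isin; case: (lab _) => -[? ?] ?; (try by [left|right]); exfalso; lra.
have T i : (i <= n)%N -> isin Q1 Q2 (l i n).
  move=> hi; have := ht _ (gr i hi); have := lab_spec (nl i n hi (leqnn n)).
  by rewrite /l divff// /isin; case: (lab _) => -[? ?] ?; (try by [left|right]); exfalso; lra.
have Le j : (j <= n)%N -> isin Q2 Q3 (l 0%N j).
  move=> hi; have := hl _ (gr j hi); have := lab_spec (nl 0%N j (leq0n n) hi).
  by rewrite /l mul0r /isin; case: (lab _) => -[? ?] ?; (try by [left|right]); exfalso; lra.
have Ri j : (j <= n)%N -> isin Q0 Q1 (l n j).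
  move=> hi; have := hr _ (gr j hi); have := lab_spec (nl n j (leqnn n) hi).
  by rewrite /l divff// /isin; case: (lab _) => -[? ?] ?; (try by [left|right]); exfalso; lra.
have tele a b (q : nat -> quad) M : qstep a b = 1 ->
    (forall i, (i < n)%N -> M i.+1 - M i = qstep (q i) (q i.+1)) ->
    (forall i, (i <= n)%N -> isin a b (q i)) -> M n - M 0%N = qind b (q n) - qind b (q 0%N).
  move=> ab hM hq; apply: (@lift_tele n q M (isin a b)) => //.
  by move=> c c'; exact: qstep_ind.
have sp a b c d x : isin a b x -> isin c d x -> (x = a /\ (a = c \/ a = d)) \/
   (x = b /\ (b = c \/ b = d)).
  by move=> [] -> [] ->; intuition.
have cBL : l 0%N 0%N = Q3.
  by case: (sp _ _ _ _ _ (B 0%N (leq0n n)) (Le 0%N (leq0n n))) => -[-> []].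
have cBR : l n 0%N = Q0.
  by case: (sp _ _ _ _ _ (B n (leqnn n)) (Ri 0%N (leq0n n))) => -[-> []].
have cTR : l n n = Q1.
  by case: (sp _ _ _ _ _ (T n (leqnn n)) (Ri n (leqnn n))) => -[-> []].
have cTL : l 0%N n = Q2.
  by case: (sp _ _ _ _ _ (T 0%N (leq0n n)) (Le n (leqnn n))) => -[-> []].
have := @tele Q3 Q0 (l^~ 0%N) (L^~ 0%N) erefl (fun i hi => Lx i 0%N hi (leq0n n)) B.
have := @tele Q0 Q1 (l n) (L n) erefl (fun i hi => Ly n i (leqnn n) hi) Ri.
have := @tele Q1 Q2 (l^~ n) (L^~ n) erefl (fun i hi => Lx i n hi (leqnn n)) T.
have := @tele Q2 Q3 (l 0%N) (L 0%N) erefl (fun i hi => Ly 0%N i (leq0n n) hi) Le.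
by rewrite cBL cBR cTR cTL /=; lia.
Qed.

End Quadrants.

Section Continuity.
Variable R : realType.
Implicit Types (p q z w v : pt R) (F G f g : pt R -> pt R).

Lemma cont2_comp f g : cont2 f -> cont2 g -> cont2 (f \o g).
Proof.
move=> cf cg z e e0; have [d d0 hd] := cf (g z) e e0.
by have [d' d'0 hd'] := cg z d d0; exists d' => // w /hd' /hd.
Qed.

Lemma cont2_lip f (L : R) : 0 <= L ->
  (forall z w (d : R), near2 d z w -> near2 (L * d) (f z) (f w)) -> cont2 f.
Proof.
move=> L0 h z e e0; exists (e / (L + 1)); first by rewrite divr_gt0//; lra.
move=> w /h; apply: near2_le.
rewrite mulrA ler_pdivrMr; last by lra.
by rewrite mulrC; apply: ler_wpM2l; lra.
Qed.

Lemma cont2_iter F n : cont2 F -> cont2 (iter n F).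
Proof.
move=> cF; elim: n => [|n IH]; first by move=> z e e0; exists e.
exact: (cont2_comp cF IH).
Qed.

Lemma cont2_pair (h1 h2 : pt R -> R) : continuous h1 -> continuous h2 ->
  cont2 (fun z => (h1 z, h2 z)).
Proof.
move=> c1 c2 z e e0.
have /nbhs_near2P[d1 d10 h1d] : \forall w \near z, `|h1 z - h1 w| <= e.
  by have /cvgrPdist_le := c1 z; apply.
have /nbhs_near2P[d2 d20 h2d] : \forall w \near z, `|h2 z - h2 w| <= e.
  by have /cvgrPdist_le := c2 z; apply.
exists (Num.min d1 d2); first by rewrite lt_min d10.
move=> w zw; split => /=.
  by apply: h1d; apply: near2_le zw; rewrite ge_min lexx.
by apply: h2d; apply: near2_le zw; rewrite ge_min lexx orbT.
Qed.

(* Adding [M (2 x - 1) |f_1|] to the second component does not change the zeros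
   and restores the hypotheses of [miranda]. *)
Lemma miranda_steep f (B s : R) : cont2 f -> 0 < s ->
  (forall z, unitsq z -> `|(f z).2| <= B) ->
  (forall x : R, 0 <= x <= 1 -> 0 < (f (x, 0)).1) ->
  (forall x : R, 0 <= x <= 1 -> (f (x, 1)).1 < 0) ->
  (forall y : R, 0 <= y <= 1 -> `|(f (0, y)).1| <= s -> (f (0, y)).2 < 0) ->
  (forall y : R, 0 <= y <= 1 -> `|(f (1, y)).1| <= s -> 0 < (f (1, y)).2) ->
  exists2 z, unitsq z & f z = (0, 0).
Proof.
move=> cf s0 hB hb ht hl hr.
(* With this factor the added term is at least [B + 1] in size on the vertical sides once the first
   component exceeds [s], and so dominates the second component. *)
pose M := (B + 1) / s.
have u00 : unitsq (0 : R, 0 : R) by split => /=; lra.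
have B0 : 0 <= B := le_trans (normr_ge0 _) (hB _ u00).
have M0 : 0 < M by rewrite divr_gt0//; lra.
pose g z : pt R := ((f z).1, (f z).2 + M * (2 * z.1 - 1) * `|(f z).1|).
have cg : cont2 g.
  move/cont2P : cf => cf.
  have c1 : continuous (fun w => (f w).1).
    by move=> z; apply: (cvg_comp _ _ (cf z)); exact: cvg_fst.
  have c2 : continuous (fun w => (f w).2).
    by move=> z; apply: (cvg_comp _ _ (cf z)); exact: cvg_snd.
  apply: cont2_pair => // z.
  apply: cvgD; first exact: c2.
  apply: cvgM; last by apply: cvg_norm; exact: c1.
  apply: cvgM; first exact: cvg_cst.
  apply: cvgB; last exact: cvg_cst.
  by apply: cvgM; [exact: cvg_cst | exact: cvg_fst].
have big (x : R) : ~~ (`|x| <= s) -> B + 1 <= M * `|x|.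
  rewrite -ltNge => /ltW xs; apply: le_trans (ler_wpM2l (ltW M0) xs).
  by rewrite /M divfK// gt_eqF.
have [z uz gz] : exists2 z, unitsq z & g z = (0, 0).
  apply: miranda => // y hy; rewrite /g /=.
  - have hB1 := hB (0, y); have {}hB1 : `|(f (0, y)).2| <= B.
      by apply: hB1; split => /=; move/andP : hy => [] //; lra.
    move: hB1; rewrite ler_norml => /andP[? ?].
    rewrite mulr0 sub0r mulrN1 mulNr.
    have [small|/big ?] := boolP (`|(f (0, y)).1| <= s); last by lra.
    have := hl y hy small; have : 0 <= M * `|(f (0, y)).1| by rewrite mulr_ge0// ltW.
    lra.
  - have hB1 := hB (1, y); have {}hB1 : `|(f (1, y)).2| <= B.
      by apply: hB1; split => /=; move/andP : hy => [] //; lra.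
    move: hB1; rewrite ler_norml => /andP[? ?].
    have -> : 2 * 1 - 1 = 1 :> R by lra.
    rewrite mulr1.
    have [small|/big ?] := boolP (`|(f (1, y)).1| <= s); last by lra.
    have := hr y hy small; have : 0 <= M * `|(f (1, y)).1| by rewrite mulr_ge0// ltW.
    lra.
exists z => //; case: gz => e1; rewrite e1 normr0 mulr0 addr0 => e2.
by rewrite [LHS]surjective_pairing e1 e2.
Qed.

Definition ucont F : Prop := forall e : R, 0 < e ->
  exists2 d : R, 0 < d & forall z w, near2 d z w -> near2 e (F z) (F w).

Definition unit0 z : Prop := [/\ 0 <= z.1, z.1 < 1, 0 <= z.2 & z.2 < 1].

Lemma unit0_sq z : unit0 z -> unitsq z.
Proof. by case=> a b c d; split => //; exact: ltW. Qed.

Lemma unit0_repr z : exists a b : int, exists2 z', unit0 z' & z = padd z' (zvec R a b).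
Proof.
exists (Num.floor z.1), (Num.floor z.2).
exists (z.1 - (Num.floor z.1)%:~R, z.2 - (Num.floor z.2)%:~R).
  have := floor_itv z.1; have := floor_itv z.2.
  by rewrite !intrD => /andP[? ?] /andP[? ?]; split => /=; lra.
by rewrite /padd /= !subrK -surjective_pairing.
Qed.

Lemma near2_padd (e : R) z w v : near2 e (padd z v) (padd w v) <-> near2 e z w.
Proof. by rewrite !near2P /=; split => -[? ? ? ?]; split; lra. Qed.

Lemma Zequiv_ucont F : cont2 F -> Zequivariant F -> ucont F.
Proof.
move=> cF eF e e0.
have [d d0 hd] : exists2 d : R, 0 < d &
    forall w w', unitsq w -> near2 d w w' -> near2 e (F w) (F w').
  apply: uniformize => z _.
  have e2 : 0 < e / 2 by lra.
  have [d d0 hd] := cF z (e / 2) e2.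
  exists d => // w w' /hd h /hd h'.
  have -> : e = e / 2 + e / 2 by lra.
  exact: near2_trans (near2_sym h) h'.
exists d => // z w; have [a [b [z' uz ->]]] := unit0_repr z.
have -> : w = padd (padd w (zvec R (- a) (- b))) (zvec R a b).
  by rewrite /padd /= !intrN !subrK -surjective_pairing.
by move: (padd w _) => w'; rewrite !eF !near2_padd; apply: hd; exact: unit0_sq.
Qed.

Lemma Zequiv_iter F n : Zequivariant F -> Zequivariant (iter n F).
Proof. by move=> eF a b z; elim: n => //= n ->; rewrite eF. Qed.

Lemma near2_scale n z i : (0 < n)%N -> unitsq z ->
  near2 n%:R^-1 (i%:R / n%:R * z.1, i%:R / n%:R * z.2)
    (i.+1%:R / n%:R * z.1, i.+1%:R / n%:R * z.2).
Proof.
move=> n0 [a b c d]; have n0' : 0 <= n%:R^-1 :> R by rewrite invr_ge0.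
have h x : 0 <= x -> x <= 1 -> `|i%:R / n%:R * x - i.+1%:R / n%:R * x| <= n%:R^-1.
  move=> x0 x1; rewrite -mulrBl -mulrBl -natr1 opprD addrA subrr sub0r mulN1r mulNr normrN.
  by rewrite ger0_norm ?mulr_ge0// ler_piMr.
by split => /=; apply: h.
Qed.

(** The segment from the origin to a point of the fundamental square is cut into [n] steps, each
    moving the image by at most 1; hence the term [n%:R] in the bound. *)
Lemma Zequiv_bdd F : cont2 F -> Zequivariant F ->
  exists2 B : R, 0 <= B & forall z, near2 B (F z) z.
Proof.
move=> cF eF; have [d d0 hd] := Zequiv_ucont cF eF ltr01.
have [m _ hm] := near_infty_natSinv_lt (PosNum d0).
have := hm m (leqnn m) => /= /ltW md.
pose n := m.+1.
exists (n%:R + `|(F (0, 0)).1| + `|(F (0, 0)).2| + 1) => [|z].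
  by rewrite !addr_ge0.
have [a [b [z' uz ->]]] := unit0_repr z; rewrite eF near2_padd.
have step i : near2 (i%:R : R) (F (0, 0)) (F (i%:R / n%:R * z'.1, i%:R / n%:R * z'.2)).
  elim: i => [|i IH]; first by rewrite !mul0r; exact: near2_refl.
  rewrite -[X in near2 X]natr1; apply: near2_trans IH _; apply: hd.
  by apply: near2_le md _; apply: near2_scale => //; exact: unit0_sq.
have := step n; rewrite divff ?pnatr_eq0// !mul1r -surjective_pairing.
case: uz => ? ? ? ? /near2P[? ? ? ?].
have := ler_norm (F (0, 0)).1; have := ler_norm (F (0, 0)).2.
have := ler_norm (- (F (0, 0)).1); have := ler_norm (- (F (0, 0)).2).
rewrite !normrN; have := normr_ge0 (F (0, 0)).1; have := normr_ge0 (F (0, 0)).2.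
by move=> *; apply/near2P; split; lra.
Qed.

Lemma iter_near F n : ucont F -> forall e : R, 0 < e ->
  exists2 d : R, 0 < d & forall G, (forall z, near2 d (G z) (F z)) ->
    forall z, near2 e (iter n G z) (iter n F z).
Proof.
move=> uF; elim: n => [|n IH] e e0.
  by exists 1 => // G _ z; apply: near2_refl; exact: ltW.
have e2 : 0 < e / 2 by lra.
have [d d0 hd] := uF _ e2; have [d' d'0 hd'] := IH d d0.
exists (Num.min (e / 2) d'); first by rewrite lt_min e2.
move=> G hG z /=; have -> : e = e / 2 + e / 2 by lra.
apply: (@near2_trans _ _ (F (iter n G z))).
  by apply: near2_le (hG _); rewrite ge_min lexx.
apply: hd; apply: hd' => w.
by apply: near2_le (hG _); rewrite ge_min lexx orbT.
Qed.

Lemma round_int (x : R) : exists a : int, `|x - a%:~R| <= 2^-1.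
Proof.
exists (Num.floor (x + 2^-1)); have := floor_itv (x + 2^-1).
by rewrite intrD => /andP[? ?]; rewrite ler_norml; apply/andP; split; lra.
Qed.

Lemma int_lt1_eq0 (a : int) : `|a%:~R : R| < 1 -> a = 0.
Proof.
rewrite -intr_norm => h; have {}h : `|a| < 1 by rewrite -(@ltr_int R).
lia.
Qed.

Lemma convex_unit0 z w (t : R) : 0 <= t -> t <= 1 -> unit0 z -> unit0 w ->
  unit0 (z.1 + t * (w.1 - z.1), z.2 + t * (w.2 - z.2)).
Proof.
move=> t0 t1 [a b c d] [a' b' c' d'].
have h x y : 0 <= x -> x < 1 -> 0 <= y -> y < 1 ->
   0 <= x + t * (y - x) /\ x + t * (y - x) < 1.
  move=> x0 x1 y0 y1; have -> : x + t * (y - x) = (1 - t) * x + t * y by ring.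
  have t1' : 0 <= 1 - t by lra.
  have p1 := mulr_ge0 t1' x0; have p2 := mulr_ge0 t0 y0.
  split; first by lra.
  have [->|tn0] := eqVneq t 0; first by lra.
  have tp : 0 < t by rewrite lt_neqAle eq_sym tn0.
  have : t * y < t * 1 by rewrite ltr_pM2l.
  have : (1 - t) * x <= (1 - t) * 1 by apply: ler_wpM2l => //; exact: ltW.
  lra.
by have [] := h _ _ a b a' b'; have [] := h _ _ c d c' d'.
Qed.

(* A lift [g] maps the fundamental domain to a set disjoint from its integer
   translates, so a chord of [g]-image equal to a nonzero integer vector is
   impossible; closing up the path by a short segment, [half_chord] then yields
   a point close to the midpoint. *)
Lemma image_midpoint g z1 z2 : cont2 g -> injective g -> Zequivariant g ->
  unit0 z1 -> unit0 z2 -> exists2 z, unit0 z &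
    near2 2 (g z) (((g z1).1 + (g z2).1) / 2, ((g z1).2 + (g z2).2) / 2).
Proof.
move=> cg ig eg u1 u2.
set a := g z1; set b := g z2.
(* [v] is half the chord rounded to an integer vector. A straight segment along the rounding error
   [(e1, e2)], with entries at most 1, makes the total displacement of [gam] exactly twice [v]. *)
have [v1 hv1] := round_int ((b.1 - a.1) / 2).
have [v2 hv2] := round_int ((b.2 - a.2) / 2).
move: hv1 hv2; rewrite !ler_norml => /andP[r1 r2] /andP[r3 r4].
pose e1 := a.1 + 2 * v1%:~R - b.1; pose e2 := a.2 + 2 * v2%:~R - b.2.
have e1P : `|e1| <= 1 by rewrite ler_norml /e1; apply/andP; split; lra.
have e2P : `|e2| <= 1 by rewrite ler_norml /e2; apply/andP; split; lra.
pose c (t : R) : pt R := (z1.1 + t * (z2.1 - z1.1), z1.2 + t * (z2.2 - z1.2)).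
pose lo (t : R) : R := Num.min (2 * t) 1; pose hi (t : R) : R := Num.max 0 (2 * t - 1).
pose gam (t : R) : pt R := ((g (c (lo t))).1 + hi t * e1, (g (c (lo t))).2 + hi t * e2).
have mulb (x y : R) (d : R) : `|x| <= d -> `|y| <= 1 -> `|x * y| <= d.
  by move=> hx hy; rewrite normrM -[d]mulr1; apply: ler_pM.
have cgam : cont_path gam.
  move=> t e e0; have e4 : 0 < e / 2 by lra.
  have [d d0 hd] := cg (c (lo t)) _ e4.
  exists (Num.min (d / 2) (e / 4)); first by rewrite lt_min; apply/andP; split; lra.
  move=> s; rewrite le_min => /andP[ts1 ts2].
  have ts1' : `|2 * t - 2 * s| <= d.
    by rewrite -mulrBr normrM ger0_norm//; lra.
  have ts2' : `|2 * t - 2 * s| <= e / 2.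
    by rewrite -mulrBr normrM ger0_norm//; lra.
  have hlo : `|lo t - lo s| <= d by apply: minr_lip => //; rewrite subrr normr0 ltW.
  have hhi : `|hi t - hi s| <= e / 2.
    apply: maxr_lip; first by rewrite subrr normr0 ltW.
    by have -> : 2 * t - 1 - (2 * s - 1) = 2 * t - 2 * s by ring.
  case: u1 u2 => x1 x2 x3 x4 [y1 y2 y3 y4].
  have /near2P[n1 n2 n3 n4] : near2 (e / 2) (g (c (lo t))) (g (c (lo s))).
    apply: hd; split => /=.
      have -> : z1.1 + lo t * (z2.1 - z1.1) - (z1.1 + lo s * (z2.1 - z1.1)) =
        (lo t - lo s) * (z2.1 - z1.1) by ring.
      by apply: mulb => //; rewrite ler_norml; apply/andP; clear - x1 x2 y1 y2; split; lra.
    have -> : z1.2 + lo t * (z2.2 - z1.2) - (z1.2 + lo s * (z2.2 - z1.2)) =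
        (lo t - lo s) * (z2.2 - z1.2) by ring.
    by apply: mulb => //; rewrite ler_norml; apply/andP; clear - x3 x4 y3 y4; split; lra.
  have := mulb _ _ _ hhi e1P; have := mulb _ _ _ hhi e2P.
  rewrite !mulrBl !ler_norml => /andP[p1 p2] /andP[p3 p4].
  by apply/near2P; rewrite /gam /=; clear - n1 n2 n3 n4 p1 p2 p3 p4; split; lra.
have lohi (t : R) : (lo t = 2 * t /\ hi t = 0 /\ 2 * t <= 1) \/
    (lo t = 1 /\ hi t = 2 * t - 1 /\ 1 <= 2 * t).
  rewrite /lo /hi; case: (leP (2 * t) 1) => h.
    by left; split => //; split => //; apply/max_idPl; lra.
  by right; split => //; split; [apply/max_idPr; lra | exact: ltW].
have c0 : c 0 = z1 by rewrite /c !mul0r !addr0 -surjective_pairing.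
have c1 : c 1 = z2.
  by rewrite /c !mul1r [RHS]surjective_pairing; congr pair; ring.
have gam0 : gam 0 = a.
  rewrite /gam; case: (lohi 0) => -[-> [-> ?]]; last by exfalso; lra.
  by rewrite mulr0 c0 !mul0r !addr0 -surjective_pairing.
have gam1 : gam 1 = ((gam 0).1 + 2 * v1%:~R, (gam 0).2 + 2 * v2%:~R).
  rewrite gam0 /gam; case: (lohi 1) => -[-> [-> ?]]; first by exfalso; lra.
  by rewrite c1 /e1 /e2; congr pair; rewrite -/b; ring.
have [s [t [s0 st t1 E]]] := @half_chord _ gam (v1%:~R, v2%:~R) cgam gam1.
have [E1 E2] : (g (c (lo t))).1 + hi t * e1 = (g (c (lo s))).1 + hi s * e1 + v1%:~R /\
    (g (c (lo t))).2 + hi t * e2 = (g (c (lo s))).2 + hi s * e2 + v2%:~R by case: E.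
(* If both times lie on the image of the segment, injectivity modulo translations gives [v = 0] and
   [z1] is close to the midpoint. If only [t] lies on the correcting segment, the point at time [s]
   is the required one. Otherwise [v] itself is small and [z1] works again. *)
case: (lohi s) => -[los [his s1]]; case: (lohi t) => -[lot [hit t2]].
- have : c (lo t) = padd (c (lo s)) (zvec R v1 v2).
    apply: ig; rewrite eg [LHS]surjective_pairing /padd /=.
    by move: E1 E2; rewrite his hit !mul0r !addr0 => -> ->.
  move=> []; rewrite lot los /= => E3 E4.
  have u s' : 0 <= s' -> 2 * s' <= 1 -> unit0 (c (2 * s')).
    by move=> h1 h2; apply: convex_unit0 => //; clear - h1 h2; lra.
  have := u s s0 s1; rewrite /c => -[/= c2 c3 c4 c5].
  have := u t (le_trans s0 st) t2; rewrite /c => -[/= d2 d3 d4 d5].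
  have v10 : v1 = 0.
    by apply: int_lt1_eq0; rewrite ltr_norml; apply/andP; clear - E3 c2 c3 d2 d3; split; lra.
  have v20 : v2 = 0.
    by apply: int_lt1_eq0; rewrite ltr_norml; apply/andP; clear - E4 c4 c5 d4 d5; split; lra.
  rewrite v10 in r1 r2; rewrite v20 in r3 r4; exists z1 => //.
  by apply/near2P; rewrite /= -/a; clear - r1 r2 r3 r4; split; lra.
- exists (c (lo s)); first by rewrite los; apply: convex_unit0 => //; clear - s0 s1; lra.
  have hit1 : `|hi t| <= 1 by rewrite hit ler_norml; apply/andP; clear - t1 t2; split; lra.
  have := mulb _ _ _ hit1 e1P; have := mulb _ _ _ hit1 e2P.
  move: E1 E2; rewrite lot c1 -/b his !mul0r !addr0 !ler_norml.
  move=> E3 E4 /andP[p1 p2] /andP[p3 p4].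
  by apply/near2P => /=; clear - E3 E4 p1 p2 p3 p4 r1 r2 r3 r4; split; lra.
- have ts : t = s by clear - s1 t2 st; lra.
  subst t; exists z1 => //; apply/near2P; rewrite /= -/a.
  by clear - E1 E2 r1 r2 r3 r4; split; lra.
- have hts : `|hi t - hi s| <= 1.
    by rewrite hit his ler_norml; apply/andP; clear - s1 t2 st t1; split; lra.
  have := mulb _ _ _ hts e1P; have := mulb _ _ _ hts e2P.
  move: E1 E2; rewrite lot los !mulrBl !ler_norml.
  move=> E3 E4 /andP[p1 p2] /andP[p3 p4].
  exists z1 => //; apply/near2P; rewrite /= -/a.
  by clear - E3 E4 p1 p2 p3 p4 r1 r2 r3 r4; split; lra.
Qed.

End Continuity.

(** * Convexity of the set of realised vectors *)

Section Realized.
Variable R : realType.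
Implicit Types (p q z w v x y : pt R) (F G : pt R -> pt R).

(* [w] is the mean displacement of some orbit segment of every large length. *)
Definition realized F w : Prop := forall e : R, 0 < e ->
  exists M : nat, forall n, (M <= n)%N -> exists2 z, unit0 z &
    near2 (e * n%:R) (iter n F z) (n%:R * w.1, n%:R * w.2).

Lemma nat_large (x : R) : exists M : nat, forall n, (M <= n)%N -> x <= n%:R.
Proof.
exists (Num.trunc x).+1 => n Mn; apply: (le_trans (ltW (truncnS_gt x))).
by rewrite ler_nat.
Qed.

(** Averaging needs orbit segments of equal length, which is why [realized] speaks of all large
    lengths. The iterate is again injective and equivariant, and the error 2 of [image_midpoint] is
    absorbed by [e * n]. *)
Lemma realized_mid F w w' : cont2 F -> injective F -> Zequivariant F ->
  realized F w -> realized F w' ->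
  realized F ((w.1 + w'.1) / 2, (w.2 + w'.2) / 2).
Proof.
move=> cF iF eF h h' e e0; have e2 : 0 < e / 2 by lra.
have [M hM] := h _ e2; have [M' hM'] := h' _ e2.
have [K hK] := nat_large (4 / e).
exists (maxn K (maxn M M')) => n; rewrite !geq_max => /and3P[nK nM nM'].
have [z1 u1 /near2P /= [? ? ? ?]] := hM n nM.
have [z2 u2 /near2P /= [? ? ? ?]] := hM' n nM'.
have iiF : injective (iter n F) by elim: (n) => // k IH; exact: (inj_comp iF IH).
have [z uz hz] := image_midpoint (cont2_iter n cF) iiF (Zequiv_iter n eF) u1 u2.
exists z => //.
have : 4 <= e * n%:R by have := hK n nK; rewrite ler_pdivrMr// mulrC.
by move/near2P : hz => /= [? ? ? ?] ?; apply/near2P; split => /=; lra.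
Qed.

Lemma realized_closed F w : (forall e : R, 0 < e ->
  exists2 w', realized F w' & near2 e w w') -> realized F w.
Proof.
move=> h e e0; have e2 : 0 < e / 2 by lra.
have [w' rw' /near2P[? ? ? ?]] := h _ e2; have [M hM] := rw' _ e2.
exists M => n /hM[z uz /near2P /= [? ? ? ?]]; exists z => //.
have k (x y : R) : x - y <= e / 2 -> n%:R * x - n%:R * y <= e / 2 * n%:R.
  by move=> xy; rewrite -mulrBr mulrC ler_wpM2r.
have := k w.1 w'.1; have := k w'.1 w.1; have := k w.2 w'.2; have := k w'.2 w.2.
do 4!(move=> /(_ ltac:(assumption)) ?).
by apply/near2P; split => /=; lra.
Qed.

(** Euclidean division of the length by the period: full periods contribute exactly, the incomplete
    one a bounded error. *)
Lemma realized_periodic F (N : nat) (a b : int) z : Zequivariant F -> (0 < N)%N ->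
  iter N F z = padd z (zvec R a b) ->
  realized F (a%:~R / N%:R, b%:~R / N%:R).
Proof.
move=> eF N0 hz.
have [a' [b' [z' uz' zE]]] := unit0_repr z.
have {}hz : iter N F z' = padd z' (zvec R a b).
  move: hz; rewrite zE (Zequiv_iter N eF) => -[/= e1 e2].
  by rewrite [LHS]surjective_pairing; congr pair => /=; lra.
have [B B0 hB] : exists2 B : R, 0 <= B & forall r, (r < N)%N -> near2 B (iter r F z') (0, 0).
  elim: (N) => [|n [B B0 IH]]; first by exists 0.
  exists (B + `|(iter n F z').1| + `|(iter n F z').2|); first by rewrite !addr_ge0.
  have := normr_ge0 (iter n F z').1; have := normr_ge0 (iter n F z').2 => ? ?.
  move=> r; rewrite ltnS leq_eqVlt => /orP[/eqP ->|/IH].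
    by split => /=; rewrite subr0; lra.
  by apply: near2_le; lra.
have N0' : 0 < N%:R :> R by rewrite ltr0n.
have itq (q r : nat) : iter (q * N + r) F z' = padd (iter r F z') (zvec R (a * q%:Z) (b * q%:Z)).
  elim: q => [|q IH]; first by rewrite mul0n add0n !mulr0 /padd /= !addr0 -surjective_pairing.
  rewrite mulSn -addnA addnC iterD hz (Zequiv_iter _ eF) IH /padd /=.
  by rewrite -addn1 PoszD !mulrDr !mulr1 !intrD !addrA.
move=> e e0; have [M hM] := nat_large ((B + `|a%:~R| + `|b%:~R|) / e).
exists M => n /hM; rewrite ler_pdivrMr// => nM; exists z' => //.
have rN : (n %% N < N)%N by rewrite ltn_mod.
have := hB _ rN => /near2P /= [? ? ? ?].
have := itq (n %/ N)%N (n %% N)%N; rewrite -divn_eq => ->.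
have rest (c : int) : `|n%:R * (c%:~R / N%:R) - (c * (n %/ N)%:Z)%:~R| <= `|c%:~R : R|.
  have -> : n%:R * (c%:~R / N%:R) - (c * (n %/ N)%:Z)%:~R =
     c%:~R * ((n %% N)%:R / N%:R) :> R.
    rewrite {1}(divn_eq n N) natrD natrM intrM -[((n %/ N)%:Z)%:~R]/((n %/ N)%:R).
    by field; rewrite gt_eqF.
  rewrite normrM ler_piMr// ger0_norm ?divr_ge0// ler_pdivrMr// mul1r ler_nat ltnW//.
have := rest a; have := rest b; rewrite !ler_norml => /andP[? ?] /andP[? ?].
have := normr_ge0 (a%:~R : R); have := normr_ge0 (b%:~R : R) => ? ?.
by apply/near2P; split => /=; lra.
Qed.

Lemma cvg_near2 (u : nat -> pt R) w : (forall e : R, 0 < e -> exists K : nat,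
  forall k, (K <= k)%N -> near2 e (u k) w) -> u @ \oo --> w.
Proof.
move=> h A /nbhs_near2P[d d0 hd]; have [K hK] := h d d0.
by exists K => // k /= /hK /near2_sym /hd.
Qed.

Lemma cvg_near2P (u : nat -> pt R) w : u @ \oo --> w -> forall e : R, 0 < e ->
  exists K : nat, forall k, (K <= k)%N -> near2 e (u k) w.
Proof.
move=> h e e0; have /h : nbhs w [set x | near2 e w x] by apply/nbhs_near2P; exists e.
by move=> [K _ hK]; exists K => k /hK /= /near2_sym.
Qed.

Lemma realized_rot F w : realized F w -> rotation_set F w.
Proof.
move=> h.
have {h} : forall k : nat, exists zn : pt R * nat, (k < zn.2)%N /\
    near2 (k.+1%:R^-1) (pscale zn.2%:R^-1 (psub (iter zn.2 F zn.1) zn.1)) w.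
  move=> k; have : 0 < k.+1%:R^-1 :> R by rewrite invr_gt0.
  move: (k.+1%:R^-1 : R) => c c0; have c2 : 0 < c / 2 by lra.
  have [M hM] := h _ c2; have [K hK] := nat_large (2 / c).
  pose n := maxn k.+1 (maxn M K).
  have [z [? ? ? ?] /near2P[/= ? ? ? ?]] := hM n ltac:(by rewrite /n !leq_max leqnn orbT).
  have n0 : (0 < n)%N by rewrite /n leq_max.
  have n0' : 0 < n%:R :> R by rewrite ltr0n.
  have en : 1 <= c / 2 * n%:R.
    have := hK n ltac:(by rewrite /n !leq_max leqnn !orbT).
    by rewrite ler_pdivrMr//; lra.
  exists (z, n) => /=; split; first by rewrite /n leq_max leqnn.
  have hx (x y : R) : x - n%:R * y <= c * n%:R ->
      n%:R * y - x <= c * n%:R -> `|n%:R^-1 * x - y| <= c.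
    move=> h1 h2; have -> : n%:R^-1 * x - y = (x - n%:R * y) / n%:R.
      by field; rewrite gt_eqF.
    rewrite normrM (gtr0_norm (_ : 0 < n%:R^-1)) ?invr_gt0// ler_pdivrMr//.
    by rewrite ler_norml; apply/andP; split; lra.
  by split; apply: hx => /=; lra.
move=> /choice[f hf]; exists (fun k => (f k).1), (fun k => (f k).2); split.
  by move=> M; exists M => k Mk; have [/ltnW h _] := hf k; exact: leq_trans Mk h.
apply: cvg_near2 => e e0; have [K hK] := nat_large e^-1.
exists K => k Kk; have [_] := hf k; apply: near2_le.
rewrite invf_ple ?posrE//; apply: hK; exact: leqW.
Qed.

(** Bisection: a point of either half of the segment is the midpoint of an endpoint and of a point
    of the segment, so each step halves the error. The weaker rate [1 / (n + 1)] suffices for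
    closedness. *)
Lemma closed_mid_segment (A : pt R -> Prop) x y :
  (forall p, (forall e : R, 0 < e -> exists2 q, A q & near2 e p q) -> A p) ->
  (forall p q, A p -> A q -> A ((p.1 + q.1) / 2, (p.2 + q.2) / 2)) ->
  A x -> A y -> forall t : R, 0 <= t <= 1 ->
  A (x.1 + t * (y.1 - x.1), x.2 + t * (y.2 - x.2)).
Proof.
move=> cA mA Ax Ay.
pose c (t : R) : pt R := (x.1 + t * (y.1 - x.1), x.2 + t * (y.2 - x.2)).
have key (n : nat) : forall t : R, 0 <= t <= 1 -> exists2 t' : R, A (c t') & `|t - t'| <= n.+1%:R^-1.
  elim: n => [|n IH] t /andP[t0 t1].
    exists 0; first by rewrite /c !mul0r !addr0 -surjective_pairing.
    by rewrite subr0 ger0_norm// invr1.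
  have n2 : (n.+1%:R^-1 / 2 : R) <= n.+2%:R^-1.
    rewrite -invfM lef_pV2 ?posrE ?mulr_gt0// -natrM ler_nat; lia.
  have [th|th] := leP t (1 / 2).
    have [|t' At' ht'] := IH (2 * t); first by apply/andP; split; lra.
    exists (t' / 2).
      have := mA _ _ Ax At'; congr A; congr pair; rewrite /c /=; lra.
    apply: le_trans n2; have -> : t - t' / 2 = (2 * t - t') / 2 by lra.
    by rewrite normrM (@ger0_norm _ 2^-1)// ler_wpM2r.
  have [|t' At' ht'] := IH (2 * t - 1); first by apply/andP; split; lra.
  exists ((1 + t') / 2).
    have := mA _ _ Ay At'; congr A; congr pair; rewrite /c /=; lra.
  apply: le_trans n2; have -> : t - (1 + t') / 2 = (2 * t - 1 - t') / 2 by lra.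
  by rewrite normrM (@ger0_norm _ 2^-1)// ler_wpM2r.
move=> t t01; apply: cA => e e0.
pose D := `|y.1 - x.1| + `|y.2 - x.2| + 1.
have D0 : 0 < D by rewrite /D ltr_wpDl// addr_ge0.
have [M hM] := nat_large (D / e).
have [t' At' ht'] := key M t t01; exists (c t') => //.
have tD : `|t - t'| * D <= e.
  have := hM M.+1 (leqnSn M); rewrite ler_pdivrMr// mulrC -ler_pdivrMr ?ltr0Sn// => h.
  by apply: le_trans h; rewrite mulrC; apply: ler_wpM2l => //; exact: ltW.
have h (u v : R) : `|u| <= D -> `|v + t * u - (v + t' * u)| <= e.
  move=> uD; have -> : v + t * u - (v + t' * u) = (t - t') * u by ring.
  by rewrite normrM; apply: le_trans tD; exact: ler_wpM2l.
have := normr_ge0 (y.1 - x.1); have := normr_ge0 (y.2 - x.2) => ? ?.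
by split; apply: h; rewrite /D; lra.
Qed.

Definition hull n (p : 'I_n -> pt R) : set (pt R) :=
  [set x | exists l : 'I_n -> R, (forall i, 0 <= l i) /\ \sum_(i < n) l i = 1 /\
     x = (\sum_(i < n) l i * (p i).1, \sum_(i < n) l i * (p i).2)].

Lemma closed_mid_hull (A : pt R -> Prop) n (p : 'I_n -> pt R) :
  (forall x, (forall e : R, 0 < e -> exists2 q, A q & near2 e x q) -> A x) ->
  (forall x y, A x -> A y -> A ((x.1 + y.1) / 2, (x.2 + y.2) / 2)) ->
  (forall i, A (p i)) -> hull p `<=` A.
Proof.
move=> cA mA; elim: n p => [|n IH] p Ap x [l [l0 [l1 ->]]].
  by move: l1; rewrite big_ord0 => /eqP; rewrite eq_sym oner_eq0.
rewrite !big_ord_recr /=; rewrite big_ord_recr /= in l1.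
set s := \sum_(i < n) l (widen_ord (leqnSn n) i) in l1.
have s0 : 0 <= s by apply: sumr_ge0.
have ln0 := l0 ord_max.
have [sz|snz] := eqVneq s 0.
  have lz i : l (widen_ord (leqnSn n) i) = 0.
    by have /psumr_eq0P := sz; apply.
  rewrite !big1; [|by move=> i _; rewrite lz mul0r|by move=> i _; rewrite lz mul0r].
  have -> : l ord_max = 1 by lra.
  by rewrite !add0r !mul1r -surjective_pairing.
have sp : 0 < s by rewrite lt_neqAle eq_sym snz.
pose l' i := l (widen_ord (leqnSn n) i) / s.
pose p' i := p (widen_ord (leqnSn n) i).
have Aq : A (\sum_(i < n) l' i * (p' i).1, \sum_(i < n) l' i * (p' i).2).
  apply: (IH p') => [i|]; first exact: Ap.
  exists l'; split; first by move=> i; rewrite divr_ge0.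
  by split => //; rewrite -mulr_suml divff.
have := closed_mid_segment cA mA Aq (Ap ord_max) (t := l ord_max).
move=> /(_ ltac:(by apply/andP; split; lra)) /=; congr A.
have e (u : 'I_n -> R) (v : R) : \sum_(i < n) l' i * u i + l ord_max * (v - \sum_(i < n) l' i * u i)
   = \sum_(i < n) l (widen_ord (leqnSn n) i) * u i + l ord_max * v.
  set S := \sum_(i < n) l' i * u i.
  have -> : \sum_(i < n) l (widen_ord (leqnSn n) i) * u i = s * S.
    by rewrite /S mulr_sumr; apply: eq_bigr => i _; rewrite /l' mulrA (mulrC s) divfK.
  have -> : l ord_max = 1 - s by lra.
  by ring.
by rewrite !e.
Qed.

End Realized.

(** * Shears *)

Section AreaShear.
Variable R : realType.
Implicit Types (z w : pt R) (th : R -> R) (F : pt R -> pt R).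

Definition Vsh th z : pt R := (z.1, z.2 + th z.1).
Definition Hsh th z : pt R := (z.1 + th z.2, z.2).

Lemma lebesgue_translate (c : R) (A : set (measurableTypeR R)) : measurable A ->
  lebesgue_measure ((fun y => y + c) @^-1` A) = lebesgue_measure A.
Proof.
move=> mA.
have mf : measurable_fun setT (fun y : measurableTypeR R => y + c : measurableTypeR R).
  exact: measurable_funD.
transitivity (pushforward lebesgue_measure (fun y : measurableTypeR R => y + c : measurableTypeR R) A) => //.
apply/esym; apply: (@lebesgue_measure_unique R
  (pushforward lebesgue_measure (fun y : measurableTypeR R => y + c : measurableTypeR R))) => //.
move=> _ [[a b]] _ <-; rewrite /pushforward /=.
rewrite [X in _ = lebesgue_measure X](_ : _ = `]a - c, b - c]%classic); last first.
  by apply/seteqP; split => x /=; rewrite !in_itv /= ltrBlDr lerBrDr.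
rewrite !lebesgue_measure_itv /= !lte_fin ltrD2r; case: ifP => // _.
by rewrite -!EFinB; congr EFin; lra.
Qed.

Lemma measurable_Vsh th : continuous th ->
  measurable_fun setT (Vsh th : measurableTypeR R * measurableTypeR R -> measurableTypeR R * measurableTypeR R).
Proof.
move=> cth; apply/measurable_fun_pairP; split; first exact: measurable_fst.
rewrite /Vsh /comp /=; apply: measurable_funD; first exact: measurable_snd.
apply: measurableT_comp; last exact: measurable_fst.
exact: continuous_measurable_fun.
Qed.

Lemma measurable_Hsh th : continuous th ->
  measurable_fun setT (Hsh th : measurableTypeR R * measurableTypeR R -> measurableTypeR R * measurableTypeR R).
Proof.
move=> cth; apply/measurable_fun_pairP; split; last exact: measurable_snd.
rewrite /Hsh /comp /=; apply: measurable_funD; first exact: measurable_fst.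
apply: measurableT_comp; last exact: measurable_snd.
exact: continuous_measurable_fun.
Qed.

(** [leb2] integrates vertical slices, which suits vertical shears. Horizontal shears translate
    horizontal slices and need the product in the other order. *)
Lemma leb2E2 (A : set (pt R)) : measurable A ->
  leb2 A = ((@lebesgue_measure R) \x^ (@lebesgue_measure R))%E A.
Proof.
move=> mA; rewrite /leb2; apply: product_measure_unique => // B C mB mC.
exact: product_measure2E.
Qed.

Lemma leb2_Vsh th (A : set (pt R)) : continuous th -> measurable A ->
  measurable (Vsh th @^-1` A) /\ leb2 (Vsh th @^-1` A) = leb2 A.
Proof.
move=> cth mA; split.
  by rewrite -[X in measurable X]setTI; exact: (measurable_Vsh cth).
rewrite /leb2 /product_measure1; apply: eq_integral => x _ /=.
rewrite -(lebesgue_translate (th x) (measurable_xsection x mA)).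
congr (lebesgue_measure _); apply/seteqP; split => y /=; rewrite /xsection /= !inE //.
Qed.

Lemma leb2_Hsh th (A : set (pt R)) : continuous th -> measurable A ->
  measurable (Hsh th @^-1` A) /\ leb2 (Hsh th @^-1` A) = leb2 A.
Proof.
move=> cth mA.
have mH : measurable (Hsh th @^-1` A).
  by rewrite -[X in measurable X]setTI; exact: (measurable_Hsh cth).
split; first exact: mH.
rewrite (leb2E2 mH) (leb2E2 mA) /product_measure2; apply: eq_integral => y _ /=.
rewrite -(lebesgue_translate (th y) (measurable_ysection y mA)).
congr (lebesgue_measure _); apply/seteqP; split => x /=; rewrite /ysection /= !inE //.
Qed.

Lemma area_Vsh th F : continuous th -> area_preserving F -> area_preserving (Vsh th \o F).
Proof.
move=> cth aF A mA; have [mV <-] := leb2_Vsh cth mA.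
by rewrite -(aF _ mV).
Qed.

Lemma area_Hsh th F : continuous th -> area_preserving F -> area_preserving (Hsh th \o F).
Proof.
move=> cth aF A mA; have [mV <-] := leb2_Hsh cth mA.
by rewrite -(aF _ mV).
Qed.

End AreaShear.

Section Shears.
Variable R : realType.
Implicit Types (z w : pt R) (th : R -> R) (F G k : pt R -> pt R).

Definition periodic1 th : Prop := forall x (m : int), th (x + m%:~R) = th x.

Definition lipschitz1 th : Prop := exists2 L : R, 0 <= L &
  forall x y, `|th x - th y| <= L * `|x - y|.

(** An inductive closure, so that equivariance, the Lipschitz bound, the inverse and membership in
    the space are each checked one shear at a time. *)
Inductive shmap : (pt R -> pt R) -> Prop :=
| shmap_id : shmap idfun
| shmap_V th k : periodic1 th -> lipschitz1 th -> shmap k -> shmap (Vsh th \o k)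
| shmap_H th k : periodic1 th -> lipschitz1 th -> shmap k -> shmap (Hsh th \o k).

Lemma shmap_comp k k' : shmap k -> shmap k' -> shmap (k \o k').
Proof.
move=> hk hk'; elim: hk => // th k0 p l _ IH.
  exact: (shmap_V p l IH).
exact: (shmap_H p l IH).
Qed.

Lemma shmap_Vsh th : periodic1 th -> lipschitz1 th -> shmap (Vsh th).
Proof. by move=> p l; exact: (shmap_V p l shmap_id). Qed.

Lemma shmap_Hsh th : periodic1 th -> lipschitz1 th -> shmap (Hsh th).
Proof. by move=> p l; exact: (shmap_H p l shmap_id). Qed.

Lemma lipschitz1_cont th : lipschitz1 th -> continuous th.
Proof.
move=> [L L0 h] x; apply/cvgrPdist_le => e e0; apply/nbhs_ballP.
exists (e / (L + 1)) => /=; first by rewrite divr_gt0//; lra.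
move=> y /ltW; rewrite /= => xy; apply: (le_trans (h x y)).
apply: (le_trans (ler_wpM2l L0 xy)).
rewrite mulrA ler_pdivrMr; last by lra.
by rewrite mulrC; apply: ler_wpM2l; lra.
Qed.

Lemma Vsh_equiv th : periodic1 th -> Zequivariant (Vsh th).
Proof. by move=> p a b z; rewrite /Vsh /padd /= p addrAC. Qed.

Lemma Hsh_equiv th : periodic1 th -> Zequivariant (Hsh th).
Proof. by move=> p a b z; rewrite /Hsh /padd /= p addrAC. Qed.

Lemma VshK th : cancel (Vsh th) (Vsh (fun x => - th x)).
Proof. by case=> x y; rewrite /Vsh /= addrK. Qed.

Lemma VshKn th : cancel (Vsh (fun x => - th x)) (Vsh th).
Proof. by case=> x y; rewrite /Vsh /= subrK. Qed.

Lemma HshK th : cancel (Hsh th) (Hsh (fun x => - th x)).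
Proof. by case=> x y; rewrite /Hsh /= addrK. Qed.

Lemma HshKn th : cancel (Hsh (fun x => - th x)) (Hsh th).
Proof. by case=> x y; rewrite /Hsh /= subrK. Qed.

Lemma periodic1Z th (c : R) : periodic1 th -> periodic1 (fun x => c * th x).
Proof. by move=> p x m; rewrite p. Qed.

Lemma lipschitz1Z th (c : R) : lipschitz1 th -> lipschitz1 (fun x => c * th x).
Proof.
move=> [L L0 h]; exists (`|c| * L); first by rewrite mulr_ge0.
by move=> x y; rewrite -mulrBr normrM -mulrA ler_wpM2l.
Qed.

Lemma periodic1N th : periodic1 th -> periodic1 (fun x => - th x).
Proof. by move=> p x m; rewrite p. Qed.

Lemma lipschitz1N th : lipschitz1 th -> lipschitz1 (fun x => - th x).
Proof. by move=> [L L0 h]; exists L => // x y; rewrite -opprD normrN. Qed.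

Lemma periodic1_cst (c : R) : periodic1 (fun=> c). Proof. by []. Qed.

Lemma lipschitz1_cst (c : R) : lipschitz1 (fun=> c).
Proof. by exists 0 => // x y; rewrite subrr normr0 mul0r. Qed.

Lemma lipschitz1D th th' : lipschitz1 th -> lipschitz1 th' ->
  lipschitz1 (fun x => th x + th' x).
Proof.
move=> [L L0 h] [L' L0' h']; exists (L + L'); first exact: addr_ge0.
move=> x y; rewrite mulrDl; apply: le_trans (lerD (h x y) (h' x y)).
by rewrite opprD addrACA ler_normD.
Qed.

Lemma periodic1D th th' : periodic1 th -> periodic1 th' ->
  periodic1 (fun x => th x + th' x).
Proof. by move=> p p' x m; rewrite p p'. Qed.

Lemma shmap_translate (a b : R) : shmap (fun z => (z.1 + a, z.2 + b)).
Proof.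
exact: (shmap_V (periodic1_cst b) (lipschitz1_cst b)
  (shmap_Hsh (periodic1_cst a) (lipschitz1_cst a))).
Qed.

Lemma shmap_equiv k : shmap k -> Zequivariant k.
Proof.
elim=> // th k0 p _ _ IH a b z /=; rewrite IH; [exact: Vsh_equiv | exact: Hsh_equiv].
Qed.

Lemma shmap_inv k : shmap k -> exists k', [/\ shmap k', cancel k k' & cancel k' k].
Proof.
elim=> [|th k0 p l _ [k1 [sk1 c1 c2]]|th k0 p l _ [k1 [sk1 c1 c2]]].
- by exists idfun; split => //; exact: shmap_id.
- exists (k1 \o Vsh (fun x => - th x)); split.
  + by apply: shmap_comp => //; apply: shmap_Vsh; [exact: periodic1N | exact: lipschitz1N].
  + by move=> z /=; rewrite VshK c1.
  + by move=> z /=; rewrite c2 VshKn.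
- exists (k1 \o Hsh (fun x => - th x)); split.
  + by apply: shmap_comp => //; apply: shmap_Hsh; [exact: periodic1N | exact: lipschitz1N].
  + by move=> z /=; rewrite HshK c1.
  + by move=> z /=; rewrite c2 HshKn.
Qed.

Lemma shmap_inj k : shmap k -> injective k.
Proof. by move=> /shmap_inv[k' [_ c _]]; exact: can_inj c. Qed.

Lemma Vsh_lip th (L d : R) z w : 0 <= L -> (forall x y, `|th x - th y| <= L * `|x - y|) ->
  near2 d z w -> near2 ((1 + L) * d) (Vsh th z) (Vsh th w).
Proof.
move=> L0 h [a b]; have d0 : 0 <= d := le_trans (normr_ge0 _) a.
have Ld : 0 <= L * d by exact: mulr_ge0.
rewrite mulrDl mul1r; split => /=; first by lra.
have := le_trans (h z.1 w.1) (ler_wpM2l L0 a).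
move: b; rewrite !ler_norml => /andP[? ?] /andP[? ?]; apply/andP; split; lra.
Qed.

Definition swp z : pt R := (z.2, z.1).

Lemma near2_swp (d : R) z w : near2 d (swp z) (swp w) <-> near2 d z w.
Proof. by rewrite /near2 /=; split => -[]. Qed.

Lemma Hsh_swp th z : Hsh th z = swp (Vsh th (swp z)).
Proof. by []. Qed.

Lemma shmap_lip k : shmap k -> exists2 L : R, 0 <= L &
  forall z w (d : R), near2 d z w -> near2 (L * d) (k z) (k w).
Proof.
elim=> [|th k0 p [L L0 l] _ [M M0 IH]|th k0 p [L L0 l] _ [M M0 IH]].
- by exists 1 => // z w d; rewrite mul1r.
- exists ((1 + L) * M); first by rewrite mulr_ge0// addr_ge0.
  by move=> z w d /IH h; rewrite -mulrA; exact: Vsh_lip.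
- exists ((1 + L) * M); first by rewrite mulr_ge0// addr_ge0.
  move=> z w d /IH h; rewrite -mulrA /= !Hsh_swp; apply/near2_swp.
  by apply: Vsh_lip => //; apply/near2_swp.
Qed.

Lemma shmap_cont k : shmap k -> cont2 k.
Proof. by move=> /shmap_lip[L L0 h]; exact: cont2_lip h. Qed.

(** Swapping coordinates exchanges the two kinds of shears, so the moves inside cells need only be
    built vertically. *)
Lemma shmap_swap k : shmap k -> shmap (swp \o k \o swp).
Proof.
elim=> [|th k0 p l _ IH|th k0 p l _ IH].
- suff -> : swp \o idfun \o swp = idfun by exact: shmap_id.
  by apply/funext => -[].
- suff -> : swp \o (Vsh th \o k0) \o swp = Hsh th \o (swp \o k0 \o swp) by exact: shmap_H.
  by apply/funext => z /=; rewrite Hsh_swp; case: (k0 _).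
- suff -> : swp \o (Hsh th \o k0) \o swp = Vsh th \o (swp \o k0 \o swp) by exact: shmap_V.
  by apply/funext.
Qed.

Lemma homeo_comp F G : homeomorphism F -> homeomorphism G -> homeomorphism (F \o G).
Proof.
move=> [/cont2P cF [F' [/cont2P cF' [FK F'K]]]] [/cont2P cG [G' [/cont2P cG' [GK G'K]]]].
split; first by apply/cont2P; exact: cont2_comp.
exists (G' \o F'); split; first by apply/cont2P; exact: cont2_comp.
by split => z /=; rewrite ?FK ?GK ?G'K ?F'K.
Qed.

Lemma shmap_homeo k : shmap k -> homeomorphism k.
Proof.
move=> sk; have [k' [sk' c c']] := shmap_inv sk.
split; first by apply/cont2P; exact: shmap_cont.
by exists k'; split => //; apply/cont2P; exact: shmap_cont.
Qed.

Lemma Zequiv_comp F G : Zequivariant F -> Zequivariant G -> Zequivariant (F \o G).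
Proof. by move=> hF hG a b z /=; rewrite hG hF. Qed.

Lemma cvg_to_pt (T : Type) (Fi : set_system T) (FF : Filter Fi) (f1 f2 : T -> R) (a b : R) :
  f1 x @[x --> Fi] --> a -> f2 x @[x --> Fi] --> b ->
  ((f1 x, f2 x) : pt R) @[x --> Fi] --> ((a, b) : pt R).
Proof.
move=> /cvgrPdist_le h1 /cvgrPdist_le h2 A /nbhs_near2P[d d0 hd].
by apply: filterS2 (h1 d d0) (h2 d d0) => x /= x1 x2; apply: hd; split.
Qed.

(** The isotopy of [F] is followed at time [t] by [S t]. Continuity of [S] is asked along arbitrary
    filters because the isotopy of [F] is continuous only within the strip of times between 0 and
    1. *)
Lemma lift_homeo0_isotopy (S : R -> pt R -> pt R) F :
  (forall t, homeomorphism (S t)) -> (forall t, Zequivariant (S t)) ->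
  (forall z, S 0 z = z) ->
  (forall (T : Type) (Fi : set_system T) (FF : Filter Fi) (t : T -> R) (f : T -> pt R) t0 z0,
     t x @[x --> Fi] --> t0 -> f x @[x --> Fi] --> z0 ->
     S (t x) (f x) @[x --> Fi] --> S t0 z0) ->
  lift_homeo0 F -> lift_homeo0 (S 1 \o F).
Proof.
move=> hS eS S0 cS [hF [eF [H [cH [H0 [H1 Ht]]]]]].
split; first exact: homeo_comp.
split; first exact: Zequiv_comp.
exists (fun p => S p.1 (H p)); split; last first.
  split; first by move=> z; rewrite S0 H0.
  split; first by move=> z /=; rewrite H1.
  move=> t t01; have [h e] := Ht t t01.
  by split; [exact: (homeo_comp (hS t) h) | exact: (Zequiv_comp (eS t) e)].
move=> p; apply: cS; last exact: cH.
have : {within [set p : R * pt R | 0 <= p.1 <= 1], continuous (fun p : R * pt R => p.1)}.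
  by apply: continuous_subspaceT => q; exact: cvg_fst.
exact.
Qed.

Lemma lift_homeo0_V th F : periodic1 th -> lipschitz1 th ->
  lift_homeo0 F -> lift_homeo0 (Vsh th \o F).
Proof.
move=> p l hF.
have -> : Vsh th = Vsh (fun x => 1 * th x) by congr Vsh; apply/funext => x; rewrite mul1r.
have sh t : shmap (Vsh (fun x => t * th x)).
  by apply: shmap_Vsh; [exact: periodic1Z | exact: lipschitz1Z].
apply: (@lift_homeo0_isotopy (fun t => Vsh (fun x => t * th x))) => //.
- by move=> t; exact: shmap_homeo.
- by move=> t; exact: shmap_equiv.
- by move=> z; rewrite /Vsh mul0r addr0 -surjective_pairing.
- move=> T Fi FF t f t0 z0 ct cf.
  have c1 : (f x).1 @[x --> Fi] --> z0.1 by apply: (cvg_comp _ _ cf); exact: cvg_fst.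
  have c2 : (f x).2 @[x --> Fi] --> z0.2 by apply: (cvg_comp _ _ cf); exact: cvg_snd.
  apply: cvg_to_pt => //; apply: cvgD => //; apply: cvgM => //.
  by apply: (cvg_comp _ _ c1); exact: lipschitz1_cont.
Qed.

Lemma lift_homeo0_H th F : periodic1 th -> lipschitz1 th ->
  lift_homeo0 F -> lift_homeo0 (Hsh th \o F).
Proof.
move=> p l hF.
have -> : Hsh th = Hsh (fun x => 1 * th x) by congr Hsh; apply/funext => x; rewrite mul1r.
have sh t : shmap (Hsh (fun x => t * th x)).
  by apply: shmap_Hsh; [exact: periodic1Z | exact: lipschitz1Z].
apply: (@lift_homeo0_isotopy (fun t => Hsh (fun x => t * th x))) => //.
- by move=> t; exact: shmap_homeo.
- by move=> t; exact: shmap_equiv.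
- by move=> z; rewrite /Hsh mul0r addr0 -surjective_pairing.
- move=> T Fi FF t f t0 z0 ct cf.
  have c1 : (f x).1 @[x --> Fi] --> z0.1 by apply: (cvg_comp _ _ cf); exact: cvg_fst.
  have c2 : (f x).2 @[x --> Fi] --> z0.2 by apply: (cvg_comp _ _ cf); exact: cvg_snd.
  apply: cvg_to_pt => //; apply: cvgD => //; apply: cvgM => //.
  by apply: (cvg_comp _ _ c2); exact: lipschitz1_cont.
Qed.

Lemma shmap_inH area k F : shmap k -> inH area F -> inH area (k \o F).
Proof.
move=> sk hF; elim: sk => [|th k0 p l _ [h a]|th k0 p l _ [h a]]; first exact: hF.
  split; first exact: (lift_homeo0_V p l h).
  by move=> /a ar; exact: (area_Vsh (lipschitz1_cont l) ar).
split; first exact: (lift_homeo0_H p l h).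
by move=> /a ar; exact: (area_Hsh (lipschitz1_cont l) ar).
Qed.

Lemma inH_cont area F : inH area F -> cont2 F.
Proof. by move=> [[[/cont2P cF _] _] _]. Qed.

Lemma inH_equiv area F : inH area F -> Zequivariant F.
Proof. by move=> [[_ [eF _]] _]. Qed.

Lemma inH_inj area F : inH area F -> injective F.
Proof. by move=> [[[_ [G [_ [c _]]]] _] _]; exact: can_inj c. Qed.

End Shears.

(** * Periodic bump functions and the elementary local move *)

Section Tents.
Variable R : realType.
Implicit Types (x y : R) (z w s t p q : pt R).

(** Distance to the nearest integer, that is, to 0 on the circle [R / Z]. *)
Definition dZ x : R := `|x - (Num.floor (x + 2^-1))%:~R|.

Lemma dZ_ge0 x : 0 <= dZ x. Proof. exact: normr_ge0. Qed.

Lemma dZ_ex x : exists n : int, dZ x = `|x - n%:~R|.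
Proof. by exists (Num.floor (x + 2^-1)). Qed.

Lemma dZ_le x (n : int) : dZ x <= `|x - n%:~R|.
Proof.
rewrite /dZ; set m := Num.floor _; have := floor_itv (x + 2^-1); rewrite -/m intrD.
move=> /andP[h1 h2].
have [->//|nm] := eqVneq n m.
have : (n + 1 <= m) || (m + 1 <= n) by lia.
move=> nm'; apply: (@le_trans _ _ 2^-1); first by rewrite ler_norml; apply/andP; split; lra.
rewrite ler_normr; move: nm' => /orP[]; rewrite -(ler_int R) intrD => h; apply/orP.
  by left; lra.
by right; lra.
Qed.

Lemma dZ_lip x y : `|dZ x - dZ y| <= `|x - y|.
Proof.
have h a b : dZ a - dZ b <= `|a - b|.
  have [n ->] := dZ_ex b; have := dZ_le a n.
  by have := ler_normD (a - b) (b - n%:~R); rewrite addrA subrK; lra.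
by rewrite ler_norml lerNl opprB h distrC h.
Qed.

Lemma dZ_per x (m : int) : dZ (x + m%:~R) = dZ x.
Proof.
have h a (n : int) : dZ (a + n%:~R) <= dZ a.
  have [i ->] := dZ_ex a; apply: (le_trans (dZ_le _ (i + n))).
  by rewrite intrD opprD addrACA subrr addr0.
apply/eqP; rewrite eq_le h /=.
by have := h (x + m%:~R) (- m); rewrite intrN addrK.
Qed.

Lemma dZN x : dZ (- x) = dZ x.
Proof.
have h a : dZ (- a) <= dZ a.
  have [i ->] := dZ_ex a; apply: (le_trans (dZ_le _ (- i))).
  by rewrite intrN -opprD normrN.
by apply/eqP; rewrite eq_le h /=; have := h (- x); rewrite opprK.
Qed.

Lemma dZ_small x : `|x| <= 2^-1 -> dZ x = `|x|.
Proof.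
move=> hx; apply/eqP; rewrite eq_le; have := dZ_le x 0; rewrite subr0 => -> /=.
have [n ->] := dZ_ex x; have [->|n0] := eqVneq n 0; first by rewrite subr0.
have h1 : 1 <= `|n%:~R : R| by rewrite -intr_norm -[1]/(1%:~R) ler_int; lia.
have := ler_normD (n%:~R - x) x; rewrite subrK distrC; lra.
Qed.

Lemma dZ_lt x (c : R) : dZ x < c -> exists n : int, `|x - n%:~R| < c.
Proof. by have [n ->] := dZ_ex x; exists n. Qed.

(** The periodic piecewise linear bump of height [a] and half-width [eta] centred at the integer
    translates of [x0]. *)
Definition tent (x0 eta a : R) x : R := a * Num.max 0 (1 - dZ (x - x0) / eta).

Lemma tent_ratio x0 eta x : 0 < eta ->
  0 <= Num.max 0 (1 - dZ (x - x0) / eta) <= 1.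
Proof.
move=> e0; rewrite le_max lexx /= ge_max ler01 /=.
by rewrite lerBlDr lerDl divr_ge0 ?dZ_ge0// ltW.
Qed.

Lemma tentP x0 eta a x : 0 < eta -> exists2 m : R, 0 <= m <= 1 & tent x0 eta a x = a * m.
Proof. by move=> /(tent_ratio x0 x) h; eexists; [exact: h|]. Qed.

Lemma tent_bound x0 eta a x : 0 < eta -> `|tent x0 eta a x| <= `|a|.
Proof.
move=> /(@tentP x0 eta a x)[m /andP[m0 m1] ->].
by rewrite normrM (ger0_norm m0) ler_piMr.
Qed.

Lemma tent_center x0 eta a : tent x0 eta a x0 = a.
Proof.
rewrite /tent subrr dZ_small ?normr0 ?mul0r ?subr0; last by rewrite invr_ge0.
by rewrite (max_idPr _) ?ler01// mulr1.
Qed.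

Lemma tent_far x0 eta a x : 0 < eta -> eta <= dZ (x - x0) -> tent x0 eta a x = 0.
Proof.
move=> e0 h; rewrite /tent (max_idPl _) ?mulr0//.
by rewrite subr_le0 ler_pdivlMr// mul1r.
Qed.

Lemma tent_near x0 eta a x : 0 < eta -> tent x0 eta a x != 0 -> dZ (x - x0) < eta.
Proof. by move=> e0; rewrite ltNge; apply: contra => h; rewrite tent_far. Qed.

Lemma tent_periodic x0 eta a : periodic1 (tent x0 eta a).
Proof. by move=> x m; rewrite /tent addrAC dZ_per. Qed.

Lemma tent_lip_bound x0 eta a x y : 0 < eta ->
  `|tent x0 eta a x - tent x0 eta a y| <= `|a| / eta * `|x - y|.
Proof.
move=> e0; rewrite /tent -mulrBr normrM -mulrA ler_wpM2l//.
have h : `|1 - dZ (x - x0) / eta - (1 - dZ (y - x0) / eta)| <= eta^-1 * `|x - y|.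
  have -> : 1 - dZ (x - x0) / eta - (1 - dZ (y - x0) / eta) =
    (dZ (y - x0) - dZ (x - x0)) / eta by ring.
  rewrite normrM (gtr0_norm (_ : 0 < eta^-1)) ?invr_gt0// mulrC ler_wpM2l ?invr_ge0 ?(ltW e0)//.
  apply: (le_trans (dZ_lip _ _)); rewrite distrC.
  by have -> : x - x0 - (y - x0) = x - y by ring.
by apply: maxr_lip => //; rewrite subrr normr0 mulr_ge0// invr_ge0 ltW.
Qed.

Lemma tent_lipschitz x0 eta a : 0 < eta -> lipschitz1 (tent x0 eta a).
Proof.
move=> e0; exists (`|a| / eta); first by rewrite divr_ge0// ltW.
by move=> x y; exact: tent_lip_bound.
Qed.

(* The commutator of a vertical and a horizontal tent shear is supported in a
   thin box around the segment from [s] to [(s.1, t2)]. *)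
Lemma vertical_move s (t2 eta beta : R) : 0 < eta -> 3 * eta <= 2^-1 -> 0 < beta ->
  exists k : pt R -> pt R, [/\ shmap k, k s = (s.1, t2) &
    forall z, k z <> z -> [/\ dZ (z.1 - s.1) < 4 * eta,
      exists2 m : R, 0 <= m <= 1 & dZ (z.2 - (s.2 + m * (t2 - s.2))) < beta,
      `|(k z).1 - z.1| <= 3 * eta & `|(k z).2 - z.2| <= `|t2 - s.2|]].
Proof.
move=> e0 e1 b0.
pose th := tent s.1 eta (t2 - s.2); pose al := tent s.2 beta (3 * eta).
(* At [s] the inverse horizontal shear pushes by [3 * eta], out of the support of [th], so the
   inverse vertical shear does nothing; the way back restores [s], and the last shear alone acts,
   bringing it to height [t2]. Where one of the two kinds of shear is trivial along the way, the
   other cancels. *)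
pose k := Vsh th \o (Hsh al \o (Vsh (fun x => - th x) \o Hsh (fun x => - al x))).
have pth : periodic1 th by exact: tent_periodic.
have pal : periodic1 al by exact: tent_periodic.
have lth : lipschitz1 th by exact: tent_lipschitz.
have lal : lipschitz1 al by exact: tent_lipschitz.
exists k; split.
- apply: shmap_V => //; apply: shmap_H => //.
  apply: shmap_V; [exact: periodic1N|exact: lipschitz1N|].
  apply: shmap_Hsh; [exact: periodic1N|exact: lipschitz1N].
- rewrite /k /= /Hsh /Vsh /= [al s.2]tent_center.
  have -> : th (s.1 - 3 * eta) = 0.
    rewrite /th tent_far// addrAC subrr sub0r dZN dZ_small gtr0_norm//; lra.
  rewrite !subr0 [al s.2]tent_center subrK [th s.1]tent_center.
  by congr pair; ring.
move=> z; pose x1 := z.1 - al z.2; pose y1 := z.2 - th x1; pose x2 := x1 + al y1.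
have kE : k z = (x2, y1 + th x2) by [].
have [m1 /andP[m10 m11] E1] := tentP s.2 (3 * eta) z.2 b0.
have [m2 /andP[m20 m21] E2] := tentP s.2 (3 * eta) y1 b0.
have [m3 /andP[m30 m31] E3] := tentP s.1 (t2 - s.2) x1 e0.
have [m4 /andP[m40 m41] E4] := tentP s.1 (t2 - s.2) x2 e0.
rewrite -/al in E1 E2; rewrite -/th in E3 E4.
have e3 : 0 <= 3 * eta by lra.
have p1 : 0 <= 3 * eta * m1 <= 3 * eta by rewrite mulr_ge0//= ler_piMr.
have p2 : 0 <= 3 * eta * m2 <= 3 * eta by rewrite mulr_ge0//= ler_piMr.
move: p1 p2 => /andP[p1 p1'] /andP[p2 p2'].
move=> kz; split.
- have : (th x1 != 0) || (th x2 != 0).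
    apply: contra_notT kz; rewrite negb_or !negbK => /andP[/eqP t1 /eqP t2'].
    rewrite kE t2' addr0 /x2 /y1 t1 subr0 /x1 subrK.
    by rewrite -surjective_pairing.
  have d x : `|x - z.1| <= 3 * eta -> dZ (x - s.1) < eta -> dZ (z.1 - s.1) < 4 * eta.
    move=> hx hd; have := dZ_lip (z.1 - s.1) (x - s.1).
    have -> : z.1 - s.1 - (x - s.1) = - (x - z.1) by ring.
    rewrite normrN ler_norml => /andP[_]; lra.
  move=> /orP[/tent_near|/tent_near] => /(_ e0); apply: d; rewrite ler_norml /x2 /x1 ?E2 E1;
    apply/andP; split; lra.
- have : (al z.2 != 0) || (al y1 != 0).
    apply: contra_notT kz; rewrite negb_or !negbK => /andP[/eqP t1 /eqP t2'].
    rewrite kE /x2 t2' addr0 /y1 subrK /x1 t1 subr0.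
    by rewrite -surjective_pairing.
  move=> /orP[/tent_near|/tent_near] => /(_ b0) h.
    by exists 0; rewrite ?lexx ?ler01// mul0r addr0.
  exists m3; first by rewrite m30.
  by have -> : z.2 - (s.2 + m3 * (t2 - s.2)) = y1 - s.2 by rewrite /y1 E3; ring.
- by rewrite kE /= /x2 /x1 E1 E2 ler_norml; apply/andP; split; lra.
- rewrite kE /= /y1 E3 E4.
  have -> : z.2 - (t2 - s.2) * m3 + (t2 - s.2) * m4 - z.2 = (t2 - s.2) * (m4 - m3) by ring.
  by rewrite normrM ler_piMr// ler_norml; apply/andP; split; lra.
Qed.

Lemma seq_lower (T : eqType) (Z : seq T) (f : T -> R) : (forall z : T, z \in Z -> 0 < f z) ->
  exists2 c : R, 0 < c & forall z : T, z \in Z -> c <= f z.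
Proof.
elim: Z => [|z Z IH] h; first by exists 1.
have [c c0 hc] := IH (fun (w : T) hw => h w (mem_behead (s := z :: Z) hw)).
exists (Num.min c (f z)); first by rewrite lt_min c0 h ?mem_head.
move=> w; rewrite inE => /orP[/eqP ->|/hc]; first by rewrite ge_min lexx orbT.
by apply: le_trans; rewrite ge_min lexx.
Qed.

Lemma int_eq_lt1 (a b : int) : a%:~R < b%:~R + 1 :> R -> b%:~R < a%:~R + 1 :> R -> a = b.
Proof.
rewrite -[1 : R]/(1%:~R) -!intrD !ltr_int; lia.
Qed.

End Tents.

(** * Cell-preserving transport *)

Section Cells.
Variable R : realType.
Variable N : nat.
Hypothesis N4 : (4 <= N)%N.
Implicit Types (z w s t p q : pt R) (k l : int * int) (h : pt R -> pt R).

Let n : R := N%:R.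

Definition cello k z : Prop := [/\ k.1%:~R < N%:R * z.1, N%:R * z.1 < k.1%:~R + 1,
  k.2%:~R < N%:R * z.2 & N%:R * z.2 < k.2%:~R + 1].

Definition cellc k z : Prop := [/\ k.1%:~R <= N%:R * z.1, N%:R * z.1 <= k.1%:~R + 1,
  k.2%:~R <= N%:R * z.2 & N%:R * z.2 <= k.2%:~R + 1].

Definition kshift k (a b : int) : int * int := (k.1 + N%:Z * a, k.2 + N%:Z * b).

Lemma n4 : 4 <= n. Proof. by rewrite /n (ler_nat R 4). Qed.

Lemma cello_cellc k z : cello k z -> cellc k z.
Proof. by case=> *; split; exact: ltW. Qed.

Lemma kshiftE k (a b : int) : ((kshift k a b).1%:~R = k.1%:~R + N%:R * a%:~R :> R) *
  ((kshift k a b).2%:~R = k.2%:~R + N%:R * b%:~R :> R).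
Proof. by rewrite /kshift /= !intrD !intrM. Qed.

Lemma cello_shift k z (a b : int) : cello (kshift k a b) (padd z (zvec R a b)) <-> cello k z.
Proof.
by rewrite /cello !kshiftE /= !mulrDr; split => -[? ? ? ?]; split; lra.
Qed.

Lemma cello_cellc_eq k l z : cello k z -> cellc l z -> k = l.
Proof.
move=> [? ? ? ?] [? ? ? ?]; rewrite [k]surjective_pairing [l]surjective_pairing.
by congr pair; apply: int_eq_lt1; lra.
Qed.

Definition cellpres h : Prop := forall k z,
  (cello k (h z) <-> cello k z) /\ (cellc k (h z) <-> cellc k z).

Lemma cellpres_comp h h' : cellpres h -> cellpres h' -> cellpres (h \o h').
Proof. by move=> hh hh' k z /=; have [-> ->] := hh k (h' z); exact: hh'. Qed.

(** An open cell meets no other closed cell, so staying in one open cell settles membership in every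
    cell. *)
Lemma cellpres_local h : (forall z, h z <> z -> exists2 k, cello k z & cello k (h z)) ->
  cellpres h.
Proof.
move=> hh k z; have [->//|/hh[l lz lhz]] := pselect (h z = z).
split; split => hk.
- by rewrite (cello_cellc_eq lhz (cello_cellc hk)) in lz.
- by rewrite (cello_cellc_eq lz (cello_cellc hk)) in lhz.
- by rewrite -(cello_cellc_eq lhz hk); exact: cello_cellc.
- by rewrite -(cello_cellc_eq lz hk); exact: cello_cellc.
Qed.

Lemma convex_itv (a b x y m : R) : a <= x <= b -> a <= y <= b -> 0 <= m <= 1 ->
  a <= x + m * (y - x) <= b.
Proof.
move=> /andP[h1 h2] /andP[h3 h4] /andP[m0 m1]; have m1' : 0 <= 1 - m by lra.
have i1 : 0 <= (1 - m) * (x - a) by apply: mulr_ge0; lra.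
have i2 : 0 <= m * (y - a) by apply: mulr_ge0; lra.
have i3 : 0 <= (1 - m) * (b - x) by apply: mulr_ge0; lra.
have i4 : 0 <= m * (b - y) by apply: mulr_ge0; lra.
by apply/andP; split; lra.
Qed.

Lemma vertical_cell_move k s (t2 : R) (Z : seq (pt R)) : cello k s -> cello k (s.1, t2) ->
  (forall z, z \in Z -> dZ (z.1 - s.1) <> 0) ->
  exists h, [/\ shmap h, cellpres h, h s = (s.1, t2) & forall z, z \in Z -> h z = z].
Proof.
move=> [s1 s2 s3 s4] [/= _ _ t3 t4] hZ; have n4' := n4.
have n0 : 0 < n by lra.
rewrite -/n in s1 s2 s3 s4 t3 t4.
have [c c0 hc] : exists2 c : R, 0 < c & forall z, z \in Z -> c <= dZ (z.1 - s.1).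
  apply: (@seq_lower R _ Z (fun z => dZ (z.1 - s.1))) => z /hZ /eqP zZ.
  by rewrite lt_neqAle eq_sym zZ dZ_ge0.
have [mu [mu0 mu1 mu2 mu3 mu4]] : exists mu : R, [/\ 0 < mu, k.1%:~R + mu <= n * s.1 <= k.1%:~R + 1 - mu,
   k.2%:~R + mu <= n * s.2 <= k.2%:~R + 1 - mu, k.2%:~R + mu <= n * t2 <= k.2%:~R + 1 - mu & mu <= 1].
  pose l : seq R := [:: n * s.1 - k.1%:~R; k.1%:~R + 1 - n * s.1; n * s.2 - k.2%:~R;
    k.2%:~R + 1 - n * s.2; n * t2 - k.2%:~R; k.2%:~R + 1 - n * t2; 1].
  have [mu mu0 hm] : exists2 mu : R, 0 < mu & forall x : R, x \in l -> mu <= x.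
    apply: (@seq_lower R _ l id) => x; rewrite !inE.
    by do 6 (case/orP => [/eqP -> /=|]; first by lra); move=> /eqP ->.
  have i (j : nat) : (j < 7)%N -> mu <= l`_j by move=> hj; apply: hm; exact: mem_nth.
  exists mu; have := i 0%N isT; have := i 1%N isT; have := i 2%N isT; have := i 3%N isT.
  by have := i 4%N isT; have := i 5%N isT; have := i 6%N isT => /= *; split;
    try (apply/andP; split); lra.
move/andP : mu1 => [mu1 mu1']; move/andP : mu2 => [mu2 mu2']; move/andP : mu3 => [mu3 mu3'].
(* A moved point starts within [4 * eta] of the column of [s] and shifts sideways by at most
   [3 * eta]: the total factor 7 stays below the divisor 8 of the margin [mu]. The bound [c / 4]
   keeps [Z] out of the support. *)
pose eta := Num.min (c / 4) (mu / (8 * n)); pose beta := mu / (8 * n).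
have b0 : 0 < beta by rewrite divr_gt0// mulr_gt0.
have bn : n * beta = mu / 8 by rewrite /beta; field; rewrite gt_eqF.
have bs : beta <= 1 / 32.
  by rewrite /beta ler_pdivrMr ?mulr_gt0//; lra.
have eta0 : 0 < eta by rewrite lt_min b0 andbT divr_gt0.
have eta1 : eta <= beta by rewrite ge_min lexx orbT.
have eta2 : 4 * eta <= c.
  have : eta <= c / 4 by rewrite ge_min lexx.
  lra.
have e3 : 3 * eta <= 2^-1 by lra.
have ne : n * eta <= mu / 8 by rewrite -bn ler_pM2l.
have [h [sh hs hsupp]] := vertical_move s t2 eta0 e3 b0.
exists h; split => //; last first.
  move=> z zZ; apply: contrapT => /hsupp[+ _ _ _].
  by have := hc z zZ; lra.
apply: cellpres_local => z hz.
have [z1 [m /andP[m0 m1] z2] d1 d2] := hsupp z hz.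
(* By injectivity [h z] is not fixed either, so the description of the support also locates its
   second coordinate. *)
have [|_ [m' /andP[m0' m1'] z2'] _ _] := hsupp (h z).
  by move=> /(shmap_inj sh).
have [a ha] := dZ_lt z1; have [b hb] := dZ_lt z2; have [b' hb'] := dZ_lt z2'.
have scale (x c' : R) : `|x| < c' -> - (n * c') < n * x < n * c'.
  by rewrite ltr_norml => /andP[? ?]; rewrite -mulrN !ltr_pM2l//; apply/andP.
have scalele (x c' : R) : `|x| <= c' -> - (n * c') <= n * x <= n * c'.
  by rewrite ler_norml => /andP[? ?]; rewrite -mulrN !ler_pM2l//; apply/andP.
(* The integer translates found for [z] and [h z] agree: as [N] is at least 4, cells have side at
   most 1/4, and the displacements involved add up to less than 1. *)
have bb : b' = b.
  have e : `|n * (t2 - s.2)| <= 1.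
    by rewrite mulrBr ler_norml; apply/andP; clear - s3 s4 t3 t4; split; lra.
  have e' : `|t2 - s.2| <= 1 / 4.
    have : n * `|t2 - s.2| <= 1 by move: e; rewrite normrM (gtr0_norm n0).
    have : 4 * `|t2 - s.2| <= n * `|t2 - s.2| by rewrite ler_wpM2r.
    by clear; lra.
  have e2 : `|(m' - m) * (t2 - s.2)| <= 1 / 4.
    by rewrite normrM -[1 / 4]mul1r; apply: ler_pM => //; rewrite ler_norml; apply/andP; clear - m0 m1 m0' m1'; split; lra.
  move: hb hb' d2 e2; rewrite !ltr_norml !mulrBl => /andP[c1 c2] /andP[c3 c4].
  have d2' : `|t2 - s.2| <= 1 / 4 by [].
  move=> /le_trans /(_ d2'); rewrite !ler_norml => /andP[c5 c6] /andP[c7 c8].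
  by apply: (@int_eq_lt1 R); clear - c1 c2 c3 c4 c5 c6 c7 c8 bs; lra.
rewrite bb {bb z2' b'} in hb'.
have mid (m'' : R) : 0 <= m'' -> m'' <= 1 ->
    k.2%:~R + mu <= n * (s.2 + m'' * (t2 - s.2)) <= k.2%:~R + 1 - mu.
  move=> h0 h1.
  have -> : n * (s.2 + m'' * (t2 - s.2)) = n * s.2 + m'' * (n * t2 - n * s.2) by ring.
  by apply: convex_itv; apply/andP.
have := scale _ _ ha; have := scale _ _ hb; have := scale _ _ hb'; have := scalele _ _ d1.
have := mid m m0 m1; have := mid m' m0' m1'.
rewrite !mulrBr => /andP[f1 f2] /andP[f3 f4] /andP[f5 f6] /andP[f7 f8] /andP[f9 f10] /andP[f11 f12].
exists (kshift k a b); rewrite /cello !kshiftE -/n; split.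
- by clear - f11 ne mu0 mu1 bn; lra.
- by clear - f12 ne mu0 mu1' bn; lra.
- by clear - f3 f9 bn mu0; lra.
- by clear - f4 f10 bn mu0; lra.
- by clear - f5 f11 ne mu0 mu1 bn; lra.
- by clear - f6 f12 ne mu0 mu1' bn; lra.
- by clear - f1 f7 bn mu0; lra.
- by clear - f2 f8 bn mu0; lra.
Qed.

Lemma cellpres_swap h : cellpres h -> cellpres (@swp R \o h \o @swp R).
Proof.
move=> hh k z /=; have := hh (k.2, k.1) (swp z); rewrite /cello /cellc /=.
case=> h1 h2; split; [have {h2} := h1|have {h1} := h2]; case=> a b; split => -[? ? ? ?].
- by have [] := a _ => //; split.
- by have [] := b _ => //; split.
- by have [] := a _ => //; split.
- by have [] := b _ => //; split.
Qed.

(* General position: no common coordinate modulo 1. *)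
Definition gp p q : Prop := dZ (p.1 - q.1) <> 0 /\ dZ (p.2 - q.2) <> 0.

Lemma gp_sym p q : gp p q -> gp q p.
Proof. by rewrite /gp -(dZN (p.1 - _)) -(dZN (p.2 - _)) !opprB. Qed.

Lemma gp_shift p q (a b a' b' : int) :
  gp (padd p (zvec R a b)) (padd q (zvec R a' b')) <-> gp p q.
Proof.
rewrite /gp /=.
have e (x y : R) (c c' : int) : dZ (x + c%:~R - (y + c'%:~R)) = dZ (x - y).
  by rewrite -(dZ_per (x - y) (c - c')) intrB; congr dZ; ring.
by rewrite !e.
Qed.

(** A vertical move to [(s.1, t.2)], then a horizontal one obtained by swapping. Hence the
    asymmetric condition: [Z] avoids the column of [s] and the row of [t]. *)
Lemma cell_move k s t (Z : seq (pt R)) : cello k s -> cello k t ->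
  (forall z, z \in Z -> dZ (z.1 - s.1) <> 0 /\ dZ (z.2 - t.2) <> 0) ->
  exists h, [/\ shmap h, cellpres h, h s = t & forall z, z \in Z -> h z = z].
Proof.
move=> ks kt hZ; have := ks; have := kt; move=> [t1 t2 t3 t4] [s1 s2 s3 s4].
have km : cello k (s.1, t.2) by split.
have [h1 [sh1 ch1 h1s h1Z]] := vertical_cell_move ks km (fun z hz => (hZ z hz).1).
have [||| h2 [sh2 ch2 h2s h2Z]] := @vertical_cell_move (k.2, k.1) (t.2, s.1) t.1 (map (@swp R) Z).
- by split.
- by split.
- by move=> z /mapP[w /hZ[_ h2] ->].
exists ((@swp R \o h2 \o @swp R) \o h1); split.
- by apply: shmap_comp => //; exact: shmap_swap.
- by apply: cellpres_comp => //; exact: cellpres_swap.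
- by rewrite /= h1s /swp /= h2s /= -surjective_pairing.
- move=> z hz; rewrite /= h1Z// h2Z; first by case: (z).
  exact: map_f.
Qed.

(** Points are moved one at a time. While [s i] moves, [Z] and the remaining sources stay fixed;
    afterwards [t i] joins [Z]. This explains the mixed condition between sources and targets. *)
Lemma transport (I : eqType) (idx : seq I) (s t : I -> pt R) (Z : seq (pt R)) :
  uniq idx ->
  (forall i, i \in idx -> exists2 k, cello k (s i) & cello k (t i)) ->
  (forall i j, i \in idx -> j \in idx -> i <> j ->
     [/\ gp (s i) (s j), gp (t i) (t j) & gp (s i) (t j)]) ->
  (forall i z, i \in idx -> z \in Z -> gp z (s i) /\ gp z (t i)) ->
  exists h, [/\ shmap h, cellpres h, forall i, i \in idx -> h (s i) = t i &
    forall z, z \in Z -> h z = z].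
Proof.
elim: idx Z => [|i idx IH] Z /=.
  by move=> _ _ _ _; exists idfun; split => //; exact: shmap_id.
move=> /andP[iidx uidx] hk hgp hZ.
have [k ks kt] := hk i (mem_head _ _).
have sub j : j \in idx -> j \in i :: idx by rewrite inE => ->; rewrite orbT.
have nij j : j \in idx -> j <> i by move=> jx ji; rewrite -ji jx in iidx.
have [|h0 [sh0 ch0 h0s h0Z]] := @cell_move k (s i) (t i) (Z ++ map s idx) ks kt.
  move=> z; rewrite mem_cat => /orP[zZ|/mapP[j jx ->]].
    by have [[a _] [_ b]] := hZ i z (mem_head _ _) zZ.
  by have [[a _] _ [_ b]] := hgp j i (sub j jx) (mem_head _ _) (nij j jx).
have [||||h1 [sh1 ch1 h1s h1Z]] := IH (t i :: Z) => //.
- by move=> j /sub; exact: hk.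
- by move=> j j' /sub jx /sub jx'; exact: hgp.
- move=> j z jx; rewrite inE => /orP[/eqP ->|zZ]; last exact: hZ (sub j jx) zZ.
  have [_ b c] := hgp j i (sub j jx) (mem_head _ _) (nij j jx).
  by split; exact: gp_sym.
exists (h1 \o h0); split.
- exact: shmap_comp.
- exact: cellpres_comp.
- move=> j; rewrite inE => /orP[/eqP ->|jx] /=; first by rewrite h0s h1Z// mem_head.
  by rewrite h0Z ?h1s// mem_cat map_f ?orbT.
- by move=> z zZ /=; rewrite h0Z ?mem_cat ?zZ// h1Z// inE zZ orbT.
Qed.

End Cells.

(** * Choosing points in general position *)

Section GeneralPosition.
Variable R : realType.
Implicit Types (z w p q : pt R) (F G : pt R -> pt R).

(** Bad classes modulo 1 are avoided one by one: a good point is found inside the current interval,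
    which then shrinks around it. *)
Lemma avoid1 (X : seq R) (a b : R) : a < b -> exists a' b' : R, [/\ a <= a', a' < b', b' <= b &
  forall x, a' <= x <= b' -> forall y, y \in X -> dZ (x - y) <> 0].
Proof.
move=> ab; elim: X => [|y X [a1 [b1 [h1 h2 h3 h4]]]]; first by exists a, b.
have [p [pa pb hp]] : exists p : R, [/\ a1 < p, p < b1 & 0 < dZ (p - y)].
  pose p := (a1 + b1) / 2; pose e := Num.min ((b1 - a1) / 4) (1 / 4).
  have e0 : 0 < e by rewrite lt_min; apply/andP; split; lra.
  have e1 : e <= (b1 - a1) / 4 by rewrite ge_min lexx.
  have e2 : e <= 1 / 4 by rewrite ge_min lexx orbT.
  have [pz|pnz] := eqVneq (dZ (p - y)) 0; last first.
    exists p; split; [by rewrite /p; lra|by rewrite /p; lra|].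
    by rewrite lt_neqAle eq_sym pnz dZ_ge0.
  exists (p + e); split; rewrite /p; [clear - h2 e0; lra|clear - h2 e1 e0; lra|].
  have [n] := dZ_ex (p - y); rewrite pz => /esym/eqP; rewrite normr_eq0 subr_eq0 => /eqP hn.
  have -> : (a1 + b1) / 2 + e - y = e + n%:~R by rewrite -hn /p; ring.
  rewrite dZ_per dZ_small gtr0_norm//; lra.
pose r := Num.min (dZ (p - y) / 2) (Num.min (p - a1) (b1 - p)).
have r0 : 0 < r by rewrite !lt_min; apply/and3P; split; lra.
have r1 : r <= dZ (p - y) / 2 by rewrite ge_min lexx.
have r2 : r <= p - a1 by rewrite !ge_min lexx orbT.
have r3 : r <= b1 - p by rewrite !ge_min lexx !orbT.
exists (p - r), (p + r); split; [lra|lra|lra|].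
move=> x /andP[x1 x2] w; rewrite inE => /orP[/eqP ->|wX]; last first.
  by apply: h4 => //; apply/andP; split; lra.
have := dZ_lip (p - y) (x - y); have -> : p - y - (x - y) = p - x by ring.
have : `|p - x| <= r by rewrite ler_norml; apply/andP; split; lra.
move=> le1 /le_trans /(_ le1); rewrite ler_norml => /andP[_]; lra.
Qed.

Lemma avoid2 z (d : R) (Z : seq (pt R)) : 0 < d -> exists z' (d' : R), 0 < d' /\
  forall w, near2 d' z' w -> near2 d z w /\ forall q, q \in Z -> gp w q.
Proof.
move=> d0.
have [|a1 [b1 [h1 h2 h3 h4]]] := @avoid1 (map fst Z) (z.1 - d) (z.1 + d); first by lra.
have [|a2 [b2 [g1 g2 g3 g4]]] := @avoid1 (map snd Z) (z.2 - d) (z.2 + d); first by lra.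
exists ((a1 + b1) / 2, (a2 + b2) / 2), (Num.min ((b1 - a1) / 2) ((b2 - a2) / 2)); split.
  by rewrite lt_min; apply/andP; split; lra.
move=> w [/=]; rewrite !le_min !ler_norml => /andP[/andP[? ?] _] /andP[_ /andP[? ?]].
split; first by apply/near2P; split; lra.
move=> q qZ; split; [apply: h4|apply: g4]; rewrite ?map_f//; apply/andP; split; lra.
Qed.

(** Each new point must be generic together with its image. A whole neighbourhood of good sources is
    secured, then a generic image is chosen in its image under [F] and pulled back by [G]. *)
Lemma choose_gp (I : eqType) (idx : seq I) (O : I -> pt R -> Prop) F G (Z1 Z2 : seq (pt R)) :
  cont2 G -> cancel F G -> cancel G F -> uniq idx ->
  (forall i, i \in idx -> exists z (d : R), 0 < d /\ forall w, near2 d z w -> O i w) ->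
  exists x : I -> pt R,
    (forall i, i \in idx -> [/\ O i (x i), forall q, q \in Z1 -> gp (x i) q &
       forall q, q \in Z2 -> gp (F (x i)) q]) /\
    (forall i j, i \in idx -> j \in idx -> i <> j ->
       gp (x i) (x j) /\ gp (F (x i)) (F (x j))).
Proof.
move=> cG FK GK; elim: idx => [|i idx IH] /=; first by move=> _ _; exists (fun=> (0, 0)).
move=> /andP[iidx uidx] hO.
have sub j : j \in idx -> j \in i :: idx by rewrite inE => ->; rewrite orbT.
have [x [x1 x2]] := IH uidx (fun j hj => hO j (sub j hj)).
have [z [d [d0 hz]]] := hO i (mem_head _ _).
have [z' [d' [d'0 hz']]] := avoid2 z (Z1 ++ map x idx) d0.
have [e e0 he] := cG (F z') d' d'0; rewrite FK in he.
have [u [e' [e'0 hu]]] := avoid2 (F z') (Z2 ++ map (F \o x) idx) e0.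
have [hu1 hu2] := hu u (near2_refl _ (ltW e'0)).
have [hg1 hg2] := hz' _ (he _ hu1).
exists (fun j => if j == i then G u else x j); split.
  move=> j; rewrite inE; case: eqP => [-> _|_ /= jx]; last exact: x1.
  split; first exact: hz.
    by move=> q qZ; apply: hg2; rewrite mem_cat qZ.
  by move=> q qZ; rewrite GK; apply: hu2; rewrite mem_cat qZ.
have new j : j \in idx -> gp (G u) (x j) /\ gp (F (G u)) (F (x j)).
  move=> jx; split; first by apply: hg2; rewrite mem_cat map_f ?orbT.
  by rewrite GK; apply: hu2; rewrite mem_cat (map_f (F \o x)) ?orbT.
move=> j j'; rewrite !inE; case: eqP => [-> _|_ /= jx]; case: eqP => [-> _|_ /= jx'] //.
- by move=> _; exact: new.
- by move=> _; have [a b] := new j jx; split; exact: gp_sym.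
- exact: x2.
Qed.

(* Sources and targets may coincide, so the points first move to fresh way points. *)
Lemma transport_gp (N : nat) (I : eqType) (idx : seq I) (s t : I -> pt R) : (4 <= N)%N ->
  uniq idx ->
  (forall i, i \in idx -> exists2 k, cello N k (s i) & cello N k (t i)) ->
  (forall i j, i \in idx -> j \in idx -> i <> j -> gp (s i) (s j) /\ gp (t i) (t j)) ->
  exists h, [/\ shmap h, cellpres N h & forall i, i \in idx -> h (s i) = t i].
Proof.
move=> N4 uidx hk hgp; have n4 : 4 <= N%:R :> R by rewrite (ler_nat R 4).
pose O i z := exists2 k, cello N k (s i) /\ cello N k (t i) & cello N k z.
have c2id : @cont2 R idfun by move=> z e e0; exists e.
have [|r [r1 r2]] := @choose_gp I idx O idfun idfun (map s idx ++ map t idx) [::]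
    c2id (fun=> erefl) (fun=> erefl) uidx.
  move=> i ix; have [k ks kt] := hk i ix.
  exists ((k.1%:~R + 1 / 2) / N%:R, (k.2%:~R + 1 / 2) / N%:R), (1 / 4 / N%:R).
  have n0 : 0 < N%:R :> R by lra.
  split; first by rewrite divr_gt0//; lra.
  move=> w [/= h1 h2]; exists k => //.
  have sc (x c : R) : `|c / N%:R - x| <= 1 / 4 / N%:R -> c - 1 / 4 <= N%:R * x <= c + 1 / 4.
    move=> h; have : `|c - N%:R * x| <= 1 / 4.
      have -> : c - N%:R * x = N%:R * (c / N%:R - x) by field; rewrite gt_eqF.
      by rewrite normrM (gtr0_norm n0) mulrC -ler_pdivlMr.
    by rewrite ler_norml => /andP[? ?]; apply/andP; split; lra.
  by move: (sc _ _ h1) (sc _ _ h2) => /andP[? ?] /andP[? ?]; split; lra.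
have rs i j : i \in idx -> j \in idx -> gp (r i) (s j).
  by move=> ix jx; have [_ h _] := r1 i ix; apply: h; rewrite mem_cat map_f.
have rt i j : i \in idx -> j \in idx -> gp (r i) (t j).
  by move=> ix jx; have [_ h _] := r1 i ix; apply: h; rewrite mem_cat map_f ?orbT.
have [|||h1 [sh1 ch1 h1s _]] := @transport R N N4 I idx s r [::] uidx.
- by move=> i ix; have [[k [ks kt] kr] _ _] := r1 i ix; exists k.
- move=> i j ix jx ij; split; [exact: (hgp _ _ ix jx ij).1|exact: (r2 _ _ ix jx ij).1|].
  by apply: gp_sym; exact: rs.
- by [].
have [|||h2 [sh2 ch2 h2s _]] := @transport R N N4 I idx r t [::] uidx.
- by move=> i ix; have [[k [ks kt] kr] _ _] := r1 i ix; exists k.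
- move=> i j ix jx ij; split; [exact: (r2 _ _ ix jx ij).1|exact: (hgp _ _ ix jx ij).2|].
  exact: rt.
- by [].
exists (h2 \o h1); split.
- exact: shmap_comp.
- exact: cellpres_comp.
- by move=> i ix /=; rewrite h1s// h2s.
Qed.

End GeneralPosition.

(** * Robust periodic orbits *)

Section Robust.
Variable R : realType.
Implicit Types (z w p q : pt R) (F G k : pt R -> pt R).

Lemma cont2_sub F G : cont2 F -> cont2 G ->
  cont2 (fun z => ((F z).1 - (G z).1, (F z).2 - (G z).2)).
Proof.
move=> cF cG z e e0; have e2 : 0 < e / 2 by lra.
have [d1 d10 h1] := cF z _ e2; have [d2 d20 h2] := cG z _ e2.
exists (Num.min d1 d2); first by rewrite lt_min d10.
move=> w zw.
have /h1/near2P[? ? ? ?] : near2 d1 z w by apply: near2_le zw; rewrite ge_min lexx.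
have /h2/near2P[? ? ? ?] : near2 d2 z w by apply: near2_le zw; rewrite ge_min lexx orbT.
by apply/near2P; split => /=; lra.
Qed.

Lemma miranda_box (D : pt R -> pt R) (x y eta r B s : R) :
  cont2 D -> 0 < eta -> 0 < r -> 0 < s ->
  let box z := x - eta <= z.1 <= x + eta /\ y <= z.2 <= y + r in
  (forall z, box z -> `|(D z).2| <= B) ->
  (forall z, box z -> z.2 = y -> 0 < (D z).1) ->
  (forall z, box z -> z.2 = y + r -> (D z).1 < 0) ->
  (forall z, box z -> z.1 = x - eta -> `|(D z).1| <= s -> (D z).2 < 0) ->
  (forall z, box z -> z.1 = x + eta -> `|(D z).1| <= s -> 0 < (D z).2) ->
  exists z, D z = (0, 0).
Proof.
move=> cD eta0 r0 s0 box hB hb ht hl hr.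
pose A z : pt R := (x - eta + 2 * eta * z.1, y + r * z.2).
have cA : cont2 A.
  apply: (@cont2_lip _ _ (2 * eta + r)); first by lra.
  move=> z w d [h1 h2]; have d0 : 0 <= d := le_trans (normr_ge0 _) h1.
  split => /=.
    have -> : x - eta + 2 * eta * z.1 - (x - eta + 2 * eta * w.1) = 2 * eta * (z.1 - w.1) by ring.
    rewrite normrM gtr0_norm; last by lra.
    by apply: ler_pM => //; lra.
  have -> : y + r * z.2 - (y + r * w.2) = r * (z.2 - w.2) by ring.
  rewrite normrM gtr0_norm//.
  by apply: ler_pM => //; lra.
have bx z : unitsq z -> box (A z).
  move=> [z1 z2 z3 z4]; have m1 := mulr_ge0 (ltW eta0) z1; have m2 := mulr_ge0 (ltW r0) z3.
  have m3 : eta * z.1 <= eta by rewrite ler_piMr// ltW.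
  have m4 : r * z.2 <= r by rewrite ler_piMr// ltW.
  by split; apply/andP; split; rewrite /A /=; lra.
have u01 (t : R) : 0 <= t <= 1 -> [/\ unitsq (t, 0), unitsq (t, 1), unitsq (0, t) & unitsq (1, t)].
  by move=> /andP[t0 t1]; split; split => //=; lra.
have [|||||z _ Dz] := @miranda_steep R (D \o A) B s (cont2_comp cD cA) s0.
- by move=> z /bx; exact: hB.
- move=> t /u01[u _ _ _]; apply: hb; first exact: bx.
  by rewrite /A /= mulr0 addr0.
- move=> t /u01[_ u _ _]; apply: ht; first exact: bx.
  by rewrite /A /= mulr1.
- move=> t /u01[_ _ u _]; apply: hl; first exact: bx.
  by rewrite /A /= mulr0 addr0.
- move=> t /u01[_ _ _ u]; apply: hr; first exact: bx.
  by rewrite /A /= mulr1; lra.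
by exists (A z).
Qed.

Lemma tent_tame (c c' e a x : R) : 0 < e -> `|c' - c| + e <= dZ (x - c) -> tent c' e a x = 0.
Proof.
move=> e0 h; apply: tent_far => //.
have := dZ_lip (x - c) (x - c'); have -> : x - c - (x - c') = c' - c by ring.
by rewrite ler_norml => /andP[_]; lra.
Qed.

Lemma iter_near_orbit G p m (e : R) : cont2 G -> 0 < e ->
  exists2 r : R, 0 < r & forall z, near2 r p z ->
    forall i, (i <= m)%N -> near2 e (iter i G p) (iter i G z).
Proof.
move=> cG e0; elim: m => [|m [r r0 IH]].
  by exists e => // z h i; rewrite leqn0 => /eqP ->.
have [d d0 hd] := cont2_iter m.+1 cG p e0.
exists (Num.min r d); first by rewrite lt_min r0.
move=> z h i; rewrite leq_eqVlt => /orP[/eqP ->|].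
  by apply: hd; apply: near2_le h; rewrite ge_min lexx orbT.
by rewrite ltnS; apply: IH; apply: near2_le h; rewrite ge_min lexx.
Qed.

(* Small shears near [x0] act trivially on points whose coordinates are both
   [rho]-far from those of [x0] modulo 1. *)
Definition fixes_far (x0 : pt R) (rho : R) k : Prop := forall w,
  rho <= dZ (w.1 - x0.1) -> rho <= dZ (w.2 - x0.2) -> k w = w.

(** A horizontal shear cannot separate [q2] from [x0] at equal heights. A vertical tent centred at
    [q2.1] and vanishing at [x0.1] repairs this. *)
Lemma lift_second (x0 q2 : pt R) (kap : R) : 0 < kap -> kap <= 1 / 4 -> near2 kap x0 q2 -> q2 <> x0 ->
  exists k, [/\ shmap k, fixes_far x0 (2 * kap) k, forall z, near2 kap z (k z), k x0 = x0 &
    (k q2).2 <> x0.2].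
Proof.
move=> k0 k4 [n1 n2] q20.
have [h2|h2] := pselect (q2.2 = x0.2); last first.
  exists idfun; split => //; first exact: shmap_id.
  by move=> z; apply: near2_refl; exact: ltW.
have h1 : 0 < `|q2.1 - x0.1|.
  rewrite normr_gt0 subr_eq0; apply/eqP => h1; apply: q20.
  by rewrite [q2]surjective_pairing h1 h2 -surjective_pairing.
rewrite distrC in n1.
exists (Vsh (tent q2.1 `|q2.1 - x0.1| kap)); split.
- by apply: shmap_Vsh; [exact: tent_periodic | exact: tent_lipschitz].
- move=> w w1 _; rewrite /Vsh (@tent_tame x0.1) ?addr0 -?surjective_pairing//.
  by apply: le_trans w1; lra.
- move=> z; split; rewrite /= ?subrr ?normr0 ?(ltW k0)// opprD addrA subrr sub0r normrN.
  by rewrite -[leRHS](gtr0_norm k0); exact: tent_bound.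
- rewrite /Vsh tent_far// ?addr0 -?surjective_pairing// dZ_small distrC//.
  by apply: (le_trans n1); lra.
- by rewrite /= tent_center h2; lra.
Qed.

(** The two tents have half-width equal to the difference of heights, so each vanishes at the centre
    of the other. Since [q.1] is at most [x0.1 + 2 * kap], the image of [q] ends at least [2 * kap]
    to the left of [x0]. *)
Lemma push_apart (x0 q : pt R) (kap : R) : 0 < kap -> kap <= 1 / 16 -> near2 (2 * kap) x0 q -> q.2 <> x0.2 ->
  exists k, [/\ shmap k, fixes_far x0 (4 * kap) k, forall z, near2 (5 * kap) z (k z),
    k x0 = (x0.1 + kap, x0.2) & (k q).1 = q.1 - 4 * kap].
Proof.
move=> k0 k16 [_ n2] q20; rewrite distrC in n2.
pose om := `|q.2 - x0.2|.
have om0 : 0 < om by rewrite normr_gt0 subr_eq0; exact/eqP.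
pose th x := tent x0.2 om kap x + tent q.2 om (- (4 * kap)) x.
have omh : om <= 2^-1 by apply: (le_trans n2); lra.
exists (Hsh th); split.
- apply: shmap_Hsh; first by apply: periodic1D; exact: tent_periodic.
  by apply: lipschitz1D; exact: tent_lipschitz.
- move=> w _ w2; rewrite /Hsh /th.
  have -> : tent x0.2 om kap w.2 = 0.
    by apply: (@tent_tame x0.2) => //; rewrite subrr normr0 add0r; clear - k0 n2 w2; rewrite /om; lra.
  have -> : tent q.2 om (- (4 * kap)) w.2 = 0.
    by apply: (@tent_tame x0.2) => //; clear - k0 n2 w2; rewrite /om; lra.
  by rewrite !addr0 -surjective_pairing.
- move=> z; split; rewrite /= ?subrr ?normr0; last by lra.
  rewrite opprD addrA subrr sub0r normrN /th.
  have b1 := tent_bound x0.2 kap z.2 om0; have b2 := tent_bound q.2 (- (4 * kap)) z.2 om0.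
  rewrite normrN (gtr0_norm (_ : 0 < 4 * kap)) in b2; last by lra.
  rewrite (gtr0_norm k0) in b1.
  by apply: (le_trans (ler_normD _ _)); lra.
- by rewrite /Hsh /th tent_center tent_far ?addr0// dZ_small distrC.
- by rewrite /Hsh /th tent_center tent_far ?add0r// dZ_small.
Qed.

(** A rise of [40 * kap] over the width [2 * eta] outweighs vertical displacements of a few [kap],
    with opposite signs on the two sides of a thin box. *)
Lemma steep_shear (x0 eta kap : R) : 0 < eta -> eta <= kap -> kap <= 1 / 16 ->
  exists th, [/\ periodic1 th, lipschitz1 th,
    forall x, 2 * kap <= dZ (x - x0) -> th x = 0, forall x, `|th x| <= 40 * kap &
    [/\ th (x0 + eta) = 20 * kap, th (x0 - eta) = - (20 * kap) &
     forall x y, `|th x - th y| <= 40 * kap / eta * `|x - y|]].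
Proof.
move=> e0 ek k16.
pose th x := tent (x0 + eta) eta (20 * kap) x + tent (x0 - eta) eta (- (20 * kap)) x.
have T0 : 0 < 20 * kap by lra.
exists th; split.
- by apply: periodic1D; exact: tent_periodic.
- by apply: lipschitz1D; exact: tent_lipschitz.
- move=> x hx; rewrite /th.
  have -> : tent (x0 + eta) eta (20 * kap) x = 0.
    apply: (@tent_tame x0) => //; have -> : x0 + eta - x0 = eta by ring.
    by rewrite gtr0_norm//; lra.
  have -> : tent (x0 - eta) eta (- (20 * kap)) x = 0.
    apply: (@tent_tame x0) => //; have -> : x0 - eta - x0 = - eta by ring.
    by rewrite normrN gtr0_norm//; lra.
  by rewrite addr0.
- move=> x; have b1 := tent_bound (x0 + eta) (20 * kap) x e0.
  have b2 := tent_bound (x0 - eta) (- (20 * kap)) x e0.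
  rewrite normrN in b2; rewrite (gtr0_norm T0) in b1 b2.
  by apply: (le_trans (ler_normD _ _)); lra.
split.
- rewrite /th tent_center tent_far ?addr0//.
  have -> : x0 + eta - (x0 - eta) = 2 * eta by ring.
  by rewrite dZ_small gtr0_norm; lra.
- rewrite /th tent_center tent_far ?add0r//.
  have -> : x0 - eta - (x0 + eta) = - (2 * eta) by ring.
  by rewrite dZN dZ_small gtr0_norm; lra.
- move=> x y; have b1 := tent_lip_bound (x0 + eta) (20 * kap) x y e0.
  have b2 := tent_lip_bound (x0 - eta) (- (20 * kap)) x y e0.
  rewrite normrN in b2; rewrite (gtr0_norm T0) in b1 b2.
  have -> : 40 * kap / eta * `|x - y| = 20 * kap / eta * `|x - y| + 20 * kap / eta * `|x - y|.
    by rewrite -mulrDl -mulrDl; congr (_ / _ * _); lra.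
  by rewrite /th opprD addrACA; apply: (le_trans (ler_normD _ _)); apply: lerD.
Qed.

End Robust.

Section Robustify.
Variable R : realType.
Implicit Types (z w p q : pt R) (F G k : pt R -> pt R).

(** The perturbation acts on the orbit only near [x 0], hence once per period. It destroys that
    orbit, but the return displacement now points right on the bottom and left on the top of a box
    of height [r] and half-width [eta], while the steep shear fixes the sign of its vertical part on
    the other sides wherever its horizontal part is small. *)
Lemma robust_periodic G (m : nat) (x : nat -> pt R) (a b : int) (Z : seq (pt R)) (del : R) :
  cont2 G -> injective G -> Zequivariant G -> (0 < m)%N ->
  (forall i, (i < m)%N -> G (x i) = x i.+1) -> x m = padd (x 0%N) (zvec R a b) ->
  (forall i, (0 < i < m)%N -> gp (x i) (x 0%N)) -> (forall z, z \in Z -> gp z (x 0%N)) ->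
  0 < del ->
  exists k, [/\ shmap k, forall z, near2 del z (k z), forall z, z \in Z -> k z = z &
    exists2 d : R, 0 < d & forall G', cont2 G' -> (forall z, near2 d (G' z) (k (G z))) ->
      exists z, iter m G' z = padd z (zvec R a b)].
Proof.
move=> cG iG eG m0 hx xm gx gZ del0.
set x0 := x 0%N in xm gx gZ *.
have xE i : (i <= m)%N -> iter i G x0 = x i.
  by elim: i => // i IH hi; rewrite iterS IH ?(ltnW hi)// hx.
pose L := Z ++ [seq x i | i <- iota 1 m.-1].
have [c c0 hc] : exists2 c : R, 0 < c & forall z, z \in L ->
    c <= Num.min (dZ (z.1 - x0.1)) (dZ (z.2 - x0.2)).
  apply: (@seq_lower R _ L (fun z => Num.min (dZ (z.1 - x0.1)) (dZ (z.2 - x0.2)))) => z.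
  rewrite mem_cat => hz.
  have [/eqP g1 /eqP g2] : gp z x0.
    case/orP : hz => [/gZ//|/mapP[i]]; rewrite mem_iota => hi ->.
    by apply: gx; lia.
  by rewrite lt_min !lt_neqAle eq_sym g1 eq_sym g2 !dZ_ge0.
(* [c / 16] keeps points within [kap] of [L] at distance at least [4 * kap] from [x0] in both
   coordinates; [del / 100] covers the total motion [46 * kap] of the three shears. *)
pose kap := Num.min (c / 16) (Num.min (del / 100) (1 / 100)).
have kap0 : 0 < kap by rewrite !lt_min; apply/and3P; split; lra.
have kapc : kap <= c / 16 by rewrite ge_min lexx.
have kapd : kap <= del / 100 by rewrite !ge_min lexx orbT.
have kap1 : kap <= 1 / 100 by rewrite !ge_min lexx !orbT.
have [r' r'0 hr'] := iter_near_orbit x0 m cG kap0.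
pose r := Num.min r' kap.
have r0 : 0 < r by rewrite lt_min r'0.
have rk : r <= kap by rewrite ge_min lexx orbT.
have hr z : near2 r x0 z -> forall i, (i <= m)%N -> near2 kap (x i) (iter i G z).
  move=> h i hi; rewrite -(xE i hi); apply: hr' => //.
  by apply: near2_le h; rewrite ge_min lexx.
clearbody r; clearbody kap; clear r'0 hr'.
(* The return map followed by the inverse integer translation, so that [x0] becomes a fixed
   point. *)
pose g0 z := padd (iter m G z) (zvec R (- a) (- b)).
have g0E z : iter m G z = padd (g0 z) (zvec R a b).
  by rewrite /g0 /padd /= !intrN !subrK -surjective_pairing.
have g0x : g0 x0 = x0.
  by rewrite /g0 xE// xm /padd /= !intrN !addrK -surjective_pairing.
have g0n z : near2 r x0 z -> near2 kap x0 (g0 z).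
  by move=> h; have := hr z h m (leqnn m); rewrite xm g0E near2_padd.
have g0i : injective g0.
  have iiG : injective (iter m G) by elim: (m) => // i IH; exact: (inj_comp iG IH).
  move=> z w [/addIr e1 /addIr e2]; apply: iiG.
  by rewrite [LHS]surjective_pairing [RHS]surjective_pairing e1 e2.
have cg0 : cont2 g0.
  move=> z e e0; have [d d0 hd] := cont2_iter m cG z e0.
  by exists d => // w /hd h; rewrite near2_padd.
(* The middle of the top side. By injectivity its image differs from [x0], so the two images can be
   pushed in opposite directions. *)
pose p2 : pt R := (x0.1, x0.2 + r).
have p2n : near2 r x0 p2 by apply/near2P; split => /=; lra.
have q2x : g0 p2 <> x0.
  move=> h; have := g0i p2 x0; rewrite h g0x => /(_ erefl) /(congr1 snd) /= e.
  by clear - e r0; lra.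
have [V' [sV' fV' nV' V'x V'q]] := lift_second kap0 ltac:(lra) (g0n _ p2n) q2x.
set q := V' (g0 p2) in V'q.
have qn : near2 (2 * kap) x0 q.
  have -> : 2 * kap = kap + kap by ring.
  exact: near2_trans (g0n _ p2n) (nV' _).
have [H [sH fH nH Hx Hq]] := push_apart kap0 ltac:(lra) qn V'q.
pose g1 z := H (V' (g0 z)).
have cg1 : cont2 g1.
  by apply: (cont2_comp (shmap_cont sH)); exact: (cont2_comp (shmap_cont sV') cg0).
have g1x : g1 x0 = (x0.1 + kap, x0.2) by rewrite /g1 g0x V'x Hx.
have g1p : (g1 p2).1 <= x0.1 - 2 * kap.
  rewrite /g1 -/q Hq; move/near2P : qn => [_ h _ _]; clear - h; lra.
have g1n z : near2 r x0 z -> near2 (7 * kap) x0 (g1 z).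
  move=> /g0n h; have -> : 7 * kap = kap + kap + 5 * kap by ring.
  exact: near2_trans (near2_trans h (nV' _)) (nH _).
have kap4 : 0 < kap / 4 by lra.
have [d1 d10 hd1] := cg1 x0 _ kap4; have [d2 d20 hd2] := cg1 p2 _ kap4.
(* Thin enough for [g1] on the bottom and top sides to be read off at [x0] and [p2] up to
   [kap / 4]. *)
pose eta := Num.min (Num.min d1 d2) (Num.min r (kap / 4)).
have eta0 : 0 < eta by rewrite !lt_min d10 d20 r0.
have ed1 : eta <= d1 by rewrite !ge_min lexx.
have ed2 : eta <= d2 by rewrite !ge_min lexx !orbT.
have er : eta <= r by rewrite !ge_min lexx !orbT.
have ek : eta <= kap / 4 by rewrite !ge_min lexx !orbT.
have [th [pth lth far_th bth [thp thm thl]]] := @steep_shear R x0.1 eta kap eta0 ltac:(lra) ltac:(lra).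
pose k := Vsh th \o (H \o V').
have sk : shmap k.
  by apply: shmap_comp; [exact: shmap_Vsh | exact: shmap_comp].
have k_far w : 4 * kap <= dZ (w.1 - x0.1) -> 4 * kap <= dZ (w.2 - x0.2) -> k w = w.
  move=> w1 w2; rewrite /k /= fV'; [|clear - w1 kap0; lra|clear - w2 kap0; lra].
  rewrite fH// /Vsh far_th; last by clear - w1 kap0; lra.
  by rewrite addr0 -surjective_pairing.
have k_L z w : z \in L -> near2 kap z w -> k w = w.
  move=> /hc; rewrite le_min => /andP[z1 z2] [w1 w2]; apply: k_far.
    have := dZ_lip (z.1 - x0.1) (w.1 - x0.1); have -> : z.1 - x0.1 - (w.1 - x0.1) = z.1 - w.1 by ring.
    by move=> /le_trans /(_ w1); rewrite ler_norml => /andP[_ h]; clear - h z1 kapc kap0; lra.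
  have := dZ_lip (z.2 - x0.2) (w.2 - x0.2); have -> : z.2 - x0.2 - (w.2 - x0.2) = z.2 - w.2 by ring.
  by move=> /le_trans /(_ w2); rewrite ler_norml => /andP[_ h]; clear - h z2 kapc kap0; lra.
exists k; split => //.
- move=> z; have nV : near2 (40 * kap) (H (V' z)) (k z).
    split; rewrite /k /= ?subrr ?normr0; first by clear - kap0; lra.
    by rewrite opprD addrA subrr sub0r normrN.
  apply: near2_le (near2_trans (near2_trans (nV' z) (nH _)) nV); clear - kapd kap0; lra.
- by move=> z zZ; apply: (@k_L z) => //; [rewrite mem_cat zZ | apply: near2_refl; exact: ltW].
pose G2 := k \o G.
have uG2 : ucont G2.
  apply: Zequiv_ucont; first exact: (cont2_comp (shmap_cont sk) cG).
  exact: (Zequiv_comp (shmap_equiv sk) eG).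
(* Before the last step the orbit stays within [kap] of points of [L], where [k] is the identity. *)
have iterG2 z : near2 r x0 z -> iter m G2 z = padd (Vsh th (g1 z)) (zvec R a b).
  move=> hz; have lt_m i : (i < m)%N -> iter i G2 z = iter i G z.
    elim: i => // i IH hi; rewrite !iterS IH ?(ltnW hi)// /G2 /=.
    apply: (@k_L (x i.+1)); last exact: (hr z hz i.+1 (ltnW hi)).
    rewrite mem_cat; apply/orP; right; apply: map_f; rewrite mem_iota.
    by clear - hi m0; lia.
  have -> : m = m.-1.+1 by rewrite prednK.
  rewrite iterS lt_m ?prednK// /G2 /= -iterS prednK// g0E (shmap_equiv sk).
  by [].
(* Matched to the slope [40 * kap / eta]: an uncertainty [2 * s] in the abscissa changes [th] by at
   most [kap]. *)
pose s := eta / 80.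
have s0 : 0 < s by rewrite /s; clear - eta0; lra.
have se : 40 * kap / eta * (2 * s) = kap by rewrite /s; field; rewrite gt_eqF.
have [d d0 hd] := iter_near m uG2 s0.
exists d => // G' cG' hG'.
pose D z : pt R := ((iter m G' z).1 - (padd z (zvec R a b)).1, (iter m G' z).2 - (padd z (zvec R a b)).2).
have cD : cont2 D.
  apply: cont2_sub; first exact: cont2_iter.
  by move=> z e e0; exists e => // w h; rewrite near2_padd.
have D12 z : near2 r x0 z -> near2 s (D z) ((g1 z).1 - z.1, (g1 z).2 + th (g1 z).1 - z.2).
  move=> hz; have := hd G' hG' z; rewrite iterG2// => /near2P /= [h1 h2 h3 h4].
  by apply/near2P; rewrite /D /=; clear - h1 h2 h3 h4; split; lra.
have se' : s <= kap / 320 by rewrite /s; clear - ek; lra.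
have boxn z : x0.1 - eta <= z.1 <= x0.1 + eta -> x0.2 <= z.2 <= x0.2 + r -> near2 r x0 z.
  move=> /andP[z1 z2] /andP[z3 z4].
  by apply/near2P; clear - z1 z2 z3 z4 er; split; lra.
have [|||||z Dz] := @miranda_box R D x0.1 x0.2 eta r (50 * kap) s cD eta0 r0 s0.
- move=> z [z1 z2]; have hz := boxn z z1 z2.
  have /near2P /= [_ _ h3 h4] := D12 z hz; have /near2P [_ _ h5 h6] := g1n z hz.
  have := bth (g1 z).1; rewrite ler_norml => /andP[h7 h8].
  move/andP : z2 => [z3 z4].
  by rewrite ler_norml; apply/andP; clear - h3 h4 h5 h6 h7 h8 z3 z4 se' rk kap0; split; lra.
- move=> z [z1 z2] zy; have hz := boxn z z1 z2.
  have /near2P /= [_ h2 _ _] := D12 z hz.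
  move/andP : z1 => [z1 z1'].
  have /hd1/near2P : near2 d1 x0 z by apply/near2P; clear - z1 z1' zy ed1 d10; split; lra.
  by rewrite g1x /= => -[h3 _ _ _]; clear - h2 h3 z1' se' ek kap0; lra.
- move=> z [z1 z2] zy; have hz := boxn z z1 z2.
  have /near2P /= [h2 _ _ _] := D12 z hz.
  move/andP : z1 => [z1 z1'].
  have /hd2/near2P : near2 d2 p2 z by apply/near2P; rewrite /p2 /=; clear - z1 z1' zy ed2 d20; split; lra.
  by move=> [_ h3 _ _]; clear - h2 h3 z1 g1p se' ek kap0; lra.
- move=> z [z1 z2] zx; have hz := boxn z z1 z2.
  have /near2P /= [h1 h2 h3 h4] := D12 z hz; have /near2P [_ _ h5 h6] := g1n z hz.
  rewrite ler_norml => /andP[h7 h8]; move/andP : z2 => [z3 z4].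
  (* A horizontal displacement of at most [s] leaves the image close to the left edge, where [th] is
     [- (20 * kap)]; this beats all other terms. The right side is symmetric. *)
  have h9 : `|(g1 z).1 - (x0.1 - eta)| <= 2 * s.
    by rewrite -zx ler_norml; apply/andP; clear - h1 h2 h7 h8; split; lra.
  have := thl (g1 z).1 (x0.1 - eta); rewrite thm.
  have c1 : 0 <= 40 * kap / eta by rewrite divr_ge0// ?ltW//; clear - kap0; lra.
  move=> /le_trans /(_ (ler_wpM2l c1 h9)); rewrite se ler_norml => /andP[h10 h11].
  by clear - h3 h4 h5 h6 h10 h11 z3 z4 se' kap0 rk; lra.
- move=> z [z1 z2] zx; have hz := boxn z z1 z2.
  have /near2P /= [h1 h2 h3 h4] := D12 z hz; have /near2P [_ _ h5 h6] := g1n z hz.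
  rewrite ler_norml => /andP[h7 h8]; move/andP : z2 => [z3 z4].
  have h9 : `|(g1 z).1 - (x0.1 + eta)| <= 2 * s.
    by rewrite -zx ler_norml; apply/andP; clear - h1 h2 h7 h8; split; lra.
  have := thl (g1 z).1 (x0.1 + eta); rewrite thp.
  have c1 : 0 <= 40 * kap / eta by rewrite divr_ge0// ?ltW//; clear - kap0; lra.
  move=> /le_trans /(_ (ler_wpM2l c1 h9)); rewrite se ler_norml => /andP[h10 h11].
  by clear - h3 h4 h5 h6 h10 h11 z3 z4 se' kap0 rk; lra.
exists z; move: Dz => [/eqP + /eqP]; rewrite !subr_eq0 => /eqP e1 /eqP e2.
by rewrite [LHS]surjective_pairing e1 e2.
Qed.

End Robustify.

(** * Walks in the transition graph *)

Section HullClosed.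
Variable R : realType.

Lemma continuous_lin n (c : 'I_n -> R) :
  continuous (fun v : 'rV[R]_n => \sum_(i < n) v ord0 i * c i).
Proof.
have h (r : seq 'I_n) : continuous (fun v : 'rV[R]_n => \sum_(i <- r) v ord0 i * c i).
  elim: r => [|i r IH].
    rewrite [X in continuous X](_ : _ = cst 0); first exact: cst_continuous.
    by apply/funext => v; rewrite big_nil.
  rewrite [X in continuous X](_ : _ = fun v : 'rV[R]_n => v ord0 i * c i + \sum_(i <- r) v ord0 i * c i).
    have cc : continuous (fun u : 'rV[R]_n => u ord0 i * c i).
      move=> v.
      exact: (continuous_comp (@coord_continuous R 1 n ord0 i v) (@mulrr_continuous R (c i) _)).
    by move=> v; exact: (cvgD (cc v) (IH v)).
  by apply/funext => v; rewrite big_cons.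
exact: h.
Qed.

(** The weights range over a compact cube. [f] adds up the defects of the two coordinates and of the
    total weight, so the cube can replace the simplex; were [w] outside the hull, [f] would be
    bounded below there. *)
Lemma hull_closed n (p : 'I_n -> pt R) (w : pt R) :
  (forall e : R, 0 < e -> exists2 x, hull p x & near2 e w x) -> hull p w.
Proof.
move=> hw; apply: contrapT => nw.
pose K := [set v : 'rV[R]_n | forall i, `[0 : R, 1]%classic (v ord0 i)].
have cK : compact K.
  by apply: (@rV_compact R n (fun=> `[0 : R, 1]%classic)) => i; exact: segment_compact.
pose s (v : 'rV[R]_n) := \sum_(i < n) v ord0 i * 1.
pose s1 (v : 'rV[R]_n) := \sum_(i < n) v ord0 i * (p i).1.
pose s2 (v : 'rV[R]_n) := \sum_(i < n) v ord0 i * (p i).2.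
pose f v := `|s v - 1| + `|s1 v - w.1| + `|s2 v - w.2|.
have cf : continuous f.
  have cn (c : 'I_n -> R) (y : R) : continuous (fun v : 'rV[R]_n => `|\sum_(i < n) v ord0 i * c i - y|).
    by move=> v; exact: (cvg_norm (cvgB (@continuous_lin n c v) (cvg_cst y))).
  by move=> v; exact: (cvgD (cvgD (cn _ 1 v) (cn _ w.1 v)) (cn _ w.2 v)).
move/compact_near_coveringP : cK => /(_ nat \oo%classic (fun m v => m.+1%:R^-1 < f v) _).
case.
  move=> v Kv.
  have fv0 : 0 < f v.
    rewrite lt_neqAle eq_sym addr_ge0 ?addr_ge0// andbT; apply/eqP => fv.
    have := normr_ge0 (s v - 1); have := normr_ge0 (s1 v - w.1); have := normr_ge0 (s2 v - w.2).
    move=> n1 n2 n3; move: fv; rewrite /f => fv.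
    have /eqP : `|s v - 1| = 0 by lra.
    have /eqP : `|s1 v - w.1| = 0 by lra.
    have /eqP : `|s2 v - w.2| = 0 by lra.
    rewrite !normr_eq0 !subr_eq0 => /eqP e2 /eqP e1 /eqP e0.
    apply: nw; exists (fun i => v ord0 i); split; first by move=> i; have /= := Kv i; rewrite in_itv /= => /andP[].
    split; first by rewrite -e0; apply: eq_bigr => i _; rewrite mulr1.
    by rewrite [w]surjective_pairing -e1 -e2.
  have fv2 : 0 < f v / 2 by rewrite divr_gt0.
  have [m _ hm] := near_infty_natSinv_lt (PosNum fv2).
  exists ([set u | f v / 2 < f u], [set j | (m <= j)%N]).
    split; last by exists m.
    have /cvgrPdist_lt := cf v; move=> /(_ _ fv2); apply: filterS => u /=.
    by rewrite ltr_norml => /andP[_ h]; clear - h; lra.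
  by move=> [u j] /= [fu mj]; apply: lt_trans (hm j mj) fu.
move=> m _ hm; have e0 : 0 < m.+1%:R^-1 / 2 :> R by rewrite divr_gt0// invr_gt0.
have [x [l [l0 [l1 xE]]] [n1 n2]] := hw _ e0.
pose v : 'rV[R]_n := \row_i l i.
have vE (c : 'I_n -> R) : \sum_(i < n) v ord0 i * c i = \sum_(i < n) l i * c i.
  by apply: eq_bigr => i _; rewrite mxE.
have := hm m (leqnn m) v; rewrite /f /s /s1 /s2 !vE.
have -> : \sum_(i < n) l i * 1 = 1 by under eq_bigr do rewrite mulr1.
rewrite subrr normr0 add0r; move: n1 n2; rewrite xE /= (distrC w.1) (distrC w.2) => n1 n2.
have Kv : K v.
  move=> i; rewrite /= in_itv /= mxE l0 /= -l1 (bigD1 i)//= lerDl.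
  by apply: sumr_ge0.
move=> /(_ Kv); move: (m.+1%:R^-1 : R) n1 n2; clear => c; lra.
Qed.

End HullClosed.

Section Walks.
Variable N : nat.
Hypothesis N0 : (0 < N)%N.
Variable E : int * int -> int * int -> Prop.
Hypothesis Eshift : forall k l a b, E k l -> E (kshift N k a b) (kshift N l a b).
Variable M : nat.
Hypothesis Ebound : forall k l, E k l ->
  `|l.1 - k.1| <= M%:Z /\ `|l.2 - k.2| <= M%:Z.

Fixpoint walk n k l : Prop := if n is n'.+1 then exists2 c, E k c & walk n' c l else k = l.

Lemma walk_cat n m a b c : walk n a b -> walk m b c -> walk (n + m) a c.
Proof.
elim: n a => [|n IH] a /=; first by move=> ->.
by move=> [d ad db] bc; exists d => //; exact: IH.
Qed.

Lemma walk_shift n k l a b : walk n k l -> walk n (kshift N k a b) (kshift N l a b).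
Proof.
elim: n k => [|n IH] k /=; first by move=> ->.
by move=> [c kc cl]; exists (kshift N c a b); [exact: Eshift | exact: IH].
Qed.

Lemma walk_bound n k l : walk n k l ->
  `|l.1 - k.1| <= (M * n)%N%:Z /\ `|l.2 - k.2| <= (M * n)%N%:Z.
Proof.
elim: n k => [|n IH] k /=; first by move=> ->; rewrite !subrr muln0.
by move=> [c /Ebound[? ?] /IH[? ?]]; rewrite mulnS; lia.
Qed.

Lemma kshift_add k a b a' b' : kshift N (kshift N k a b) a' b' = kshift N k (a + a') (b + b').
Proof. by rewrite /kshift /=; congr pair; lia. Qed.

Lemma kshift0 k : kshift N k 0 0 = k.
Proof. by rewrite /kshift !mulr0 !addr0 -surjective_pairing. Qed.

Lemma walk_fun n k l : walk n k l -> exists f : nat -> int * int,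
  [/\ f 0%N = k, f n = l & forall i j, (i <= j)%N -> (j <= n)%N -> walk (j - i) (f i) (f j)].
Proof.
elim: n k => [|n IH] k /=.
  move=> ->; exists (fun=> l); split => // i j ij; rewrite leqn0 => /eqP j0.
  by rewrite j0.
move=> [c kc /IH[f [f0 fn ff]]].
exists (fun i => if i is i'.+1 then f i' else k); split => //.
move=> [|i] [|j] //=; last by move=> ij jn; exact: ff.
by move=> _ jn; exists c => //; have := ff 0%N j (leq0n _) jn; rewrite subn0 f0.
Qed.

(** Pigeonhole on the [N * N] classes of cells modulo integer translations. *)
Lemma walk_loop n k l : walk n k l -> (N * N <= n)%N ->
  exists i m r c a b, [/\ walk i k c, walk m c (kshift N c a b),
    walk r (kshift N c a b) l, n = (i + m + r)%N & (0 < m <= N * N)%N].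
Proof.
move=> /walk_fun[f [f0 fn ff]] nV.
case: N N0 Eshift nV => // N' _ _ nV.
pose res (x : int) : 'I_N'.+1 := inord `|(x %% N'.+1)%Z|%N.
pose g (i : 'I_(N'.+1 * N'.+1).+1) := (res (f i).1, res (f i).2).
have ninj : ~ injective g.
  by move=> /leq_card; rewrite card_prod !card_ord ltnn.
have [i [j [gij ij]]] : exists i j, g i = g j /\ i <> j.
  apply: contrapT => h; apply: ninj => i j gij; apply: contrapT => ij.
  by apply: h; exists i, j.
wlog ltij : i j gij ij / (i < j)%N.
  move=> W; case: (ltngtP i j) => h; first exact: (W i j).
    by apply: (W j i) => // /esym.
  by case: ij; exact: val_inj.
have resE (x y : int) : res x = res y -> exists a : int, y = x + N'.+1%:Z * a.
  have md (u : int) : (`|(u %% N'.+1)%Z| < N'.+1)%N.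
    by have := modz_ge0 u (isT : N'.+1%:Z != 0); have := ltz_pmod u (isT : 0 < N'.+1%:Z); lia.
  move=> /(congr1 val); rewrite /= !inordK// => e.
  exists ((y %/ N'.+1)%Z - (x %/ N'.+1)%Z).
  have := divz_eq x N'.+1; have := divz_eq y N'.+1.
  have := modz_ge0 x (isT : N'.+1%:Z != 0); have := modz_ge0 y (isT : N'.+1%:Z != 0).
  by rewrite mulrBr [_ * (y %/ _)%Z]mulrC [_ * (x %/ _)%Z]mulrC; lia.
case: gij => /resE[a ha] /resE[b hb].
have fj : f j = kshift N'.+1 (f i) a b by rewrite /kshift -ha -hb -surjective_pairing.
have jn : (j <= n)%N by apply: leq_trans nV; rewrite -ltnS.
exists i, (j - i)%N, (n - j)%N, (f i), a, b; split.
- by have := ff 0%N i (leq0n _) (leq_trans (ltnW ltij) jn); rewrite subn0 f0.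
- by rewrite -fj; apply: ff => //; exact: ltnW.
- by rewrite -fj -fn; exact: ff.
- by rewrite subnKC ?subnKC// ltnW.
- by rewrite subn_gt0 ltij /= (leq_trans (leq_subr _ _))// -ltnS.
Qed.

Lemma loops_enum : exists n (mm : 'I_n -> nat) (aa bb : 'I_n -> int),
  (forall i, (0 < mm i <= N * N)%N /\ exists c, walk (mm i) c (kshift N c (aa i) (bb i))) /\
  (forall m a b c, (0 < m <= N * N)%N -> walk m c (kshift N c a b) ->
     exists i, [/\ mm i = m, aa i = a & bb i = b]).
Proof.
pose D := (M * (N * N))%N.
pose T := ('I_(N * N).+1 * 'I_(2 * D).+1 * 'I_(2 * D).+1)%type.
pose tm (t : T) : nat := t.1.1.
pose ta (t : T) : int := t.1.2%:Z - D%:Z.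
pose tb (t : T) : int := t.2%:Z - D%:Z.
pose A := [set t : T | (0 < tm t)%N && `[< exists c, walk (tm t) c (kshift N c (ta t) (tb t)) >]]%SET.
exists #|A|, (fun i => tm (enum_val i)), (fun i => ta (enum_val i)), (fun i => tb (enum_val i)).
split.
  move=> i; have := enum_valP i; rewrite inE => /andP[-> /asboolP h]; split => //.
  by rewrite /= /tm -ltnS ltn_ord.
move=> m a b c /andP[m0 mV] w.
have [ba bb] := walk_bound w; rewrite /kshift /= in ba bb.
have mD : (M * m <= D)%N by rewrite leq_mul2l mV orbT.
have N1 : 1 <= N%:Z by rewrite lez_nat.
have aD : `|a| <= D%:Z.
  have : `|N%:Z * a| <= D%:Z by move: ba mD; lia.
  by rewrite normrM; move: N1; case: (N) => // N'; clear; nia.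
have bD : `|b| <= D%:Z.
  have : `|N%:Z * b| <= D%:Z by move: bb mD; lia.
  by rewrite normrM; move: N1; case: (N) => // N'; clear; nia.
pose t : T := (inord m, inord (absz (a + D%:Z)), inord (absz (b + D%:Z))).
have tmE : tm t = m by rewrite /tm /= inordK.
have taE : ta t = a by rewrite /ta /= inordK; lia.
have tbE : tb t = b by rewrite /tb /= inordK; lia.
have tA : t \in A.
  by rewrite inE tmE m0 taE tbE; apply/asboolP; exists c.
exists (enum_rank_in tA t); rewrite enum_rankK_in//.
Qed.

(** Loops are cut out, and counted in [cnt], until fewer than [N * N] steps remain; the remainder
    contributes a bounded error. *)
Lemma walk_decomp n0 (mm : 'I_n0 -> nat) (aa bb : 'I_n0 -> int) :
  (forall m a b c, (0 < m <= N * N)%N -> walk m c (kshift N c a b) ->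
     exists i, [/\ mm i = m, aa i = a & bb i = b]) ->
  forall n k l, walk n k l -> exists cnt : 'I_n0 -> nat,
   [/\ (\sum_(i < n0) cnt i * mm i <= n)%N, (n <= \sum_(i < n0) cnt i * mm i + N * N)%N,
     `|l.1 - k.1 - N%:Z * \sum_(i < n0) (cnt i)%:Z * aa i| <= (M * (N * N))%N%:Z &
     `|l.2 - k.2 - N%:Z * \sum_(i < n0) (cnt i)%:Z * bb i| <= (M * (N * N))%N%:Z].
Proof.
move=> hloop n; have [j] := ubnP n; elim: j n => // j IH n nj k l w.
case: (ltnP n (N * N)) => nV.
  exists (fun=> 0%N); have [h1 h2] := walk_bound w.
  rewrite !big1; [|by move=> *; rewrite mul0r|by move=> *; rewrite mul0r|by []].
  have : (M * n <= M * (N * N))%N by rewrite leq_mul2l (ltnW nV) orbT.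
  by split; lia.
have [i [m [r [c [a [b [w1 w2 w3 nE /andP[m0 mV]]]]]]]] := walk_loop w nV.
(* Cutting the loop shifts the tail back by the displacement of the loop, which the count of [i0]
   restores. *)
have w' : walk (i + r) k (kshift N l (- a) (- b)).
  apply: (walk_cat w1); have := walk_shift (- a) (- b) w3.
  by rewrite kshift_add !subrr kshift0.
have [|cnt [c1 c2 c3 c4]] := IH _ _ _ _ w'; first by lia.
have [i0 [em ea eb]] := hloop m a b c ltac:(by rewrite m0) w2.
exists (fun i => cnt i + (i == i0))%N.
have -> : (\sum_(i1 < n0) (cnt i1 + (i1 == i0)) * mm i1 = \sum_(i1 < n0) cnt i1 * mm i1 + m)%N.
  under eq_bigr do rewrite mulnDl.
  rewrite big_split /= -em; congr addn.
  by rewrite (bigD1 i0)//= eqxx mul1n big1 ?addn0// => i1 /negbTE ->; rewrite mul0n.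
have sm (d : 'I_n0 -> int) : \sum_(i1 < n0) (cnt i1 + (i1 == i0))%N%:Z * d i1 =
    \sum_(i1 < n0) (cnt i1)%:Z * d i1 + d i0.
  under eq_bigr do rewrite PoszD mulrDl.
  rewrite big_split /=; congr (_ + _).
  by rewrite (bigD1 i0)//= eqxx mul1r big1 ?addr0// => i1 /negbTE ->; rewrite mul0r.
rewrite !sm ea eb; move: c3 c4; rewrite /kshift /=.
move: (\sum_(_ < n0) _ * aa _) (\sum_(_ < n0) _ * bb _) (\sum_(_ < n0) _)%N c1 c2 => S1 S2 S3.
by rewrite nE => ? ? ? ?; split; lia.
Qed.

End Walks.

(** * Upper bound: the rotation set lies in the hull of the loop means *)

Section RotationHull.
Variable R : realType.
Variable N : nat.
Hypothesis N0 : (0 < N)%N.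
Implicit Types (z w : pt R) (F G : pt R -> pt R) (k l : int * int).

(** Two graphs with complementary virtues: every orbit follows closed contacts, while interior
    contacts ([Eint]) persist under perturbation. *)
Definition Ecl F k l : Prop := exists2 z, cellc N k z & cellc N l (F z).
Definition Eint F k l : Prop := exists2 z, cello N k z & cello N l (F z).

Lemma cell_ex z : exists k, cellc N k z.
Proof.
exists (Num.floor (N%:R * z.1), Num.floor (N%:R * z.2)).
have := floor_itv (N%:R * z.1); have := floor_itv (N%:R * z.2).
by rewrite !intrD => /andP[? ?] /andP[? ?]; split => //=; exact: ltW.
Qed.

Variable E : int * int -> int * int -> Prop.

Lemma orbit_walk G n z k : (forall k l, Ecl G k l -> E k l) -> cellc N k z ->
  exists2 l, walk E n k l & cellc N l (iter n G z).
Proof.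
move=> GE; elim: n z k => [|n IH] z k kz; first by exists k.
have [c cz] := cell_ex (G z); have [l wl lz] := IH (G z) c cz.
by exists l; rewrite ?iterSr//; exists c => //; apply: GE; exists z.
Qed.

Hypothesis Eshift : forall k l a b, E k l -> E (kshift N k a b) (kshift N l a b).
Variable M : nat.
Hypothesis Ebound : forall k l, E k l ->
  `|l.1 - k.1| <= M%:Z /\ `|l.2 - k.2| <= M%:Z.

Variables (n0 : nat) (mm : 'I_n0 -> nat) (aa bb : 'I_n0 -> int).
Hypothesis mm0 : forall i, (0 < mm i)%N.
Hypothesis loops : forall m a b c, (0 < m <= N * N)%N -> walk E m c (kshift N c a b) ->
  exists i, [/\ mm i = m, aa i = a & bb i = b].

Definition loop_pt (i : 'I_n0) : pt R := ((aa i)%:~R / (mm i)%:R, (bb i)%:~R / (mm i)%:R).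

Lemma loop_index G : (forall k l, Ecl G k l -> E k l) -> (0 < n0)%N.
Proof.
move=> GE.
have [k kz] := cell_ex (0, 0); have [l w _] := orbit_walk (N * N) GE kz.
have [i [m [r [c [a [b [_ w2 _ _ mV]]]]]]] := walk_loop N0 Eshift w (leqnn _).
by have [j _] := loops mV w2; exact: leq_ltn_trans (leq0n j) (ltn_ord j).
Qed.

(** The weight of a loop is the share of time spent on it. The leftover time [r] goes to an
    arbitrary loop [i0], so that the weights add up to 1. *)
Lemma weight_sum (cnt : 'I_n0 -> nat) (i0 : 'I_n0) (d : 'I_n0 -> int) (n : nat) (r : R) :
  \sum_(i < n0) (((cnt i * mm i)%N%:R + (i == i0)%:R * r) / n%:R) * ((d i)%:~R / (mm i)%:R) =
  ((\sum_(i < n0) (cnt i)%:Z * d i)%:~R + r * ((d i0)%:~R / (mm i0)%:R)) / n%:R.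
Proof.
rewrite rmorph_sum /=.
have -> : r * ((d i0)%:~R / (mm i0)%:R) = \sum_(i < n0) (i == i0)%:R * r * ((d i)%:~R / (mm i)%:R).
  by rewrite (bigD1 i0)//= eqxx mul1r big1 ?addr0// => i /negbTE ->; rewrite !mul0r.
rewrite -big_split /= mulr_suml; apply: eq_bigr => i _.
have mi : (mm i)%:R != 0 :> R by rewrite pnatr_eq0 -lt0n.
rewrite natrM intrM -[(cnt i)%:~R]/((cnt i)%:R) mulrAC; congr (_ / _).
by rewrite mulrDl; congr (_ + _); field.
Qed.

Lemma rot_sub_hull G : (forall k l, Ecl G k l -> E k l) -> rotation_set G `<=` hull loop_pt.
Proof.
move=> GE w [zz [nn [hn cw]]]; apply: hull_closed => e e0.
have [i0 _] : exists i0 : 'I_n0, True by exists (Ordinal (loop_index GE)).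
(* The first terms bound the uncut remainder of the walk and the position inside cells; the last one
   is the cost of giving the leftover time, at most [V], to [i0]. *)
pose V := (N * N)%N; pose C : R := (M * V)%N%:R + 1 + V%:R * (`|(loop_pt i0).1| + `|(loop_pt i0).2|).
have C0 : 0 <= C by rewrite !addr_ge0// mulr_ge0// addr_ge0.
have e2 : 0 < e / 2 by lra.
have [K hK] := cvg_near2P cw e2.
have [M1 hM1] := nat_large (C / (e / 2)).
have [K' hK'] := hn M1.+1.
pose j := maxn K K'; pose n := nn j; pose z := zz j.
have /hK : (K <= j)%N by rewrite leq_maxl.
have /hK' : (K' <= j)%N by rewrite leq_maxr.
rewrite -/n -/z => nM nw.
have n1 : (0 < n)%N by exact: leq_trans nM.
have n1' : 0 < n%:R :> R by rewrite ltr0n.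
have Cn : C / n%:R <= e / 2.
  rewrite ler_pdivrMr// mulrC -ler_pdivrMr//; apply: hM1; exact: ltnW.
have [k kz] := cell_ex z; have [l wl lz] := orbit_walk n GE kz.
have [cnt [c1 c2 c3 c4]] := walk_decomp N0 Eshift Ebound loops wl.
set W := (\sum_(i < n0) cnt i * mm i)%N in c1 c2.
pose r : R := n%:R - W%:R.
have r0 : 0 <= r by rewrite subr_ge0 ler_nat.
have rV : r <= V%:R by rewrite lerBlDr -natrD ler_nat addnC.
pose la i : R := ((cnt i * mm i)%N%:R + (i == i0)%:R * r) / n%:R.
exists (\sum_(i < n0) la i * (loop_pt i).1, \sum_(i < n0) la i * (loop_pt i).2).
  exists la; split; first by move=> i; rewrite divr_ge0// addr_ge0// mulr_ge0.
  split => //.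
  have sW : \sum_(i < n0) (cnt i * mm i)%N%:R = W%:R :> R by rewrite /W natr_sum.
  have sr : \sum_(i < n0) (i == i0)%:R * r = r.
    rewrite (bigD1 i0) //= big1 ?addr0; first by rewrite eqxx mul1r.
    by move=> i /negbTE ->; rewrite mul0r.
  by rewrite -mulr_suml big_split /= sW sr addrC subrK divff// gt_eqF.
have -> : e = e / 2 + e / 2 by lra.
apply: near2_trans (near2_sym nw) _; apply: near2_le Cn _.
have coord (d : 'I_n0 -> int) (x y : R) (lk kk : int) :
    kk%:~R <= N%:R * x -> N%:R * x <= kk%:~R + 1 -> lk%:~R <= N%:R * y -> N%:R * y <= lk%:~R + 1 ->
    `|lk - kk - N%:Z * \sum_(i < n0) (cnt i)%:Z * d i| <= (M * (N * N))%N%:Z ->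
    `|(d i0)%:~R / (mm i0)%:R : R| <= `|(loop_pt i0).1| + `|(loop_pt i0).2| ->
    `|n%:R^-1 * (y - x) - \sum_(i < n0) la i * ((d i)%:~R / (mm i)%:R)| <= C / n%:R.
  move=> x1 x2 y1 y2 hd hp; rewrite weight_sum mulrC -mulrBl normrM (gtr0_norm (_ : 0 < n%:R^-1)) ?invr_gt0//.
  rewrite ler_pM2r ?invr_gt0//.
  set S : R := (\sum_(i < n0) _)%:~R.
  have hS : `|N%:R * (y - x - S)| <= (M * V)%N%:R + 1.
    have : `|(lk - kk - N%:Z * \sum_(i < n0) (cnt i)%:Z * d i)%:~R : R| <= (M * V)%N%:R.
      by rewrite -intr_norm -[(M * V)%N%:R]/(((M * V)%N%:Z)%:~R) ler_int.
    rewrite !intrB intrM -/S -[N%:~R]/(N%:R) !ler_norml => /andP[h1 h2].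
    by apply/andP; clear - h1 h2 x1 x2 y1 y2; split; lra.
  have hS' : `|y - x - S| <= (M * V)%N%:R + 1.
    apply: le_trans hS; rewrite normrM ler_peMl// ger0_norm// (ler_nat R 1) //.
  have hr : `|r * ((d i0)%:~R / (mm i0)%:R)| <= V%:R * (`|(loop_pt i0).1| + `|(loop_pt i0).2|).
    by rewrite normrM ger0_norm//; apply: ler_pM.
  by rewrite opprD addrA; apply: (le_trans (ler_normB _ _)); exact: lerD.
case: kz => ? ? ? ?; case: lz => ? ? ? ?.
split; apply: coord; try eassumption.
  by rewrite /loop_pt /= lerDl.
by rewrite /loop_pt /= lerDr.
Qed.

Lemma hull_rational : (0 < n0)%N -> rational_polygon (hull loop_pt).
Proof.
move=> n00; exists n0, (fun i => ((aa i)%:~R / (mm i)%:R, (bb i)%:~R / (mm i)%:R)); split => //.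
have e (a : int) (m : nat) : ratr (a%:~R / m%:R) = a%:~R / m%:R :> R.
  by rewrite fmorph_div /= ratr_int ratr_nat.
by apply/seteqP; split => x [l [l0 [l1 ->]]]; exists l; split => //; split => //;
  congr pair; apply: eq_bigr => i _; rewrite /= e.
Qed.

End RotationHull.

(** * Perturbation to a stable graph *)

Section MaxGraph.
Variable R : realType.
Variable N : nat.
Hypothesis N0 : (0 < N)%N.
Implicit Types (z w : pt R) (F G : pt R -> pt R) (k l : int * int).

Lemma cello_open k z : cello N k z -> exists2 d : R, 0 < d & forall w, near2 d z w -> cello N k w.
Proof.
move=> [h1 h2 h3 h4]; have n0 : 0 < N%:R :> R by rewrite ltr0n.
pose l : seq R := [:: N%:R * z.1 - k.1%:~R; k.1%:~R + 1 - N%:R * z.1;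
   N%:R * z.2 - k.2%:~R; k.2%:~R + 1 - N%:R * z.2].
have [mu mu0 hm] : exists2 mu : R, 0 < mu & forall x : R, x \in l -> mu <= x.
  apply: (@seq_lower R _ l id) => x; rewrite !inE.
  by do 3 (case/orP => [/eqP -> /=|]; first by lra); move=> /eqP -> /=; lra.
have i (j : nat) : (j < 4)%N -> mu <= l`_j by move=> hj; apply: hm; exact: mem_nth.
have := i 0%N isT; have := i 1%N isT; have := i 2%N isT; have := i 3%N isT => /= m1 m2 m3 m4.
exists (mu / (2 * N%:R)); first by rewrite divr_gt0// mulr_gt0.
move=> w [w1 w2].
have sc (x y : R) : `|x - y| <= mu / (2 * N%:R) -> - (mu / 2) <= N%:R * x - N%:R * y <= mu / 2.
  move=> xy; rewrite -mulrBr -ler_norml normrM (gtr0_norm n0) mulrC -ler_pdivlMr//.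
  by rewrite -mulrA -invfM.
move: (sc _ _ w1) (sc _ _ w2) => /andP[a1 a2] /andP[a3 a4].
by split; clear - a1 a2 a3 a4 m1 m2 m3 m4 mu0; lra.
Qed.

Lemma cellc_approx k z (s : R) : 0 < s -> cellc N k z -> exists2 w, cello N k w & near2 s z w.
Proof.
move=> s0 [h1 h2 h3 h4]; have n0 : 1 <= N%:R :> R by rewrite (ler_nat R 1).
pose t := Num.min s 1; have t0 : 0 < t by rewrite lt_min s0 ltr01.
have t1 : t <= 1 by rewrite ge_min lexx orbT.
have ts : t <= s by rewrite ge_min lexx.
have n0' : 0 < N%:R :> R by lra.
have mv (x c : R) : c <= N%:R * x -> N%:R * x <= c + 1 ->
    [/\ c < N%:R * (x + t * ((c + 1 / 2) / N%:R - x)), N%:R * (x + t * ((c + 1 / 2) / N%:R - x)) < c + 1 &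
    `|x - (x + t * ((c + 1 / 2) / N%:R - x))| <= s].
  move=> x1 x2.
  have eq : N%:R * (x + t * ((c + 1 / 2) / N%:R - x)) = (1 - t) * (N%:R * x) + t * (c + 1 / 2).
    by field; rewrite gt_eqF.
  rewrite eq.
  have t1' : 0 <= 1 - t by lra.
  have i1 : 0 <= (1 - t) * (N%:R * x - c) by apply: mulr_ge0 => //; lra.
  have i2 : 0 <= (1 - t) * (c + 1 - N%:R * x) by apply: mulr_ge0 => //; lra.
  split; [by clear - i1 t0; lra|by clear - i2 t0; lra|].
  have -> : x - (x + t * ((c + 1 / 2) / N%:R - x)) = t * ((N%:R * x - (c + 1 / 2)) / N%:R).
    by field; rewrite gt_eqF.
  rewrite normrM gtr0_norm//; apply: le_trans ts; rewrite ler_piMr ?(ltW t0)//.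
  rewrite normrM (gtr0_norm (_ : 0 < N%:R^-1)) ?invr_gt0// ler_pdivrMr// [1 * N%:R]mul1r.
  by apply: (le_trans _ n0); rewrite ler_norml; apply/andP; clear - x1 x2; split; lra.
have [a1 a2 a3] := mv _ _ h1 h2; have [b1 b2 b3] := mv _ _ h3 h4.
by exists (z.1 + t * ((k.1%:~R + 1 / 2) / N%:R - z.1), z.2 + t * ((k.2%:~R + 1 / 2) / N%:R - z.2)).
Qed.

Lemma kshiftK k (a b : int) : kshift N (kshift N k a b) (- a) (- b) = k.
Proof. by rewrite /kshift [RHS]surjective_pairing /=; congr pair; lia. Qed.

Lemma Eint_shift F k l (a b : int) : Zequivariant F -> Eint N F k l ->
  Eint N F (kshift N k a b) (kshift N l a b).
Proof.
move=> eF [z kz lz]; exists (padd z (zvec R a b)); first by rewrite cello_shift.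
by rewrite eF cello_shift.
Qed.

Lemma Ecl_bound F (B : R) M : (forall z, near2 B (F z) z) -> N%:R * B + 2 <= M%:R ->
  forall k l, Ecl N F k l -> `|l.1 - k.1| <= M%:Z /\ `|l.2 - k.2| <= M%:Z.
Proof.
move=> hB BM k l [z [h1 h2 h3 h4] [g1 g2 g3 g4]].
have n0 : 0 < N%:R :> R by rewrite ltr0n.
have [b1 b2] := hB z.
have sc (x y : R) (c d : int) : `|y - x| <= B -> c%:~R <= N%:R * x -> N%:R * x <= c%:~R + 1 ->
    d%:~R <= N%:R * y -> N%:R * y <= d%:~R + 1 -> `|d - c| <= M%:Z.
  move=> xy x1 x2 y1 y2.
  have : `|N%:R * y - N%:R * x| <= N%:R * B by rewrite -mulrBr normrM (gtr0_norm n0) ler_pM2l.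
  rewrite ler_norml => /andP[m1 m2].
  rewrite -(ler_int R) intr_norm intrB -[M%:~R]/(M%:R) ler_norml.
  by apply/andP; clear - m1 m2 x1 x2 y1 y2 BM; split; lra.
by split; [exact: (sc _ _ _ _ b1) | exact: (sc _ _ _ _ b2)].
Qed.

(** Modulo integer translations the number of interior contacts is bounded on the ball of radius
    [e0], so a maximiser [F1] exists. Its contacts persist nearby, so by maximality every map close
    to it has exactly the same ones. *)
Lemma max_graph area F (e0 : R) : inH area F -> 0 < e0 ->
  exists F1 (M : nat) (d : R), [/\ inH area F1, forall z, near2 e0 (F1 z) (F z), 0 < d,
    forall F', inH area F' -> (forall z, near2 d (F' z) (F1 z)) ->
      forall k l, Ecl N F' k l -> Eint N F1 k l &
    forall k l, Eint N F1 k l -> `|l.1 - k.1| <= M%:Z /\ `|l.2 - k.2| <= M%:Z].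
Proof.
move=> hF e00.
have [B B0 hB] := Zequiv_bdd (inH_cont hF) (inH_equiv hF).
have [M hM] := nat_large (N%:R * (B + e0) + 2).
have {}hM := hM M (leqnn M).
(* The strict bound leaves room around the maximiser, so that nearby maps still compete. *)
pose Bl F' := inH area F' /\ exists2 e : R, e < e0 & forall z, near2 e (F' z) (F z).
have Bl_bound F' : Bl F' -> forall k l, Ecl N F' k l -> `|l.1 - k.1| <= M%:Z /\ `|l.2 - k.2| <= M%:Z.
  move=> [_ [e ee0 he]]; apply: (@Ecl_bound F' (B + e0)) => // z.
  by rewrite addrC; apply: near2_le (near2_trans (he z) (hB z)); lra.
have EintEcl F' k l : Eint N F' k l -> Ecl N F' k l.
  by move=> [z /cello_cellc kz /cello_cellc lz]; exists z.
(* Representatives of edges modulo translations: a source cell in the fundamental square and a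
   displacement shifted by [M] to be nonnegative. *)
pose T : finType := ('I_N * 'I_N * 'I_(2 * M).+1 * 'I_(2 * M).+1)%type.
pose tk (t : T) : int * int := (t.1.1.1%:Z, t.1.1.2%:Z).
pose tl (t : T) : int * int := (t.1.1.1%:Z + t.1.2%:Z - M%:Z, t.1.1.2%:Z + t.2%:Z - M%:Z).
pose I F' := [set t : T | `[< Eint N F' (tk t) (tl t) >]]%SET.
have repr k l : `|l.1 - k.1| <= M%:Z -> `|l.2 - k.2| <= M%:Z ->
    exists t a b, k = kshift N (tk t) a b /\ l = kshift N (tl t) a b.
  move=> h1 h2; have Nn : N%:Z != 0 by rewrite eqz_nat -lt0n.
  have Np : 0 < N%:Z by rewrite ltz_nat.
  have md (x : int) : (absz (x %% N)%Z < N)%N.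
    by have := modz_ge0 x Nn; have := ltz_pmod x Np; lia.
  have c1 : (absz (l.1 - k.1 + M%:Z)%R < (2 * M).+1)%N by lia.
  have c2 : (absz (l.2 - k.2 + M%:Z)%R < (2 * M).+1)%N by lia.
  exists (Ordinal (md k.1), Ordinal (md k.2), Ordinal c1, Ordinal c2), (k.1 %/ N)%Z, (k.2 %/ N)%Z.
  rewrite /kshift /tk /tl /=.
  have := divz_eq k.1 N; have := divz_eq k.2 N; have := modz_ge0 k.1 Nn; have := modz_ge0 k.2 Nn.
  rewrite [_ * N%:Z]mulrC [X in _ -> _ -> _ -> k.1 = X + _ -> _]mulrC => m1 m2 d1 d2.
  by split; [rewrite [k]surjective_pairing|rewrite [l]surjective_pairing]; congr pair => /=; lia.
have BlF : Bl F by split => //; exists 0 => // z; exact: near2_refl.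
have [F1 BlF1 max1] : exists2 F1, Bl F1 & forall F', Bl F' -> (#|I F'| <= #|I F1|)%N.
  pose P (m : nat) := `[< exists2 F', Bl F' & #|I F'| = m >].
  have exP : exists m, P m by exists #|I F|; apply/asboolP; exists F.
  have ubP m : P m -> (m <= #|T|)%N by move=> /asboolP[F' _ <-]; exact: max_card.
  case: (ex_maxnP exP ubP) => m /asboolP[F1 BF1 <-] hm.
  by exists F1 => // F' BF'; apply: hm; apply/asboolP; exists F'.
have [hF1 [e1 e1e0 he1]] := BlF1.
have [dm dm0 hdm] : exists2 d : R, 0 < d & forall t, t \in I F1 -> forall F',
    (forall z, near2 d (F' z) (F1 z)) -> Eint N F' (tk t) (tl t).
  have : forall t, exists d : R, 0 < d /\ (t \in I F1 -> forall F',
      (forall z, near2 d (F' z) (F1 z)) -> Eint N F' (tk t) (tl t)).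
    move=> t; have [tI|tI] := boolP (t \in I F1); last by exists 1.
    move: (tI); rewrite inE => /asboolP[z kz lz].
    have [d d0 hd] := cello_open lz; exists d; split => // _ F' hF'.
    by exists z => //; apply: hd; apply: near2_sym.
  move=> /choice[d hd].
  have [c c0 hc] := @seq_lower R _ (enum T) d (fun t _ => (hd t).1).
  exists c => // t tI F' hF'; apply: (hd t).2 => // z.
  by apply: near2_le (hF' z); apply: hc; rewrite mem_enum.
pose d1 := Num.min dm ((e0 - e1) / 2).
have d10 : 0 < d1 by rewrite lt_min dm0 /=; clear - e1e0; lra.
have d1m : d1 <= dm by rewrite ge_min lexx.
have d1e : d1 <= (e0 - e1) / 2 by rewrite ge_min lexx orbT.
have near_max F' : inH area F' -> (forall z, near2 d1 (F' z) (F1 z)) -> Bl F' /\ I F' = I F1.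
  move=> iF' nF'.
  have BF' : Bl F'.
    split => //; exists (d1 + e1); first by clear - d1e e1e0; lra.
    by move=> z; exact: near2_trans (nF' z) (he1 z).
  split => //; apply/esym/eqP; rewrite eqEcard max1// andbT.
  apply/fintype.subsetP => t tI; rewrite inE; apply/asboolP; apply: hdm => // z.
  exact: near2_le (nF' z).
exists F1, M, (d1 / 2); split => //.
- by move=> z; apply: near2_le (he1 z); exact: ltW.
- by clear - d10; lra.
- move=> F' iF' nF' k l [z kz lz].
  have d2 : 0 < d1 / 2 by clear - d10; lra.
  have [w lw nw] := cellc_approx d2 lz.
  (* The translation carries [F' z] to the interior point [w] and is short, so [F2] has only the
     contacts of [F1]. The point [z] is moved into the interior of its own cell afterwards, by
     continuity. *)
  pose F2 := (fun v : pt R => (v.1 + (w.1 - (F' z).1), v.2 + (w.2 - (F' z).2))) \o F'.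
  have iF2 : inH area F2 by apply: shmap_inH => //; exact: shmap_translate.
  have nF2 v : near2 d1 (F2 v) (F1 v).
    have -> : d1 = d1 / 2 + d1 / 2 by clear; lra.
    apply: near2_trans (nF' v); move/near2P : nw => [a1 a2 a3 a4].
    by apply/near2P; rewrite /F2 /=; clear - a1 a2 a3 a4; split; lra.
  have F2z : F2 z = w.
    have e (x y : R) : x + (y - x) = y by ring.
    by rewrite /F2 /= !e -surjective_pairing.
  have [BF2 IF2] := near_max F2 iF2 nF2.
  have E2 : Eint N F2 k l.
    rewrite -F2z in lw; have [d d0 hd] := cello_open lw.
    have [d' d'0 hd'] := inH_cont iF2 z d0.
    have [z' kz' nz'] := cellc_approx d'0 kz.
    by exists z' => //; apply: hd; apply: hd'.
  have [h1 h2] := Bl_bound F2 BF2 k l (EintEcl _ _ _ E2).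
  have [t [a [b [kE lE]]]] := repr k l h1 h2.
  have : t \in I F2.
    rewrite inE; apply/asboolP; move: E2; rewrite kE lE => /(Eint_shift (- a) (- b) (inH_equiv iF2)).
    by rewrite !kshiftK.
  rewrite IF2 inE => /asboolP E1; rewrite kE lE.
  exact: (Eint_shift a b (inH_equiv hF1) E1).
- by move=> k l /EintEcl; exact: Bl_bound.
Qed.

End MaxGraph.

(** * Closing the walks and making the orbits robust *)

Section RealizeLoops.
Variable R : realType.
Variable N : nat.
Hypothesis N4 : (4 <= N)%N.
Implicit Types (z w : pt R) (F G : pt R -> pt R) (k l : int * int).
Variables (n0 : nat) (mm : 'I_n0 -> nat) (aa bb : 'I_n0 -> int).
Hypothesis mm0 : forall i, (0 < mm i)%N.

(** Each edge of each walk receives its own point, with image in the next cell; [h] then carries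
    every image to the next point inside that cell. Private points in general position let walks
    share cells. *)
Lemma realize_loops F Finv : cont2 F -> cont2 Finv -> cancel F Finv -> cancel Finv F ->
  (forall i, exists c, walk (Eint N F) (mm i) c (kshift N c (aa i) (bb i))) ->
  exists h (X : 'I_n0 -> nat -> pt R), [/\ shmap h, cellpres N h,
    forall i j, (j < mm i)%N -> h (F (X i j)) = X i j.+1,
    forall i, X i (mm i) = padd (X i 0%N) (zvec R (aa i) (bb i)) &
    forall i j i' j', (j < mm i)%N -> (j' < mm i')%N -> (i, j) <> (i', j') ->
      gp (X i j) (X i' j')].
Proof.
move=> cF cFi FK FiK loops.
have N0 : (0 < N)%N by apply: leq_trans N4.
have /choice[f hf] : forall i, exists f : nat -> int * int,
    f (mm i) = kshift N (f 0%N) (aa i) (bb i) /\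
    forall j, (j < mm i)%N -> Eint N F (f j) (f j.+1).
  move=> i; have [c /walk_fun[f [f0 fm fw]]] := loops i.
  exists f; split; first by rewrite fm f0.
  by move=> j jm; have := fw j j.+1 (leqnSn j) jm; rewrite subSnn => -[c' ? <-].
pose idx : seq ('I_n0 * nat) := [seq (i, j) | i <- enum 'I_n0, j <- iota 0 (mm i)].
have idxE i j : ((i, j) \in idx) = (j < mm i)%N.
  apply/allpairsPdep/idP => [[i' [j' [_ + [-> ->]]]]|jm]; first by rewrite mem_iota.
  by exists i, j; rewrite mem_enum mem_iota.
have uidx : uniq idx.
  apply: allpairs_uniq_dep => [|i _|[i j] [i' j'] _ _ /= [-> ->]//]; first exact: enum_uniq.
  exact: iota_uniq.
pose O (p : 'I_n0 * nat) z := cello N (f p.1 p.2) z /\ cello N (f p.1 p.2.+1) (F z).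
have [|x [x1 x2]] := @choose_gp R _ idx O F Finv [::] [::] cFi FK FiK uidx.
  move=> [i j]; rewrite idxE => jm; have [z kz lz] := (hf i).2 j jm.
  have [d1 d10 h1] := cello_open N0 kz; have [e e0 he] := cello_open N0 lz.
  have [d2 d20 h2] := cF z e e0.
  exists z, (Num.min d1 d2); split; first by rewrite lt_min d10.
  move=> w zw; split; first by apply: h1; apply: near2_le zw; rewrite ge_min lexx.
  by apply: he; apply: h2; apply: near2_le zw; rewrite ge_min lexx orbT.
(* The last target of a walk is an integer translate of its first point. Up to translations the
   targets are the points themselves, reindexed injectively by [nx], so general position is
   inherited. *)
pose nx (p : 'I_n0 * nat) := if (p.2.+1 < mm p.1)%N then (p.1, p.2.+1) else (p.1, 0%N).
pose t (p : 'I_n0 * nat) : pt R := if (p.2.+1 < mm p.1)%N then x (p.1, p.2.+1)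
  else padd (x (p.1, 0%N)) (zvec R (aa p.1) (bb p.1)).
have tnx p : exists a b : int, t p = padd (x (nx p)) (zvec R a b).
  rewrite /t /nx; case: ifP => _; last by exists (aa p.1), (bb p.1).
  by exists 0, 0; rewrite /padd /= !addr0 -surjective_pairing.
have nxidx p : p \in idx -> nx p \in idx.
  case: p => i j; rewrite idxE /nx /= => jm; case: ifP => h; rewrite idxE//.
have nxinj p q : p \in idx -> q \in idx -> nx p = nx q -> p = q.
  case: p q => i j [i' j']; rewrite !idxE /nx /= => jm jm'.
  case: ifP => h; case: ifP => h' [] e //; subst i'; last first.
  - by congr pair; move: h h' jm jm'; clear; lia.
  - by move=> e2; congr pair; move: e2; clear; lia.
have [||h [sh ch hh]] := @transport_gp R N _ idx (F \o x) t N4 uidx.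
- move=> [i j] pidx; have [[_ /= h1] _ _] := x1 _ pidx.
  exists (f i j.+1) => //; rewrite /t /=.
  move: (pidx); rewrite idxE => jm; case: ifP => h.
    have hm : (i, j.+1) \in idx by rewrite idxE.
    by have [[]] := x1 _ hm.
  have -> : j.+1 = mm i by move: h jm; clear; lia.
  rewrite (hf i).1; apply/cello_shift.
  have hm : (i, 0%N) \in idx by rewrite idxE.
  by have [[]] := x1 _ hm.
- move=> p q pi qi pq; split; first exact: (x2 p q pi qi pq).2.
  have [a [b ->]] := tnx p; have [a' [b' ->]] := tnx q; apply/gp_shift.
  apply: (x2 _ _ (nxidx p pi) (nxidx q qi) _).1.
  by move=> /(nxinj p q pi qi).
exists h, (fun i j => if (j < mm i)%N then x (i, j) else padd (x (i, 0%N)) (zvec R (aa i) (bb i))).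
split => //.
- by move=> i j jm; rewrite jm; have := hh (i, j); rewrite idxE /= => ->.
- by move=> i; rewrite ltnn mm0.
- move=> i j i' j' jm jm' ne; rewrite jm jm'; apply: (x2 _ _ _ _ ne).1; rewrite idxE//.
Qed.

(** Loops are treated one at a time. Each perturbation fixes the orbits of the other loops and moves
    points by at most half the tolerance won so far. *)
Lemma robust_all area G (X : 'I_n0 -> nat -> pt R) (del : R) : inH area G -> 0 < del ->
  (forall i j, (j < mm i)%N -> G (X i j) = X i j.+1) ->
  (forall i, X i (mm i) = padd (X i 0%N) (zvec R (aa i) (bb i))) ->
  (forall i j i' j', (j < mm i)%N -> (j' < mm i')%N -> (i, j) <> (i', j') ->
      gp (X i j) (X i' j')) ->
  exists G2 (d : R), [/\ inH area G2, forall z, near2 del (G2 z) (G z), 0 < d &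
    forall G', cont2 G' -> (forall z, near2 d (G' z) (G2 z)) ->
      forall i, exists z, iter (mm i) G' z = padd z (zvec R (aa i) (bb i))].
Proof.
move=> hG del0 hX Xm Xgp.
(* Strengthened for induction on the list of treated loops: the total motion stays strictly below
   [del], and untreated loops keep their exact orbits. *)
suff [G2 [e [d [iG2 [ed nG2] d0 rob _]]]] : exists G2 (e d : R), [/\ inH area G2,
    e < del /\ forall z, near2 e (G2 z) (G z), 0 < d,
    forall G', cont2 G' -> (forall z, near2 d (G' z) (G2 z)) ->
      forall i, i \in enum 'I_n0 -> exists z, iter (mm i) G' z = padd z (zvec R (aa i) (bb i)) &
    forall i, i \notin enum 'I_n0 -> forall j, (j < mm i)%N -> G2 (X i j) = X i j.+1].
  exists G2, d; split => //; first by move=> z; apply: near2_le (nG2 z); exact: ltW.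
  by move=> G' cG' nG' i; apply: rob => //; rewrite mem_enum.
elim: (enum 'I_n0) => [|i r [G2 [e [d [iG2 [ed nG2] d0 rob ex]]]]].
  exists G, 0, 1; split => //; last by move=> i _ j; exact: hX.
  by split => // z; exact: near2_refl.
have [ir|ir] := boolP (i \in r).
  exists G2, e, d; split => //.
    by move=> G' cG' nG' i'; rewrite inE => /orP[/eqP ->|]; exact: rob.
  by move=> i'; rewrite inE negb_or => /andP[_]; exact: ex.
pose Z := [seq X i' j | i' <- [seq i' <- enum 'I_n0 | i' != i], j <- iota 0 (mm i')].
have ZE i' j : i' != i -> (j < mm i')%N -> X i' j \in Z.
  move=> ii jm; apply/allpairsPdep; exists i', j.
  by rewrite mem_filter ii mem_enum mem_iota.
pose dl := Num.min ((del - e) / 2) (d / 2).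
have dl0 : 0 < dl by rewrite lt_min; apply/andP; split; lra.
have dl1 : dl <= (del - e) / 2 by rewrite ge_min lexx.
have dl2 : dl <= d / 2 by rewrite ge_min lexx orbT.
have [||k [sk nk kZ [d' d'0 hd']]] := @robust_periodic R G2 (mm i) (X i) (aa i) (bb i) Z dl
  (inH_cont iG2) (@inH_inj _ _ _ iG2) (inH_equiv iG2) (mm0 i) (ex i ir) (Xm i) _ _ dl0.
- by move=> j /andP[j0 jm]; apply: Xgp => // -[j0']; rewrite j0' in j0.
- move=> z /allpairsPdep[i' [j [+ + ->]]]; rewrite mem_filter mem_iota /= => /andP[ii _] jm.
  by apply: Xgp => // -[ii']; rewrite ii' eqxx in ii.
exists (k \o G2), (e + dl), (Num.min d' (d / 2)); split.
- exact: shmap_inH.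
- split; first by lra.
  by move=> z; rewrite addrC; exact: near2_trans (near2_sym (nk _)) (nG2 z).
- by rewrite lt_min d'0 /=; lra.
- move=> G' cG' nG' i'; rewrite inE => /orP[/eqP ->|i'r].
    by apply: hd' => // z; apply: near2_le (nG' z); rewrite ge_min lexx.
  apply: rob => // z; have -> : d = d / 2 + d / 2 by lra.
  apply: (near2_trans (near2_le _ (nG' z))); first by rewrite ge_min lexx orbT.
  exact: near2_le dl2 (near2_sym (nk _)).
- move=> i'; rewrite inE negb_or => /andP[ii i'r] j jm /=; rewrite ex//.
  have [jm'|jm'] := ltnP j.+1 (mm i'); first by apply: kZ; exact: ZE.
  have -> : j.+1 = mm i' by move: jm jm'; clear; lia.
  rewrite Xm (shmap_equiv sk) kZ//; exact: ZE.
Qed.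

End RealizeLoops.

(** * Area preservation and nonempty interior *)

Section Recurrence.
Variable R : realType.
Implicit Types (z w : pt R) (F : pt R -> pt R).

Definition cbox z (r : R) : set (pt R) := [set w | near2 r z w].

Lemma cboxE z (r : R) : cbox z r = `[z.1 - r, z.1 + r]%classic `*` `[z.2 - r, z.2 + r]%classic.
Proof.
apply/seteqP; split => w /=.
  by move=> /near2P[? ? ? ?]; split; rewrite /= in_itv /=; apply/andP; split; lra.
by move=> [/=]; rewrite !in_itv /= => /andP[? ?] /andP[? ?]; apply/near2P; split; lra.
Qed.

Lemma measurable_cbox z (r : R) : measurable (cbox z r).
Proof. by rewrite cboxE; apply: measurableX; exact: measurable_itv. Qed.

Lemma leb2_cbox z (r : R) : 0 <= r -> leb2 (cbox z r) = ((2 * r) ^+ 2)%:E.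
Proof.
move=> r0; rewrite cboxE /leb2 product_measure1E; [|exact: measurable_itv..].
have e (x : R) : lebesgue_measure (`[x - r, x + r]%classic : set R) = (2 * r)%:E.
  rewrite lebesgue_measure_itv /= lte_fin; case: ifP => [_|].
    by rewrite -EFinB; congr EFin; ring.
  by move=> /negbT; rewrite -leNgt => h; congr EFin; lra.
rewrite expr2 EFinM; congr (_ * _)%E; exact: e.
Qed.

Lemma open_measurable2 (A : set (pt R)) :
  (forall z, A z -> exists2 d : R, 0 < d & cbox z d `<=` A) -> measurable A.
Proof.
move=> oA.
pose B (a b c : rat) := if `[< cbox (ratr a, ratr b) (ratr c) `<=` A >]
  then cbox (ratr a, ratr b) (ratr c) else set0.
rewrite (_ : A = \bigcup_a \bigcup_b \bigcup_c B a b c).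
  do 3 (apply: bigcupT_measurable_rat => ?).
  by rewrite /B; case: ifP => _; [exact: measurable_cbox | exact: measurable0].
apply/seteqP; split => [z /oA[d d0 dA]|z [a _ [b _ [c _]]]]; last first.
  by rewrite /B; case: asboolP => // h; exact: h.
have [c /= ] := @rat_in_itvoo R (d / 4) (d / 2) ltac:(lra).
rewrite in_itv /= => /andP[c1 c2].
have [a /= ] := @rat_in_itvoo R (z.1 - d / 4) (z.1 + d / 4) ltac:(lra).
rewrite in_itv /= => /andP[a1 a2].
have [b /= ] := @rat_in_itvoo R (z.2 - d / 4) (z.2 + d / 4) ltac:(lra).
rewrite in_itv /= => /andP[b1 b2].
exists a => //; exists b => //; exists c => //; rewrite /B; case: asboolP => [_|].
  by apply/near2P; split => /=; lra.
case=> w /near2P /= [? ? ? ?]; apply: dA; apply/near2P; split; lra.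
Qed.

Lemma preimage_open_measurable F (A : set (pt R)) : cont2 F ->
  (forall z, A z -> exists2 d : R, 0 < d & cbox z d `<=` A) -> measurable (F @^-1` A).
Proof.
move=> cF oA; apply: open_measurable2 => z /oA[d d0 dA].
by have [e e0 he] := cF z d d0; exists e => // w /he /dA.
Qed.

Definition obox z (r : R) : set (pt R) := [set w | `|z.1 - w.1| < r /\ `|z.2 - w.2| < r].

Lemma obox_open z (r : R) w : obox z r w -> exists2 d : R, 0 < d & cbox w d `<=` obox z r.
Proof.
move=> [h1 h2]; exists (Num.min (r - `|z.1 - w.1|) (r - `|z.2 - w.2|) / 2).
  by rewrite divr_gt0// lt_min !subr_gt0 h1.
set m := Num.min _ _; have m1 : m <= r - `|z.1 - w.1| by rewrite ge_min lexx.
have m2 : m <= r - `|z.2 - w.2| by rewrite ge_min lexx orbT.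
have m0 : 0 < m by rewrite lt_min !subr_gt0 h1.
move=> u [u1 u2]; split.
  have := ler_normD (z.1 - w.1) (w.1 - u.1); rewrite addrA subrK; lra.
have := ler_normD (z.2 - w.2) (w.2 - u.2); rewrite addrA subrK; lra.
Qed.

Lemma iter_area F n z (r : R) : cont2 F -> area_preserving F ->
  measurable (iter n F @^-1` obox z r) /\ leb2 (iter n F @^-1` obox z r) = leb2 (obox z r).
Proof.
move=> cF aF.
have m k : measurable (iter k F @^-1` obox z r).
  by apply: preimage_open_measurable; [exact: cont2_iter | move=> w; exact: obox_open].
split; first exact: m.
elim: n => [|n IH]; first by [].
rewrite -IH -(aF _ (m n)); congr leb2.
by apply/seteqP; split => w /=; rewrite -iterSr.
Qed.

Lemma leb2_translate (a b : R) (A : set (pt R)) : measurable A ->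
  measurable ((fun z : pt R => (z.1 + a, z.2 + b)) @^-1` A) /\
  leb2 ((fun z : pt R => (z.1 + a, z.2 + b)) @^-1` A) = leb2 A.
Proof.
move=> mA; have c (x : R) : continuous (fun _ : R => x) by move=> y; exact: cvg_cst.
have [mV <-] := leb2_Vsh (c b) mA; have [mH <-] := leb2_Hsh (c a) mV.
by split.
Qed.

Lemma leb2_fin_additive (I : finType) (A : I -> set (pt R)) :
  (forall i, measurable (A i)) -> trivIset setT A ->
  leb2 (\bigcup_i A i) = (\sum_(i : I) leb2 (A i))%E.
Proof.
move=> mA tA; rewrite /leb2.
rewrite (measure_fin_bigcup (@lebesgue_measure R \x @lebesgue_measure R)%E finite_finset tA
  (fun i _ => mA i)).
rewrite (@fsbigE _ _ _ _ _ (enum I)) ?enum_uniq//.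
  rewrite big_enum_cond /=; apply: eq_bigl => i.
  by rewrite mem_set.
by move=> i _; rewrite mem_enum.
Qed.

Lemma le_leb2 (A B : set (pt R)) : measurable A -> measurable B -> A `<=` B -> (leb2 A <= leb2 B)%E.
Proof. by move=> mA mB AB; apply: le_measure => //; rewrite inE. Qed.

End Recurrence.

Section Recurrence2.
Variable R : realType.
Implicit Types (z w p q : pt R) (F : pt R -> pt R).

Definition fdom : set (pt R) := `[0 : R, 1[%classic `*` `[0 : R, 1[%classic.

Lemma measurable_fdom : measurable fdom.
Proof. by apply: measurableX; exact: measurable_itv. Qed.

Lemma fdomP p : fdom p <-> unit0 p.
Proof.
rewrite /fdom /=; split => [[/=]|[? ? ? ?]].
  by rewrite !in_itv /= => /andP[? ?] /andP[? ?].
by split; rewrite /= in_itv /=; apply/andP.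
Qed.

Lemma leb2_fdom : leb2 fdom = 1%:E.
Proof.
rewrite /leb2 product_measure1E; [|exact: measurable_itv..].
have e : lebesgue_measure (`[0, 1[%classic : set R) = 1%:E.
  by rewrite lebesgue_measure_itv /= lte_fin ltr01 oppr0 adde0.
by rewrite -[RHS]mule1; congr (_ * _)%E; exact: e.
Qed.

Lemma unit0_eq (p : pt R) (a b a' b' : int) q q' : unit0 q -> unit0 q' ->
  p = padd q (zvec R a b) -> p = padd q' (zvec R a' b') -> a = a' /\ b = b'.
Proof.
move=> [? ? ? ?] [? ? ? ?] -> /[dup] /(congr1 fst) /= e1 /(congr1 snd) /= e2.
by split; apply: (@int_eq_lt1 R); lra.
Qed.

Lemma iter_bound F (B : R) n z : (forall w, near2 B (F w) w) ->
  near2 (n%:R * B) (iter n F z) z.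
Proof.
move=> hB; elim: n => [|n IH]; first by rewrite mul0r; exact: near2_refl.
rewrite -natr1 mulrDl mul1r addrC.
exact: near2_trans (hB _) IH.
Qed.

Lemma floor_cover (m : nat) (x : R) : - m%:R <= x -> x < m%:R -> exists u : 'I_(2 * m),
  0 <= x - (u%:Z - m%:Z)%:~R /\ x - (u%:Z - m%:Z)%:~R < 1.
Proof.
move=> x1 x2; have f1 : - m%:Z <= Num.floor x by rewrite floor_ge_int intrN.
have f2 : Num.floor x < m%:Z by rewrite floor_lt_int.
have hu : (absz (Num.floor x + m%:Z)%R < 2 * m)%N by clear - f1 f2; lia.
exists (Ordinal hu) => /=.
have -> : (absz (Num.floor x + m%:Z)%R)%:Z - m%:Z = Num.floor x by clear - f1; lia.
have := floor_itv x; rewrite intrD => /andP[? ?]; split; lra.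
Qed.

(** Poincare recurrence on the torus without a quotient measure: preimages of a box are folded into
    the unit square. Without a return they would be disjoint there, with total area at least 2. *)
Lemma recurrence F z (d : R) : cont2 F -> Zequivariant F -> area_preserving F -> 0 < d ->
  exists q n (a b : int), [/\ near2 d z q, (0 < n)%N & near2 d z (padd (iter n F q) (zvec R a b))].
Proof.
move=> cF eF aF d0; apply: contrapT => nrec.
(* With radius at most 1/4 the box is disjoint from its integer translates, so the folded pieces of
   one preimage do not overlap. *)
pose r := Num.min d (1 / 4).
have r0 : 0 < r by rewrite lt_min d0; lra.
have rd : r <= d by rewrite ge_min lexx.
have r4 : r <= 1 / 4 by rewrite ge_min lexx orbT.
clearbody r.
pose X (i : nat) : set (pt R) := iter i F @^-1` obox z r.
have mX i : measurable (X i) by exact: (iter_area i z r cF aF).1.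
have aX i : leb2 (X i) = leb2 (obox z r) by exact: (iter_area i z r cF aF).2.
have aB : ((r ^+ 2)%:E <= leb2 (obox z r))%E.
  have -> : (r ^+ 2)%:E = leb2 (cbox z (r / 2)).
    by rewrite leb2_cbox; [congr (_ ^+ 2)%:E; lra | lra].
  apply: le_leb2; [exact: measurable_cbox | exact: (mX 0%N) |].
  by move=> w [h1 h2]; split; lra.
have [T hT] := nat_large (2 / r ^+ 2).
have {}hT := hT T (leqnn T).
have Tr : 2 <= T%:R * r ^+ 2 by rewrite -ler_pdivrMr// exprn_gt0.
have [B B0 hB] := Zequiv_bdd cF eF.
(* The preimages up to time [T] lie in a square of half-side [m], so finitely many translates
   suffice for the folding. *)
have [m hm] := nat_large (T%:R * B + `|z.1| + `|z.2| + 2).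
have {}hm := hm m (leqnn m).
have Xbox i w : (i <= T)%N -> X i w -> [/\ - m%:R <= w.1, w.1 < m%:R, - m%:R <= w.2 & w.2 < m%:R].
  move=> iT [h1 h2]; have /near2P[g1 g2 g3 g4] := iter_bound i w hB.
  have : i%:R * B <= T%:R * B by rewrite ler_wpM2r// ler_nat.
  have := ler_norm z.1; have := ler_norm z.2; have := ler_norm (- z.1); have := ler_norm (- z.2).
  have := normr_ge0 z.1; have := normr_ge0 z.2.
  move: h1 h2; rewrite !normrN !ltr_norml => /andP[? ?] /andP[? ?] *.
  by split; lra.
pose J : finType := ('I_(2 * m) * 'I_(2 * m))%type.
pose ja (j : J) : int := j.1%:Z - m%:Z; pose jb (j : J) : int := j.2%:Z - m%:Z.
pose tr (j : J) (p : pt R) : pt R := (p.1 + (ja j)%:~R, p.2 + (jb j)%:~R).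
pose Y (t : 'I_T * J) : set (pt R) := (tr t.2 @^-1` X t.1) `&` fdom.
have mtr j A : measurable A -> measurable (tr j @^-1` A) /\ leb2 (tr j @^-1` A) = leb2 A.
  by move=> mA; exact: leb2_translate.
have mY t : measurable (Y t).
  by apply: measurableI; [exact: (mtr _ _ (mX _)).1 | exact: measurable_fdom].
have jinj (j j' : J) : ja j = ja j' -> jb j = jb j' -> j = j'.
  case: j j' => [j1 j2] [j1' j2']; rewrite /ja /jb /= => e1 e2.
  by congr pair; apply: val_inj => /=; [move: e1 | move: e2]; clear; lia.
have noret i i' p (a b a' b' : int) : (i < i')%N -> X i (padd p (zvec R a b)) ->
    X i' (padd p (zvec R a' b')) -> False.
  move=> ii' [h1 h2] [h3 h4]; apply: nrec.
  pose q := iter i F (padd p (zvec R a b)).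
  exists q, (i' - i)%N, (a' - a), (b' - b); split; first by split; rewrite -/q; apply: (le_trans _ rd); exact: ltW.
    by rewrite subn_gt0.
  have -> : padd (iter (i' - i) F q) (zvec R (a' - a) (b' - b)) = iter i' F (padd p (zvec R a' b')).
    rewrite /q -iterD subnK ?(ltnW ii')// !(Zequiv_iter i' eF) /padd /= !intrB.
    by congr pair; ring.
  by split; apply: (le_trans _ rd); exact: ltW.
have tY : trivIset setT Y.
  move=> [i j] [i' j'] _ _ [p [[/= hp fp] [/= hp' _]]].
  have [ii'|ii'|ii'] := ltngtP (i : nat) (i' : nat).
  - by case: (noret i i' p (ja j) (jb j) (ja j') (jb j')).
  - by case: (noret i' i p (ja j') (jb j') (ja j) (jb j)).
  - have -> : i = i' by exact: val_inj.
    congr pair; move: hp hp'; rewrite -ii' => -[h1 h2] [h3 h4].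
    have e (k : J) : iter i F (tr k p) = padd (iter i F p) (zvec R (ja k) (jb k)).
      by rewrite -(Zequiv_iter i eF).
    rewrite !e /= in h1 h2 h3 h4.
    move: h1 h2 h3 h4; rewrite !ltr_norml => /andP[? ?] /andP[? ?] /andP[? ?] /andP[? ?].
    by apply: jinj; apply: (@int_eq_lt1 R); lra.
have sumX (i : 'I_T) : leb2 (X i) = (\sum_(j : J) leb2 (Y (i, j)))%E.
  have -> : X i = \bigcup_j (X i `&` [set w | unit0 (w.1 - (ja j)%:~R, w.2 - (jb j)%:~R)]).
    apply/seteqP; split => [w Xw|w [j _ []//]].
    have [w1 w2 w3 w4] := Xbox i w (ltnW (ltn_ord i)) Xw.
    have [u [u1 u2]] := floor_cover w1 w2; have [v [v1 v2]] := floor_cover w3 w4.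
    by exists (u, v) => //; split => //; split.
  rewrite leb2_fin_additive.
  - apply: eq_bigr => j _; have mI : measurable (X i `&` [set w | unit0 (w.1 - (ja j)%:~R, w.2 - (jb j)%:~R)]).
      apply: measurableI => //.
      rewrite [X in measurable X](_ : _ = (fun z : pt R => (z.1 + - (ja j)%:~R, z.2 + - (jb j)%:~R)) @^-1` fdom).
        exact: (leb2_translate _ _ measurable_fdom).1.
      by apply/seteqP; split => w /=; rewrite fdomP.
    rewrite -(mtr j _ mI).2; congr leb2; apply/seteqP; split => w /=; rewrite /Y /tr /= !addrK fdomP => -[h1 h2];
      by split => //; rewrite -?surjective_pairing // in h2 *.
  - move=> j; apply: measurableI => //.
    rewrite [X in measurable X](_ : _ = (fun z : pt R => (z.1 + - (ja j)%:~R, z.2 + - (jb j)%:~R)) @^-1` fdom).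
      exact: (leb2_translate _ _ measurable_fdom).1.
    by apply/seteqP; split => w /=; rewrite fdomP.
  - move=> j j' _ _ [w [[_ /= u1] [_ /= u2]]].
    have [||e1 e2] := @unit0_eq w (ja j) (jb j) (ja j') (jb j') _ _ u1 u2.
    + by rewrite /padd /= !subrK -surjective_pairing.
    + by rewrite /padd /= !subrK -surjective_pairing.
    exact: jinj.
have le1 : ((\sum_(t : 'I_T * J) leb2 (Y t)) <= 1%:E)%E.
  rewrite -leb2_fin_additive// -leb2_fdom; apply: le_leb2; last by move=> p [t _ []].
  - by apply: fin_bigcup_measurable => //; exact: finite_finset.
  - exact: measurable_fdom.
move: le1; rewrite -(pair_bigA _ (fun i j => leb2 (Y (i, j)))) /=.
under eq_bigr do rewrite -sumX aX.
move=> le1; have : ((T%:R * r ^+ 2)%:E <= 1%:E :> \bar R)%E.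
  apply: le_trans le1.
  have -> : (T%:R * r ^+ 2)%:E = (\sum_(i < T) (r ^+ 2)%:E)%E.
    by rewrite sumEFin sumr_const card_ord mulr_natl.
  exact: lee_sum.
by rewrite lee_fin; lra.
Qed.

End Recurrence2.

(** * Nonempty interior in the area-preserving case *)

Section Interior.
Variable R : realType.
Variable N : nat.
Hypothesis N4 : (4 <= N)%N.
Implicit Types (z w : pt R) (F G : pt R -> pt R) (k l : int * int).

Let N0 : (0 < N)%N. Proof. exact: leq_trans N4. Qed.

Lemma enorm_ge (x : pt R) : `|x.1| <= enorm x /\ `|x.2| <= enorm x.
Proof.
by rewrite /enorm -!sqrtr_sqr; split; apply: ler_wsqrtr; rewrite ?lerDl ?lerDr sqr_ge0.
Qed.

Lemma hull_interior n (p : 'I_n -> pt R) (i0 i1 i2 : 'I_n) :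
  ((p i1).1 - (p i0).1) * ((p i2).2 - (p i0).2) - ((p i1).2 - (p i0).2) * ((p i2).1 - (p i0).1) != 0 ->
  nonempty_interior (hull p).
Proof.
pose u1 := (p i1).1 - (p i0).1; pose u2 := (p i1).2 - (p i0).2.
pose v1 := (p i2).1 - (p i0).1; pose v2 := (p i2).2 - (p i0).2.
pose D := u1 * v2 - u2 * v1; rewrite -/u1 -/u2 -/v1 -/v2 -/D => D0.
pose S := `|u1| + `|u2| + `|v1| + `|v2| + 1.
have S0 : 0 < S by rewrite /S ltr_wpDl// !addr_ge0.
have Dp : 0 < `|D| by rewrite normr_gt0.
pose w : pt R := ((p i0).1 + (u1 + v1) / 3, (p i0).2 + (u2 + v2) / 3).
exists w, (`|D| / (6 * S)); split; first by rewrite divr_gt0// mulr_gt0.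
move=> x hx; have [d1 d2] := enorm_ge (psub x w).
set e := `|D| / (6 * S) in hx.
have {}d1 : `|x.1 - w.1| <= e := le_trans d1 (ltW hx).
have {}d2 : `|x.2 - w.2| <= e := le_trans d2 (ltW hx).
(* Barycentric coordinates about the centroid [w], by Cramer's rule. The chosen radius keeps both
   within 1/6 of 1/3, so the third one is nonnegative too. *)
pose be := 1 / 3 + ((x.1 - w.1) * v2 - (x.2 - w.2) * v1) / D.
pose ga := 1 / 3 + ((x.2 - w.2) * u1 - (x.1 - w.1) * u2) / D.
have e0 : 0 <= e by rewrite divr_ge0// mulr_ge0// ltW.
have small (a b : R) : `|a| + `|b| <= S -> `|((x.1 - w.1) * a - (x.2 - w.2) * b) / D| <= 1 / 6.
  move=> ab; rewrite normrM normfV ler_pdivrMr//.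
  have -> : 1 / 6 * `|D| = e * S by rewrite /e; field; rewrite gt_eqF.
  apply: (le_trans (ler_normB _ _)); rewrite !normrM.
  apply: (le_trans (lerD (ler_wpM2r (normr_ge0 a) d1) (ler_wpM2r (normr_ge0 b) d2))).
  by rewrite -mulrDr ler_wpM2l.
have nn := (normr_ge0 u1, normr_ge0 u2, normr_ge0 v1, normr_ge0 v2).
have b1 : `|be - 1 / 3| <= 1 / 6.
  have -> : be - 1 / 3 = ((x.1 - w.1) * v2 - (x.2 - w.2) * v1) / D by rewrite /be; ring.
  apply: small; rewrite /S; move: nn => [[[h1 h2] h3] h4]; clear - h1 h2 h3 h4; lra.
have g1 : `|ga - 1 / 3| <= 1 / 6.
  have -> : ga - 1 / 3 = ((x.1 - w.1) * (- u2) - (x.2 - w.2) * (- u1)) / D.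
    by rewrite /ga; ring.
  apply: small; rewrite !normrN /S; move: nn => [[[h1 h2] h3] h4]; clear - h1 h2 h3 h4; lra.
move: b1 g1; rewrite !ler_norml => /andP[b1 b2] /andP[g1 g2].
pose la i : R := (i == i0)%:R * (1 - be - ga) + (i == i1)%:R * be + (i == i2)%:R * ga.
have sum1 (j : 'I_n) (c : R) (f : 'I_n -> R) : \sum_(i < n) (i == j)%:R * c * f i = c * f j.
  rewrite (bigD1 j)//= eqxx mul1r big1 ?addr0// => i /negbTE ->.
  by rewrite !mul0r.
have sumf (f : 'I_n -> R) : \sum_(i < n) la i * f i = (1 - be - ga) * f i0 + be * f i1 + ga * f i2.
  under eq_bigr do rewrite /la !mulrDl.
  by rewrite !big_split /= !sum1.
exists la; split.
  move=> i; rewrite /la; have m (b : bool) (c : R) : 0 <= c -> 0 <= b%:R * c by move=> c0; rewrite mulr_ge0.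
  have p0 : 0 <= 1 - be - ga by clear - b1 b2 g1 g2; lra.
  have p1 : 0 <= be by clear - b1 b2 g1 g2; lra.
  have p2 : 0 <= ga by clear - b1 b2 g1 g2; lra.
  by rewrite !addr_ge0// m.
split.
  have := sumf (fun=> 1); under eq_bigr do rewrite mulr1.
  by move=> ->; ring.
rewrite !sumf [x]surjective_pairing; congr pair.
  have -> : (1 - be - ga) * (p i0).1 + be * (p i1).1 + ga * (p i2).1 = (p i0).1 + be * u1 + ga * v1.
    by rewrite /u1 /v1; ring.
  rewrite /be /ga /w /= /D; rewrite /D in D0; clearbody u1 v2 u2 v1; field.
  exact: D0.
have -> : (1 - be - ga) * (p i0).2 + be * (p i1).2 + ga * (p i2).2 = (p i0).2 + be * u2 + ga * v2.
  by rewrite /u2 /v2; ring.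
rewrite /be /ga /w /= /D; rewrite /D in D0; clearbody u1 v2 u2 v1; field.
exact: D0.
Qed.

Variable F : pt R -> pt R.
Hypothesis cF : cont2 F.
Hypothesis eF : Zequivariant F.
Hypothesis aF : area_preserving F.
Let E := Eint N F.
Hypothesis clE : forall k l, Ecl N F k l -> E k l.

Let Eshift k l a b : E k l -> E (kshift N k a b) (kshift N l a b).
Proof. exact: Eint_shift. Qed.

(** Recurrence near [z] gives an orbit that enters [l] and returns to a translate of the open cell
    [k]. Its walk ends at a closed cell meeting that open cell, hence at that very cell. *)
Lemma edge_return k l : E k l -> exists n a b, walk E n l (kshift N k a b).
Proof.
move=> [z kz lz]; have [d1 d10 h1] := cello_open N0 kz; have [e e0 he] := cello_open N0 lz.
have [d2 d20 h2] := cF z e0.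
pose d := Num.min d1 d2; have d0 : 0 < d by rewrite lt_min d10.
have dd1 : d <= d1 by rewrite ge_min lexx.
have dd2 : d <= d2 by rewrite ge_min lexx orbT.
have [q [n [a [b [zq n0 zn]]]]] := recurrence z cF eF aF d0.
case: n n0 zn => // n _ zn.
have lq : cello N l (F q) by apply: he; apply: h2; exact: near2_le zq.
have kn : cello N k (padd (iter n.+1 F q) (zvec R a b)) by apply: h1; exact: near2_le zn.
have [l' w l'c] := orbit_walk n clE (cello_cellc lq).
exists n, (- a), (- b).
suff <- : l' = kshift N k (- a) (- b) by [].
apply/esym; apply: (@cello_cellc_eq R N _ _ (iter n F (F q))) => //.
rewrite -iterSr -(cello_shift N _ _ a b); have -> : kshift N (kshift N k (- a) (- b)) a b = k.
  by rewrite /kshift [RHS]surjective_pairing /=; congr pair; lia.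
by [].
Qed.

Variables (l1 l2 c : R).
Hypothesis line : forall m a b k, walk E m k (kshift N k a b) ->
  l1 * a%:~R + l2 * b%:~R = c * m%:R.

(** Both cells have as successor a cell [l] containing [F z]. The return from [l] to a translate of
    [k'] completes a walk from [k] and also a closed walk at [k']; the latter makes [line]
    applicable. *)
Lemma chain_step k k' z : cellc N k z -> cellc N k' z ->
  exists n a b, walk E n k (kshift N k' a b) /\ l1 * a%:~R + l2 * b%:~R = c * n%:R.
Proof.
move=> kz kz'; have [l lz] := cell_ex N (F z).
have e1 : E k l by apply: clE; exists z.
have e2 : E k' l by apply: clE; exists z.
have [n [a [b w]]] := edge_return e2.
exists n.+1, a, b; split; first by exists l.
by apply: (@line n.+1 a b k'); exists l.
Qed.

Lemma chain (f : nat -> int * int) (g : nat -> pt R) :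
  (forall i, cellc N (f i) (g i)) -> (forall i, cellc N (f i.+1) (g i)) ->
  forall i, exists n a b, walk E n (f 0%N) (kshift N (f i) a b) /\
    l1 * a%:~R + l2 * b%:~R = c * n%:R.
Proof.
move=> h1 h2; elim=> [|i [n [a [b [w e]]]]].
  by exists 0%N, 0, 0; split; [rewrite kshift0 | rewrite !mulr0 addr0].
have [n' [a' [b' [w' e']]]] := chain_step (h1 i) (h2 i).
exists (n + n')%N, (a' + a), (b' + b); split.
  apply: (walk_cat w); rewrite -kshift_add//.
  exact: (walk_shift Eshift).
by rewrite !intrD natrD !mulrDr -e -e'; ring.
Qed.

Lemma line_trivial : l1 = 0 /\ l2 = 0.
Proof.
have n0 : N%:R != 0 :> R by rewrite pnatr_eq0 -lt0n.
split.
  have [| |n [a [b [w e]]]] := @chain (fun i => (i%:Z, 0)) (fun i => (i.+1%:R / N%:R, 0)) _ _ N.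
  - by move=> i; rewrite /cellc /= mulr0 mulrC divfK// -natr1; split; rewrite -?[i%:~R]/(i%:R); lra.
  - by move=> i; rewrite /cellc /= mulr0 mulrC divfK//; split; rewrite -?[i.+1%:~R]/(i.+1%:R); lra.
  (* The cell [(N, 0)] is a translate of [(0, 0)], so the walk across is closed with displacement
     [(a + 1, b)]. Subtracting the relation for [(a, b)] leaves [l1 = 0]. *)
  have w' : walk E n (0, 0) (kshift N (0, 0) (a + 1) b).
    by move: w; congr walk; rewrite /kshift /=; congr pair; lia.
  by have := line w'; rewrite intrD mulrDr mulr1 -e; lra.
have [| |n [a [b [w e]]]] := @chain (fun i => (0, i%:Z)) (fun i => (0, i.+1%:R / N%:R)) _ _ N.
- by move=> i; rewrite /cellc /= mulr0 mulrC divfK// -natr1; split; rewrite -?[i%:~R]/(i%:R); lra.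
- by move=> i; rewrite /cellc /= mulr0 mulrC divfK//; split; rewrite -?[i.+1%:~R]/(i.+1%:R); lra.
have w' : walk E n (0, 0) (kshift N (0, 0) a (b + 1)).
  by move: w; congr walk; rewrite /kshift /=; congr pair; lia.
by have := line w'; rewrite intrD mulrDr mulr1 -e; lra.
Qed.

End Interior.

(** * Assembly of the approximation *)

Section Key.
Variable R : realType.
Implicit Types (z w : pt R) (F G : pt R -> pt R) (k l : int * int).

(** The closed walks that cross the torus may be longer than [N * N], so the linear relation must
    pass from short loops to all closed walks. *)
Lemma line_all N (E : int * int -> int * int -> Prop) n0 (mm : 'I_n0 -> nat) (aa bb : 'I_n0 -> int)
    (l1 l2 c : R) : (0 < N)%N ->
  (forall k l a b, E k l -> E (kshift N k a b) (kshift N l a b)) ->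
  (forall m a b k, (0 < m <= N * N)%N -> walk E m k (kshift N k a b) ->
    exists i, [/\ mm i = m, aa i = a & bb i = b]) ->
  (forall i, l1 * (aa i)%:~R + l2 * (bb i)%:~R = c * (mm i)%:R) ->
  forall m a b k, walk E m k (kshift N k a b) -> l1 * a%:~R + l2 * b%:~R = c * m%:R.
Proof.
move=> N0 Eshift loops hl m; have [j] := ubnP m; elim: j m => // j IH m mj a b k w.
case: (leqP m (N * N)) => mV.
  case: m mj w mV => [|m] mj w mV.
    have [] : a = 0 /\ b = 0.
      have /= e := w; have := congr1 fst e; have := congr1 snd e; rewrite /kshift /=.
      by move: N0; clear; case: N => // N' _; nia.
    by move=> -> ->; rewrite !mulr0 addr0.
  by have [i [<- <- <-]] := loops m.+1 a b k ltac:(by []) w; exact: hl.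
have [i [m' [r [d [a' [b' [w1 w2 w3 mE /andP[m0 mV']]]]]]]] := walk_loop N0 Eshift w (ltnW mV).
have [i0 [e1 e2 e3]] := loops m' a' b' d ltac:(by rewrite m0) w2.
have w' : walk E (i + r) k (kshift N k (a - a') (b - b')).
  apply: (walk_cat w1); have := walk_shift Eshift (- a') (- b') w3.
  by rewrite (kshiftK N0) (kshift_add N0).
have := IH (i + r)%N ltac:(lia) _ _ _ w'; have := hl i0.
rewrite e1 e2 e3 !intrB mE !natrD; lra.
Qed.

Lemma loops_interior area N F n0 (mm : 'I_n0 -> nat) (aa bb : 'I_n0 -> int) : (4 <= N)%N ->
  inH area F -> area -> (0 < n0)%N -> (forall i, (0 < mm i)%N) ->
  (forall k l, Ecl N F k l -> Eint N F k l) ->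
  (forall m a b k, (0 < m <= N * N)%N -> walk (Eint N F) m k (kshift N k a b) ->
    exists i, [/\ mm i = m, aa i = a & bb i = b]) ->
  nonempty_interior (hull (loop_pt R mm aa bb)).
Proof.
move=> N4 hF ar n00 mm0 clE loops; have N0 : (0 < N)%N by exact: leq_trans N4.
pose p := loop_pt R mm aa bb.
apply: contrapT => ni.
have det (i0 i1 i2 : 'I_n0) : ((p i1).1 - (p i0).1) * ((p i2).2 - (p i0).2) -
    ((p i1).2 - (p i0).2) * ((p i2).1 - (p i0).1) = 0.
  by apply/eqP/negPn/negP => /hull_interior.
pose i0 := Ordinal n00.
have pline (l1 l2 c : R) : (forall i, l1 * (p i).1 + l2 * (p i).2 = c) -> l1 = 0 /\ l2 = 0.
  move=> hp; apply: (@line_trivial R N N4 F (inH_cont hF) (inH_equiv hF) (hF.2 ar) clE l1 l2 c).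
  apply: (@line_all N (Eint N F) n0 mm aa bb l1 l2 c N0) => //.
    by move=> k l a b; apply: Eint_shift; exact: inH_equiv hF.
  move=> i; rewrite -(hp i) /p /loop_pt /=.
  by field; rewrite pnatr_eq0 -lt0n.
(* The means lie on one line: either they all coincide, and a vertical line serves, or two distinct
   ones give its normal vector. *)
have [[i1 ni1]|all] := pselect (exists i1, p i1 <> p i0); last first.
  have [] := pline 1 0 (p i0).1; last by move=> /eqP; rewrite oner_eq0.
  move=> i; rewrite mul1r mul0r addr0.
  by have -> : p i = p i0 by apply: contrapT => h; apply: all; exists i.
have [] := pline (- ((p i1).2 - (p i0).2)) ((p i1).1 - (p i0).1)
    (- ((p i1).2 - (p i0).2) * (p i0).1 + ((p i1).1 - (p i0).1) * (p i0).2).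
  by move=> i; have := det i0 i1 i; lra.
move=> e2 e1; apply: ni1; rewrite [p i1]surjective_pairing [p i0]surjective_pairing.
by congr pair; lra.
Qed.

Lemma cellpres_near N h : (0 < N)%N -> cellpres N h -> forall z : pt R, near2 (N%:R^-1) z (h z).
Proof.
move=> N0 ch z; have [k kz] := cell_ex N z; have n0 : 0 < N%:R :> R by rewrite ltr0n.
have [h1 h2 h3 h4] := kz; have [g1 g2 g3 g4] : cellc N k (h z) by apply/(ch k z).2.
have sc (x y : R) : N%:R * x - N%:R * y <= 1 -> x - y <= N%:R^-1.
  by move=> xy; rewrite -[leRHS]mul1r ler_pdivlMr// mulrC mulrBr.
by apply/near2P; split; apply: sc; lra.
Qed.

Lemma stable_approx area F (e : R) : inH area F -> 0 < e ->
  exists G (P : set (pt R)) (d : R), [/\ inH area G, forall z, near2 e (G z) (F z), 0 < d,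
    forall G', inH area G' -> (forall z, near2 d (G' z) (G z)) -> rotation_set G' = P &
    rational_polygon P /\ (area -> nonempty_interior P)].
Proof.
move=> hF e0; have e3 : 0 < e / 3 by lra.
have [N' hN'] := nat_large (3 / e).
pose N := maxn 4 N'; have N4 : (4 <= N)%N by rewrite leq_maxl.
have N0 : (0 < N)%N by exact: leq_trans N4.
(* [h] moves points only inside their cells, so the mesh bounds its share of the error; the other
   two thirds go to [max_graph] and [robust_all]. *)
have Ne : N%:R^-1 <= e / 3.
  have : 3 / e <= N%:R by apply: hN'; rewrite leq_maxr.
  have n0 : 0 < N%:R :> R by rewrite ltr0n.
  rewrite ler_pdivrMr// => h; rewrite -[leLHS]mul1r ler_pdivrMr//; lra.
have [F1 [M [d1 [hF1 nF1 d10 clE bE]]]] := max_graph N0 hF e3.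
have clE1 k l : Ecl N F1 k l -> Eint N F1 k l.
  by apply: clE => // z; apply: near2_refl; exact: ltW.
have Esh k l a b : Eint N F1 k l -> Eint N F1 (kshift N k a b) (kshift N l a b).
  by apply: Eint_shift; exact: inH_equiv hF1.
have [n0 [mm [aa [bb [lp1 lp2]]]]] := loops_enum N0 bE.
have mm0 i : (0 < mm i)%N by have [/andP[]] := lp1 i.
have [F1' [cF1' [F1K F1K']]] : exists F1', cont2 F1' /\ cancel F1 F1' /\ cancel F1' F1.
  by have [[[_ [G [/cont2P cG [h1 h2]]]] _] _] := hF1; exists G.
have [h [X [sh ch hX Xm Xgp]]] := realize_loops N4 mm0 (inH_cont hF1) cF1' F1K F1K'
  (fun i => (lp1 i).2).
have [h' [sh' hK h'K]] := shmap_inv sh; have [L L0 hL] := shmap_lip sh'.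
pose G0 := h \o F1; have hG0 : inH area G0 by exact: shmap_inH.
(* [L] is a Lipschitz constant of the inverse of [h]: a map within [d2] of [G0] comes within [d1] of
   [F1] once [h] is undone. *)
pose d2 := d1 / (L + 1).
have d20 : 0 < d2 by rewrite divr_gt0//; lra.
have Ld2 : L * d2 <= d1.
  by rewrite /d2 mulrA ler_pdivrMr ?[d1 * _]mulrC ?ler_wpM2r ?(ltW d10)//; lra.
have graph G' : inH area G' -> (forall z, near2 d2 (G' z) (G0 z)) ->
    forall k l, Ecl N G' k l -> Eint N F1 k l.
  move=> iG' nG' k l [z kz lz]; apply: (clE (h' \o G')); first exact: shmap_inH.
    move=> w; apply: near2_le Ld2 _; rewrite -(hK (F1 w)).
    by apply: hL; exact: nG'.
  by exists z => //; rewrite -[G' z]h'K in lz; apply/(ch l (h' (G' z))).2.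
pose dl := Num.min (e / 3) (d2 / 2).
have dl0 : 0 < dl by rewrite lt_min e3 divr_gt0.
have [G2 [d3 [iG2 nG2 d30 rob]]] := robust_all mm0 hG0 dl0 hX Xm Xgp.
have near_G0 G' : (forall z, near2 (d2 / 2) (G' z) (G2 z)) -> forall z, near2 d2 (G' z) (G0 z).
  move=> nG' z; have -> : d2 = d2 / 2 + d2 / 2 by lra.
  by apply: near2_trans (nG' z) (near2_le _ (nG2 z)); rewrite ge_min lexx orbT.
have n00 : (0 < n0)%N.
  by apply: (@loop_index R N N0 (Eint N F1) Esh n0 mm aa bb lp2 F1 clE1).
exists G2, (hull (loop_pt R mm aa bb)), (Num.min d3 (d2 / 2)); split => //.
- move=> z; have -> : e = e / 3 + (e / 3 + e / 3) by lra.
  apply: near2_trans (near2_le _ (nG2 z)) _; first by rewrite ge_min lexx.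
  apply: near2_trans (nF1 z); apply: near2_le Ne _; apply: near2_sym.
  exact: cellpres_near.
- by rewrite lt_min d30 divr_gt0.
- move=> G' iG' nG'.
  have nG2' z : near2 (d2 / 2) (G' z) (G2 z) by apply: near2_le (nG' z); rewrite ge_min lexx orbT.
  have nG3' z : near2 d3 (G' z) (G2 z) by apply: near2_le (nG' z); rewrite ge_min lexx.
  apply/seteqP; split.
    by apply: (rot_sub_hull N0 Esh bE mm0 lp2); exact: graph iG' (near_G0 G' nG2').
  move=> x hx; apply: realized_rot.
  have cG' := inH_cont iG'; have eG' := inH_equiv iG'.
  apply: (@closed_mid_hull R (realized G') n0 (loop_pt R mm aa bb)) hx.
  + by move=> y; exact: realized_closed.
  + by move=> y y'; apply: realized_mid => //; exact: inH_inj iG'.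
  + move=> i; have [z hz] := rob G' cG' nG3' i.
    exact: (realized_periodic eG' (mm0 i) hz).
- split; first exact: hull_rational.
  by move=> ar; exact: (loops_interior N4 hF1 ar n00 mm0 clE1 lp2).
Qed.

End Key.

(** * The C^0 distance on the torus *)

Section Distance.
Variable R : realType.
Implicit Types (x y z w : pt R) (F G : pt R -> pt R).

Lemma enorm_le x : enorm x <= `|x.1| + `|x.2|.
Proof.
have h : 0 <= `|x.1| + `|x.2| by rewrite addr_ge0.
rewrite /enorm -[leRHS](ger0_norm h) -sqrtr_sqr; apply: ler_wsqrtr.
rewrite sqrrD !real_normK ?num_real// -addrA lerD2l.
by rewrite lerDr mulrn_wge0// mulr_ge0.
Qed.

Lemma tdist_le x y (a b : int) : tdist x y <= enorm (psub (psub x y) (zvec R a b)).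
Proof.
apply: ge_inf; last by exists a => //; exists b.
by exists 0 => _ [a' _ [b' _ <-]]; exact: sqrtr_ge0.
Qed.

Lemma tdist_le2 x y : tdist x y <= 2.
Proof.
apply: (le_trans (tdist_le x y (Num.floor (x.1 - y.1)) (Num.floor (x.2 - y.2)))).
apply: (le_trans (enorm_le _)) => /=.
have h (u : R) : `|u - (Num.floor u)%:~R| <= 1.
  by have := floor_itv u; rewrite intrD => /andP[? ?]; rewrite ler_norml; apply/andP; split; lra.
by have := h (x.1 - y.1); have := h (x.2 - y.2); lra.
Qed.

Lemma dC0_le F G (d : R) (a b : int) :
  (forall z, near2 d (G z) (padd (F z) (zvec R a b))) -> dC0 F G <= 2 * d.
Proof.
move=> h; apply: ge_sup; first by exists (tdist (F (0, 0)) (G (0, 0))); exists (0, 0).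
move=> _ [z _ <-]; apply: (le_trans (tdist_le _ _ (- a) (- b))).
apply: (le_trans (enorm_le _)); have [h1 h2] := h z.
rewrite /= !intrN !opprK; move: h1 h2 => /=; rewrite distrC (distrC (G z).2).
by rewrite [(F z).1 + _ - _]addrAC [(F z).2 + _ - _]addrAC; lra.
Qed.

Lemma dC0_pointwise F G (d : R) z : dC0 F G < d -> exists a b : int,
  near2 d (G z) (padd (F z) (zvec R a b)).
Proof.
move=> h; have /le_lt_trans /(_ h) : tdist (F z) (G z) <= dC0 F G.
  by apply: ub_le_sup; [exists 2 => _ [w _ <-]; exact: tdist_le2 | exists z].
move=> /inf_lt[|_ [a _ [b _ <-]] hab].
  by exists (enorm (psub (psub (F z) (G z)) (zvec R 0 0))); exists 0 => //; exists 0.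
have [h1 h2] := enorm_ge (psub (psub (F z) (G z)) (zvec R a b)).
have {}h1 := le_trans h1 (ltW hab); have {}h2 := le_trans h2 (ltW hab).
exists (- a), (- b); move: h1 h2; rewrite /= !ler_norml => /andP[? ?] /andP[? ?].
by apply/near2P; rewrite /= !intrN; split; lra.
Qed.

(** Staying within 1/4 of the integers excludes half-integer values, so the intermediate value
    theorem forbids a change of nearest integer. *)
Lemma near_integer_const (f : R -> R) (a b : int) : continuous f ->
  (forall t, exists c : int, `|f t - c%:~R| <= 1 / 4) ->
  `|f 0 - a%:~R| <= 1 / 4 -> `|f 1 - b%:~R| <= 1 / 4 -> a = b.
Proof.
move=> cf hf ha hb; apply: contrapT => /eqP nab.
move: ha hb; rewrite !ler_norml => /andP[a1 a2] /andP[b1 b2].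
pose m := Num.min a b; pose v : R := m%:~R + 1 / 2.
have v1 : Num.min (f 0) (f 1) <= v <= Num.max (f 0) (f 1).
  rewrite /v /m; have : (a + 1 <= b) || (b + 1 <= a) by lia.
  rewrite ge_min le_max => /orP[] h.
    have -> : Num.min a b = a by lia.
    rewrite -(ler_int R) intrD in h.
    by apply/andP; split; apply/orP; [left; lra | right; lra].
  have -> : Num.min a b = b by lia.
  rewrite -(ler_int R) intrD in h.
  by apply/andP; split; apply/orP; [right; lra | left; lra].
have [t _ ft] := IVT ler01 (continuous_subspaceT cf) v1.
have [c] := hf t; rewrite ft /v ler_norml => /andP[c1 c2].
have e : c = m by apply: (@int_eq_lt1 R); lra.
by rewrite e in c1 c2; lra.
Qed.

(** [dC0] compares lifts modulo integers point by point. Below 1/4 the integer vector cannot change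
    along the segment from the origin, so one vector serves the whole plane. *)
Lemma dC0_lift area F G (d : R) : inH area F -> inH area G -> d <= 1 / 4 -> dC0 F G < d ->
  exists a b : int, forall z, near2 d (G z) (padd (F z) (zvec R a b)).
Proof.
move=> hF hG d4 h.
have [a [b hab]] := dC0_pointwise (0, 0) h.
exists a, b => z; have [a' [b' hab']] := dC0_pointwise z h.
pose c (t : R) : pt R := (t * z.1, t * z.2).
have cc : continuous c.
  move=> t; apply: cvg_to_pt; apply: cvgM; (try exact: cvg_id); exact: cvg_cst.
have cFc : continuous (F \o c).
  by move=> t; apply: continuous_comp; [exact: cc | apply/(cont2P F).2; exact: inH_cont hF].
have cGc : continuous (G \o c).
  by move=> t; apply: continuous_comp; [exact: cc | apply/(cont2P G).2; exact: inH_cont hG].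
have c0 : c 0 = (0, 0) by rewrite /c !mul0r.
have c1 : c 1 = z by rewrite /c !mul1r -surjective_pairing.
have e1 : a = a'.
  apply: (@near_integer_const (fun t => (G (c t)).1 - (F (c t)).1)).
  - move=> t; apply: cvgB; [apply: (cvg_comp _ _ (cGc t)) | apply: (cvg_comp _ _ (cFc t))];
      exact: cvg_fst.
  - move=> t; have [u [v [huv _]]] := dC0_pointwise (c t) h; exists u.
    by apply: le_trans d4; move: huv; rewrite /= opprD addrA.
  - by rewrite c0; case: hab => h1 _; apply: le_trans d4; move: h1; rewrite /= opprD addrA.
  - by rewrite c1; case: hab' => h1 _; apply: le_trans d4; move: h1; rewrite /= opprD addrA.
have e2 : b = b'.
  apply: (@near_integer_const (fun t => (G (c t)).2 - (F (c t)).2)).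
  - move=> t; apply: cvgB; [apply: (cvg_comp _ _ (cGc t)) | apply: (cvg_comp _ _ (cFc t))];
      exact: cvg_snd.
  - move=> t; have [u [v [_ huv]]] := dC0_pointwise (c t) h; exists v.
    by apply: le_trans d4; move: huv; rewrite /= opprD addrA.
  - by rewrite c0; case: hab => _ h1; apply: le_trans d4; move: h1; rewrite /= opprD addrA.
  - by rewrite c1; case: hab' => _ h1; apply: le_trans d4; move: h1; rewrite /= opprD addrA.
by rewrite e1 e2.
Qed.

Lemma rot_translate_sub G (a b : int) w : Zequivariant G -> rotation_set G w ->
  rotation_set (fun z => padd (G z) (zvec R a b)) (padd w (zvec R a b)).
Proof.
move=> eG [z [n [hn cw]]]; exists z, n; split => //.
have it (m : nat) p : iter m (fun z => padd (G z) (zvec R a b)) p =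
    padd (iter m G p) (zvec R (a * m%:Z) (b * m%:Z)).
  elim: m => [|m IH]; first by rewrite !mulr0 /padd /= !addr0 -surjective_pairing.
  rewrite iterS IH eG /padd /= -addn1 PoszD !mulrDr !mulr1 !intrD.
  by congr pair; ring.
apply: cvg_near2 => e e0; have [K hK] := cvg_near2P cw e0; have [K' hK'] := hn 1%N.
exists (maxn K K') => k; rewrite geq_max => /andP[/hK nk /hK' n1].
have n0 : (n k)%:R != 0 :> R by rewrite pnatr_eq0 -lt0n.
suff -> : pscale (n k)%:R^-1 (psub (iter (n k) (fun z0 => padd (G z0) (zvec R a b)) (z k)) (z k)) =
    padd (pscale (n k)%:R^-1 (psub (iter (n k) G (z k)) (z k))) (zvec R a b) by rewrite near2_padd.
rewrite it /pscale /psub /padd /= !intrM -[((n k)%:Z)%:~R]/((n k)%:R).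
by congr pair; field.
Qed.

Lemma rot_translate G (a b : int) : Zequivariant G ->
  rotation_set (fun z => padd (G z) (zvec R a b)) = translate (rotation_set G) (zvec R a b).
Proof.
move=> eG; apply/seteqP; split; last by move=> _ [w hw <-]; exact: rot_translate_sub.
move=> w hw; exists (padd w (zvec R (- a) (- b))); last first.
  by rewrite /padd /= !intrN !subrK -surjective_pairing.
have eG' : Zequivariant (fun z => padd (G z) (zvec R a b)).
  by move=> u v z; rewrite eG /padd /=; congr pair; ring.
have := rot_translate_sub (- a) (- b) eG' hw; congr rotation_set.
by apply/funext => z; rewrite /padd /= !intrN !addrK -surjective_pairing.
Qed.

Lemma translate_add (A : set (pt R)) (a b a' b' : int) :
  translate (translate A (zvec R a b)) (zvec R a' b') = translate A (zvec R (a + a') (b + b')).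
Proof.
apply/seteqP; split => [_ [_ [x Ax <-] <-]|_ [x Ax <-]].
  by exists x => //; rewrite /padd /= !intrD !addrA.
by exists (padd x (zvec R a b)); [exists x | rewrite /padd /= !intrD !addrA].
Qed.

Lemma translate0 (A : set (pt R)) : translate A (zvec R 0 0) = A.
Proof.
apply/seteqP; split => [_ [x Ax <-]|x Ax]; first by rewrite /padd /= !addr0 -surjective_pairing.
by exists x => //; rewrite /padd /= !addr0 -surjective_pairing.
Qed.

Lemma rational_polygon_translate (A : set (pt R)) (a b : int) : rational_polygon A ->
  rational_polygon (translate A (zvec R a b)).
Proof.
move=> [n [p [n0 ->]]]; exists n, (fun i => ((p i).1 + a%:~R, (p i).2 + b%:~R)); split => //.
have e (l : 'I_n -> R) (q : 'I_n -> rat) (c : int) : \sum_(i < n) l i = 1 ->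
    \sum_(i < n) l i * ratr (q i + c%:~R) = \sum_(i < n) l i * ratr (q i) + c%:~R.
  move=> l1; under eq_bigr do rewrite rmorphD /= ratr_int mulrDr.
  by rewrite big_split /= -mulr_suml l1 mul1r.
apply/seteqP; split.
  by move=> _ [_ [l [l0 [l1 ->]]] <-]; exists l; split => //; split => //; rewrite !e.
move=> _ [l [l0 [l1 ->]]]; rewrite !e//.
exists (\sum_(i < n) l i * ratr (p i).1, \sum_(i < n) l i * ratr (p i).2) => //.
by exists l.
Qed.

Lemma interior_translate (A : set (pt R)) (a b : int) : nonempty_interior A ->
  nonempty_interior (translate A (zvec R a b)).
Proof.
move=> [w [e [e0 h]]]; exists (padd w (zvec R a b)), e; split => // x hx.
exists (padd x (zvec R (- a) (- b))); last by rewrite /padd /= !intrN !subrK -surjective_pairing.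
apply: h; move: hx; congr (enorm _ < _); rewrite /psub /padd /= !intrN.
by congr pair; ring.
Qed.

Lemma same_rot_trans F G K : same_rot_mod_Z2 F G -> same_rot_mod_Z2 F K -> same_rot_mod_Z2 G K.
Proof.
move=> [a [b h]] [a' [b' h']]; exists (- a + a'), (- b + b').
by rewrite h' h translate_add !addrA !subrr !add0r.
Qed.

End Distance.

Theorem theorem1p1 (R : realType) (area : bool) :
  (* the set of f in H with stable rotation set is open in H *)
  (forall F : pt R -> pt R, inH area F -> stable area F ->
     exists e : R, 0 < e /\
       (forall G, inH area G -> dC0 F G < e -> stable area G)) /\
  (* ... and dense in H *)
  (forall F : pt R -> pt R, inH area F -> forall e : R, 0 < e ->
     exists G, inH area G /\ dC0 F G < e /\ stable area G) /\
  (* rotation sets of such f are rational polygons, with nonempty interior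
     in the area-preserving case *)
  (forall F : pt R -> pt R, inH area F -> stable area F ->
     rational_polygon (rotation_set F) /\
     (area -> nonempty_interior (rotation_set F))).
Proof.
have small F G (e : R) : 0 < e -> (forall z, near2 (e / 4) (G z) (F z)) -> dC0 F G < e.
  move=> e0 h; apply: (@le_lt_trans _ _ (2 * (e / 4))); last by lra.
  by apply: (@dC0_le R F G (e / 4) 0 0) => z; rewrite /padd /= !addr0 -surjective_pairing.
split; [|split].
- move=> F hF [d [d0 sd]].
  (* Through lifts, a map within [e] of [G] is within [2 * e] of a translate of [F], and [dC0_le]
     doubles this: [4 * e] is at most [d / 2]. *)
  pose e := Num.min (d / 8) (1 / 8).
  have e0 : 0 < e by rewrite lt_min; apply/andP; split; lra.
  have ed : e <= d / 8 by rewrite ge_min lexx.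
  have e8 : e <= 1 / 8 by rewrite ge_min lexx orbT.
  exists e; split => // G hG FG; exists e; split => // K hK GK.
  have e4 : e <= 1 / 4 by lra.
  have [a [b h1]] := dC0_lift hF hG e4 FG.
  have [a' [b' h2]] := dC0_lift hG hK e4 GK.
  apply: (@same_rot_trans R F); apply: sd => //; first by lra.
  have h3 z : near2 (e + e) (K z) (padd (F z) (zvec R (a + a') (b + b'))).
    apply: near2_trans (h2 z) _; have := (near2_padd e (G z) (padd (F z) (zvec R a b)) (zvec R a' b')).2 (h1 z).
    by rewrite /padd /= !intrD !addrA.
  by apply: (le_lt_trans (dC0_le h3)); lra.
- move=> F hF e e0; have e4 : 0 < e / 4 by lra.
  have [G [P [d [hG nG d0 rotG _]]]] := stable_approx hF e4.
  exists G; split => //; split; first exact: small.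
  exists (Num.min d (1 / 4)); split; first by rewrite lt_min d0; lra.
  move=> K hK GK.
  have m4 : Num.min d (1 / 4) <= 1 / 4 by rewrite ge_min lexx orbT.
  have [a [b h]] := dC0_lift hG hK m4 GK.
  exists a, b.
  (* [K] may be an integer translation away from [G]; [K'] is the lift of the same torus map that is
     close to [G]. *)
  pose K' := (fun z : pt R => (z.1 + (- a)%:~R, z.2 + (- b)%:~R)) \o K.
  have hK' : inH area K' by apply: shmap_inH => //; exact: shmap_translate.
  have rK' : rotation_set K' = P.
    apply: rotG => // z; have /near2P /= [? ? ? ?] := h z.
    have dd : Num.min d (1 / 4) <= d by rewrite ge_min lexx.
    by apply: near2_le dd _; apply/near2P; rewrite /K' /= !intrN; split; lra.
  have rG : rotation_set G = P by apply: rotG => // z; apply: near2_refl; exact: ltW.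
  rewrite rG -rK' -(rot_translate _ _ (inH_equiv hK')); congr rotation_set.
  by apply/funext => z; rewrite /K' /padd /= !intrN !subrK -surjective_pairing.
- move=> F hF [d [d0 sd]]; have d4 : 0 < d / 4 by lra.
  have [G [P [d' [hG nG d'0 rotG [ratP intP]]]]] := stable_approx hF d4.
  have rG : rotation_set G = P by apply: rotG => // z; apply: near2_refl; exact: ltW.
  (* [G] lies within the stability radius of [F], so the rotation set of [F] is the polygon of [G]
     up to an integer translation. *)
  have [a [b e]] := sd G hG (small F G d d0 nG).
  have -> : rotation_set F = translate P (zvec R (- a) (- b)).
    by rewrite -rG e translate_add !subrr translate0.
  split; first exact: rational_polygon_translate.
  by move=> /intP; exact: interior_translate.
Qed.
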